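(* Let $\nu>0$. For any symmetric set $K\subset\mathbf{Z}^2$ and any real divergence-free initial datum $u_0\in H^1(\mathbf{T}^2)$, the initial-value problem $$u_t+u\cdot\nabla u+\nabla p-\nu Yu=0,\qquad \operatorname{div}u=0,\qquad u|_{t=0}=u_0$$ on $\mathbf{T}^2\times[0,\infty)$ has at least one weak solution.
   Context: $\mathbf{T}^2=\mathbf{R}^2/2\pi\mathbf{Z}^2$. Fourier series: $u(x)=\frac1{(2\pi)^2}\sum_{k\in\mathbf{Z}^2}\hat u(k)e^{ik\cdot x}$. A set $K\subset\mathbf{Z}^2$ is symmetric if it is invariant under $k\mapsto-k$. The operator $Y$ (depending on $K$, acting componentwise) is defined by $\widehat{(Yu)}(k)=-|k|^2\hat u(k)$ for $k\notin K$ and $\widehat{(Yu)}(k)=0$ for $k\in K$. A weak solution of the initial-value problem with $u_0\in H^1$ is a function $$u\in C([0,\infty),L^2)\cap L^\infty_t\dot H^1_x\cap\{v:\ Yv\in L^2_tL^2_x\}$$ which satisfies the equation in the sense of distributions for a suitable $p$ and attains the initial datum $u_0$ at $t=0$ (which is meaningful by the continuity of $u(t)$ as an $L^2$-valued function). *)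

(* Defs.v *)
From mathcomp Require Import all_boot all_order all_algebra.
From mathcomp Require Import all_classical all_reals all_analysis.
From mathcomp Require Import complex.

Set Implicit Arguments.
Unset Strict Implicit.
Unset Printing Implicit Defensive.

Import Order.TTheory GRing.Theory Num.Theory.
Import numFieldNormedType.Exports.

Local Open Scope classical_set_scope.
Local Open Scope ring_scope.

(* Functions on T^2 = R^2 / 2 pi Z^2 are 2 pi-periodic functions on R^2,
   integrated over the fundamental cell [0, 2 pi)^2. *)

Definition leb2 {R : realType} := (@lebesgue_measure R \x @lebesgue_measure R)%E.

Definition cell {R : realType} : set (R * R) :=
  `[0, 2 * pi[%classic `*` `[0, 2 * pi[%classic.

Definition periodic2 {R : realType} (f : R * R -> R) : Prop :=
  forall x : R * R,
    f (x.1 + 2 * pi, x.2) = f x /\ f (x.1, x.2 + 2 * pi) = f x.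

Definition normL2sq {R : realType} (f : R * R -> R) : \bar R :=
  (\int[leb2]_(x in cell) (f x ^+ 2)%:E)%E.

Definition inL2 {R : realType} (f : R * R -> R) : Prop :=
  [/\ periodic2 f, measurable_fun cell f & (normL2sq f < +oo)%E].

Definition kdot {R : realType} (k : int * int) (x : R * R) : R :=
  k.1%:~R * x.1 + k.2%:~R * x.2.

Definition ksq {R : realType} (k : int * int) : R :=
  k.1%:~R ^+ 2 + k.2%:~R ^+ 2.

(* \int_{T^2} f(x) e^{- i k.x} dx, with f real valued and e^{- i k.x} split
   into its real and imaginary parts. *)
Definition fourier {R : realType} (f : R * R -> R) (k : int * int) : R[i] :=
  ((\int[leb2]_(x in cell) (f x * cos (kdot k x)))
   -i* (\int[leb2]_(x in cell) (f x * sin (kdot k x))))%C.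

Definition sqmod {R : realType} (z : R[i]) : R := complex.Re z ^+ 2 + complex.Im z ^+ 2.

(* The factor (2 pi)^-2 is that of Parseval's identity for the normalization
   u(x) = (2 pi)^-2 \sum_k \hat u(k) e^{i k.x}. *)
Definition normHdot1sq {R : realType} (f : R * R -> R) : \bar R :=
  (((2 * pi) ^- 2)%:E *
   \esum_(k in [set: int * int]) (ksq k * sqmod (fourier f k))%:E)%E.

Definition inH1 {R : realType} (f : R * R -> R) : Prop :=
  inL2 f /\ (normHdot1sq f < +oo)%E.

Definition symmetricZ2 (K : set (int * int)) : Prop :=
  forall k, K k <-> K (- k).

(* Y is determined by its action on Fourier coefficients, so "g = Y f" is a
   relation between f and the square-integrable function g. *)
Definition is_Y {R : realType} (K : set (int * int)) (f g : R * R -> R) : Prop :=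
  forall k, fourier g k =
    if k \in K then 0 else real_complex R (- ksq k) * fourier f k.

Definition iterD {R : realType} {V : normedModType R} (s : seq V) (f : V -> R) :
    V -> R :=
  foldr (fun v (g : V -> R) => fun z => 'D_v g z) f s.

Definition smooth {R : realType} {V : normedModType R} (f : V -> R) : Prop :=
  forall s : seq V,
    continuous (iterD s f) /\ forall v z, derivable (iterD s f) z v.

Definition e_ {R : realType} (j : 'I_2) : R * R :=
  if j == ord0 then (1, 0) else (0, 1).

Definition partial {R : realType} (j : 'I_2) (psi : R * R -> R) : R * R -> R :=
  fun x => 'D_(e_ j) psi x.

Definition test_space {R : realType} (psi : R * R -> R) : Prop :=
  smooth psi /\ periodic2 psi.

Definition weak_partial {R : realType} (j : 'I_2) (f g : R * R -> R) : Prop :=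
  forall psi, test_space psi ->
    \int[leb2]_(x in cell) (g x * psi x) =
    - \int[leb2]_(x in cell) (f x * partial j psi x).

Definition div_free {R : realType} (v : 'I_2 -> R * R -> R) : Prop :=
  forall psi, test_space psi ->
    \sum_(j < 2) \int[leb2]_(x in cell) (v j x * partial j psi x) = 0.

(* Space-time points are (t, x) : R * (R * R). *)

Definition dt {R : realType} (phi : R * (R * R) -> R) : R * (R * R) -> R :=
  fun z => 'D_((1, 0) : R * (R * R)) phi z.

Definition dx {R : realType} (j : 'I_2) (phi : R * (R * R) -> R) :
    R * (R * R) -> R :=
  fun z => 'D_((0, e_ j) : R * (R * R)) phi z.

Definition supported_in {R : realType} (a b : R) (phi : R * (R * R) -> R) :=
  forall t x, ~~ (a <= t <= b) -> phi (t, x) = 0.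

(* C_c^oo((0, oo) x T^2): since T^2 is compact, compact support only constrains
   the time variable. *)
Definition test_spacetime {R : realType} (phi : R * (R * R) -> R) : Prop :=
  [/\ smooth phi, (forall t, periodic2 (fun x => phi (t, x))) &
      exists a b : R, 0 < a /\ supported_in a b phi].

Definition spacetime_dirs {R : realType} : seq (R * (R * R)) :=
  [:: (1, 0); (0, e_ ord0); (0, e_ ord_max)].

(* Distributions on (0, oo) x T^2: linear forms on test functions that, on those
   supported in a fixed [a, b] x T^2, are bounded by a C^N norm. *)
Definition distribution {R : realType} (p : (R * (R * R) -> R) -> R) : Prop :=
  (forall (c : R) phi psi, test_spacetime phi -> test_spacetime psi ->
     p (fun z => c * phi z + psi z) = c * p phi + p psi) /\
  (forall a b : R, 0 < a -> exists (C : R) (N : nat),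
     forall phi (M : R), test_spacetime phi -> supported_in a b phi ->
       (forall s : seq (R * (R * R)), (size s <= N)%N ->
          {subset s <= spacetime_dirs} -> forall z, `|iterD s phi z| <= M) ->
       `|p phi| <= C * M).

(* The distribution on (0, oo) x T^2 attached to a curve t |-> f t of functions
   on T^2. *)
Definition pairing {R : realType} (f : R -> R * R -> R)
    (phi : R * (R * R) -> R) : R :=
  \int[lebesgue_measure]_(t in `]0, +oo[%classic)
    (\int[leb2]_(x in cell) (f t x * phi (t, x))).

Definition in_C_L2 {R : realType} (f : R -> R * R -> R) : Prop :=
  (forall t, 0 <= t -> inL2 (f t)) /\
  (forall t, 0 <= t ->
     normL2sq (fun x => f s x - f t x) @[s --> within `[0, +oo[ (nbhs t)]
       --> 0%E).

Definition in_Linfty_Hdot1 {R : realType} (f : R -> R * R -> R) : Prop :=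
  exists M : R, {ae lebesgue_measure,
    forall t : R, 0 <= t -> (normHdot1sq (f t) <= M%:E)%E}.

Definition in_L2_L2 {R : realType} (f : R -> R * R -> R) : Prop :=
  {ae lebesgue_measure, forall t : R, 0 <= t -> inL2 (f t)} /\
  (\int[lebesgue_measure]_(t in [set t : R | (0 <= t)%R]) normL2sq (f t)
     < +oo)%E.

(* Du i j is the x_j-derivative of the i-th component of u. *)
Definition is_gradient {R : realType} (u : R -> 'I_2 -> R * R -> R)
    (Du : 'I_2 -> 'I_2 -> R -> R * R -> R) : Prop :=
  {ae lebesgue_measure, forall t : R, 0 <= t -> forall i j,
    inL2 (Du i j t) /\ weak_partial j (u t i) (Du i j t)}.

Definition is_Yu {R : realType} (K : set (int * int))
    (u : R -> 'I_2 -> R * R -> R) (Yu : 'I_2 -> R -> R * R -> R) : Prop :=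
  forall i, in_L2_L2 (Yu i) /\
    {ae lebesgue_measure, forall t : R, 0 <= t -> is_Y K (u t i) (Yu i t)}.

(* u_t + u . grad u + grad p - nu Y u = 0 and div u = 0, as distributions on
   (0, oo) x T^2; the derivatives of u in u_t and div u and that of p are moved
   to the test function, while u . grad u and Y u are locally integrable. *)
Definition solves_eq {R : realType} (nu : R) (u : R -> 'I_2 -> R * R -> R)
    (Du : 'I_2 -> 'I_2 -> R -> R * R -> R) (Yu : 'I_2 -> R -> R * R -> R)
    (p : (R * (R * R) -> R) -> R) : Prop :=
  (forall i phi, test_spacetime phi ->
     - pairing (fun t => u t i) (dt phi)
     + pairing (fun t x => \sum_(j < 2) u t j x * Du i j t x) phi
     - p (dx i phi)
     - nu * pairing (Yu i) phi = 0) /\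
  (forall phi, test_spacetime phi ->
     \sum_(j < 2) pairing (fun t => u t j) (dx j phi) = 0).

Record weak_solution {R : realType} (nu : R) (K : set (int * int))
    (u0 : 'I_2 -> R * R -> R) (u : R -> 'I_2 -> R * R -> R) : Prop := {
  ws_continuous : forall i, in_C_L2 (fun t => u t i) ;
  ws_bounded : forall i, in_Linfty_Hdot1 (fun t => u t i) ;
  ws_equation : exists Du Yu p,
    [/\ is_gradient u Du, is_Yu K u Yu, distribution p &
        solves_eq nu u Du Yu p] ;
  ws_initial : forall i, {ae leb2, forall x, cell x -> u 0 i x = u0 i x} }.

(* Main.v *)
Require Import Defs.
From mathcomp Require Import all_boot all_order all_algebra.
From mathcomp Require Import all_classical all_reals all_analysis.
From mathcomp Require Import measurable_realfun.
From mathcomp Require Import complex ring lra zify.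

Set Implicit Arguments.
Unset Strict Implicit.
Unset Printing Implicit Defensive.

Import Order.TTheory GRing.Theory Num.Theory.
Import numFieldNormedType.Exports.

Local Open Scope classical_set_scope.
Local Open Scope ring_scope.

(* The velocity is expanded in the real orthogonal basis [cos (k.x) + sin (k.x)] of the torus, and
   the Leray-projected equation becomes an infinite system of ODEs for its coefficients, which is
   discretized by Fourier truncation and explicit Euler steps.  In dimension two the vortex
   stretching term vanishes, so the enstrophy [\sum_k |k|^2 |v_k|^2] stays bounded (up to the
   error of the Euler scheme, made small by the choice of step), whatever [K] is, and it controls
   the time integral of the dissipation.  A limit is taken along an ultrafilter: each coefficient
   is Lipschitz in time, and the bound in [H^1] gives strong [L^2] convergence at each time
   (Rellich), hence convergence of the convective term.  The pressure is defined by the component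
   of the convective term along [k], and the weak formulation is tested mode by mode, the
   coefficients of a test function being rapidly decreasing uniformly in time. *)

(** * Square-integrable functions on the cell *)

(** The viscosity cannot supply compactness, since [K] may be all of Z^2, which leaves the Euler
    equations. The mean mode, which the enstrophy does not see, is controlled by its conservation.
    One index N governs the number of modes, the Euler step and the time horizon, so that a single
    limit suffices; along an ultrafilter it exists at all times simultaneously, without extracting
    subsequences. To recover the time derivative, convergence must hold jointly in N and in time,
    and this is what the Lipschitz bounds are for. Two defects of regularity shape the weak
    formulation. The convective term is a product of two square-integrable functions, so only
    integrable in x, and it is paired with absolutely convergent Fourier series. The field Yu exists
    only for almost every t, because only the time integral of the dissipation is finite. Fields are
    recovered from their coefficients time by time, and measurability in time is checked on the
    coefficients and on series of them. *)

Section L2_cell.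
Context {R : realType}.
Implicit Types (f g b : R * R -> R) (A B : R).

(* [leb2] lives on the product of two copies of [measurableTypeR R], whose display differs
   from the default one of [R]; the measurable sets are the same. *)
Definition cellR : set (measurableTypeR R * measurableTypeR R) := cell.

Definition mfun2 (f : R * R -> R) :=
  measurable_fun cellR (f : measurableTypeR R * measurableTypeR R -> R).

Definition summable2 f := leb2.-integrable cell (EFin \o f).

Definition sqsummable f := mfun2 f /\ summable2 (fun x => f x ^+ 2).

Definition ip f g : R := \int[leb2]_(x in cell) (f x * g x).

Lemma measurable_cell : measurable cellR.
Proof. by apply: measurableX; exact: measurable_itv. Qed.

#[global] Instance leb2_ae_filter : Filter (almost_everywhere (@leb2 R)).
Proof. exact: (ae_filter_ringOfSetsType (@leb2 R)). Qed.

Lemma leb2_cell : leb2 (@cell R) = ((2 * pi) ^+ 2)%:E.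
Proof.
have E : @lebesgue_measure R `[0, 2 * pi[%classic = (2 * pi)%:E.
  by rewrite lebesgue_measure_itv /= lte_fin mulr_gt0 ?pi_gt0// oppr0 adde0.
apply: (eq_trans (product_measure1E _ _ _ _)); [exact: measurable_itv..|].
by rewrite expr2 EFinM; congr (_ * _)%E; exact: E.
Qed.

Lemma mfun2_cst a : mfun2 (cst a). Proof. exact: measurable_cst. Qed.

Lemma summable2_bounded f B : mfun2 f ->
  (forall x, cell x -> `|f x| <= B) -> summable2 f.
Proof.
move=> mf fB; apply: measurable_bounded_integrable => //.
- exact: measurable_cell.
- by apply: (le_lt_trans (y := ((2 * pi) ^+ 2)%:E)); [rewrite -leb2_cell|exact: ltry].
- exists B; split; first exact: num_real.
  by move=> x Bx y /fB /le_trans; apply; exact: ltW.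
Qed.

Lemma measurable_summable2 f : summable2 f -> mfun2 f.
Proof. by case/integrableP => /measurable_EFinP. Qed.

Lemma summable2D f g : summable2 f -> summable2 g ->
  summable2 (fun x => f x + g x).
Proof.
by move=> If Ig; exact: (integrableD measurable_cell If Ig).
Qed.

Lemma summable2Z a f : summable2 f -> summable2 (fun x => a * f x).
Proof.
by move=> If; exact: (integrableZl measurable_cell a If).
Qed.

Lemma summable2_le f g : mfun2 f -> summable2 g ->
  (forall x, cell x -> `|f x| <= g x) -> summable2 f.
Proof.
move=> mf Ig fg; apply: (le_integrable measurable_cell _ _ Ig) => //.
- exact/measurable_EFinP.
- by move=> x /fg fgx; rewrite /= lee_fin (le_trans fgx)// ler_norm.
Qed.

Lemma summable2_mulb f b B : summable2 f -> mfun2 b ->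
  (forall x, cell x -> `|b x| <= B) -> summable2 (fun x => f x * b x).
Proof.
move=> If mb bB; apply: (@summable2_le _ (fun x => B * `|f x|)).
- apply: measurable_funM => //; exact: measurable_summable2.
- apply: summable2Z; rewrite /summable2 (_ : _ \o _ = abse \o (EFin \o f))//.
  exact: integrable_abse.
- by move=> x cx; rewrite normrM mulrC ler_wpM2r// bB.
Qed.

Lemma sqsummable_bounded f B : mfun2 f ->
  (forall x, cell x -> `|f x| <= B) -> sqsummable f.
Proof.
move=> mf fB; split=> //; apply: (@summable2_bounded _ (B ^+ 2)).
  exact: measurable_funX.
move=> x cx; rewrite normrX; have := fB _ cx => h.
by rewrite lerXn2r ?nnegrE// (le_trans _ h).
Qed.

Lemma sqsummableM f g : sqsummable f -> sqsummable g ->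
  summable2 (fun x => f x * g x).
Proof.
move=> [mf If] [mg Ig].
apply: (@summable2_le _ (fun x => f x ^+ 2 + g x ^+ 2)).
- exact: measurable_funM.
- exact: summable2D.
- move=> x _; rewrite normrM -(real_normK (num_real (f x))) -(real_normK (num_real (g x))).
  have := sqr_ge0 (`|f x| - `|g x|); have := normr_ge0 (f x); have := normr_ge0 (g x).
  nra.
Qed.

Lemma sqsummable_mulb f b B : sqsummable f -> mfun2 b ->
  (forall x, cell x -> `|b x| <= B) -> sqsummable (fun x => f x * b x).
Proof.
move=> [mf If] mb bB; split; first exact: measurable_funM.
rewrite (_ : (fun x => _) = (fun x => f x ^+ 2 * b x ^+ 2)).
  apply: (@summable2_mulb _ _ (B ^+ 2)) => //; first exact: measurable_funX.
  move=> x cx; rewrite normrX; have := bB _ cx => h.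
  by rewrite lerXn2r ?nnegrE// (le_trans _ h).
by apply/funext => x; rewrite exprMn.
Qed.

Lemma sqsummableZ a f : sqsummable f -> sqsummable (fun x => a * f x).
Proof.
move=> [mf If]; split; first exact: measurable_funM.
rewrite (_ : (fun x => _) = (fun x => a ^+ 2 * f x ^+ 2)); first exact: summable2Z.
by apply/funext => x; rewrite exprMn.
Qed.

Lemma sqsummableD f g : sqsummable f -> sqsummable g ->
  sqsummable (fun x => f x + g x).
Proof.
move=> Lf Lg; have [mf If] := Lf; have [mg Ig] := Lg.
split; first exact: measurable_funD.
rewrite (_ : (fun x => _) = (fun x => (f x ^+ 2 + 2 * (f x * g x)) + g x ^+ 2)).
  by do !apply: summable2D => //; apply: summable2Z; exact: sqsummableM.
by apply/funext => x; ring.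
Qed.

Lemma sqsummableB f g : sqsummable f -> sqsummable g ->
  sqsummable (fun x => f x - g x).
Proof.
move=> Lf Lg; rewrite (_ : (fun x => _) = (fun x => f x + (-1) * g x)).
  by apply: sqsummableD => //; exact: sqsummableZ.
by apply/funext => x; rewrite mulN1r.
Qed.

Lemma summable2_sum (I : Type) (s : seq I) (F : I -> R * R -> R) :
  (forall i, summable2 (F i)) -> summable2 (fun x => \sum_(i <- s) F i x).
Proof.
move=> LF; elim: s => [|i s IH].
  rewrite (_ : (fun x => _) = cst 0); last by apply/funext => x; rewrite big_nil.
  by apply: (@summable2_bounded _ 0) => [|x _]; [exact: mfun2_cst|rewrite normr0].
rewrite (_ : (fun x => _) = (fun x => F i x + \sum_(i <- s) F i x)).
  exact: summable2D.
by apply/funext => x; rewrite big_cons.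
Qed.

Definition int2 f : R := \int[leb2]_(x in cell) f x.

Lemma int2D f g : summable2 f -> summable2 g ->
  int2 (fun x => f x + g x) = int2 f + int2 g.
Proof. exact: (RintegralD measurable_cell). Qed.

Lemma int2Z a f : summable2 f -> int2 (fun x => a * f x) = a * int2 f.
Proof. exact: RintegralZl measurable_cell. Qed.

Lemma int2B f g : summable2 f -> summable2 g ->
  int2 (fun x => f x - g x) = int2 f - int2 g.
Proof. exact: RintegralB measurable_cell. Qed.

Lemma int2_sum (I : Type) (s : seq I) (F : I -> R * R -> R) :
  (forall i, summable2 (F i)) ->
  int2 (fun x => \sum_(i <- s) F i x) = \sum_(i <- s) int2 (F i).
Proof.
move=> LF; elim: s => [|i s IH].
  rewrite big_nil (_ : (fun x => _) = cst 0).
    by rewrite /int2 Rintegral_cst ?mul0r//; exact: measurable_cell.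
  by apply/funext => x; rewrite big_nil.
rewrite big_cons -IH -int2D//; last exact: summable2_sum.
by congr int2; apply/funext => x; rewrite big_cons.
Qed.

Lemma int2_ge0 f : (forall x, cell x -> 0 <= f x) -> 0 <= int2 f.
Proof. by move=> f0; apply: fine_ge0; apply: integral_ge0 => x /f0; rewrite lee_fin. Qed.

Lemma le_int2 f g : summable2 f -> summable2 g ->
  (forall x, cell x -> f x <= g x) -> int2 f <= int2 g.
Proof. exact: le_Rintegral measurable_cell. Qed.

Lemma int2_cst a : int2 (cst a) = a * (2 * pi) ^+ 2.
Proof. rewrite /int2 Rintegral_cst; last exact: measurable_cell.
by congr (_ * _); exact: (congr1 fine leb2_cell). Qed.

Lemma eq_int2 f g : (forall x, cell x -> f x = g x) -> int2 f = int2 g.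
Proof. by move=> fg; apply: eq_Rintegral => x; rewrite inE => /fg. Qed.

Lemma le_normr_int2 f : summable2 f -> `|int2 f| <= int2 (fun x => `|f x|).
Proof. exact: le_normr_Rintegral measurable_cell. Qed.

Lemma le_normr_int2_bounded f B : summable2 f ->
  (forall x, cell x -> `|f x| <= B) -> `|int2 f| <= B * (2 * pi) ^+ 2.
Proof.
move=> If fB; apply: (le_trans (le_normr_int2 If)); rewrite -int2_cst.
apply: le_int2 => //.
  rewrite /summable2 (_ : _ \o _ = abse \o (EFin \o f))//.
  exact: integrable_abse.
by apply: (@summable2_bounded _ `|B|) => //; exact: mfun2_cst.
Qed.

Lemma ipE f g : ip f g = int2 (fun x => f x * g x). Proof. by []. Qed.

Lemma ipC f g : ip f g = ip g f.
Proof. by rewrite !ipE; congr int2; apply/funext => x; rewrite mulrC. Qed.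

Lemma ipDl f g h : sqsummable f -> sqsummable g -> sqsummable h ->
  ip (fun x => f x + g x) h = ip f h + ip g h.
Proof.
move=> Lf Lg Lh; rewrite !ipE -int2D; [|exact: sqsummableM..].
by congr int2; apply/funext => x; rewrite mulrDl.
Qed.

Lemma ipBl f g h : sqsummable f -> sqsummable g -> sqsummable h ->
  ip (fun x => f x - g x) h = ip f h - ip g h.
Proof.
move=> Lf Lg Lh; rewrite !ipE -int2B; [|exact: sqsummableM..].
by congr int2; apply/funext => x; rewrite mulrBl.
Qed.

Lemma ipZl a f h : sqsummable f -> sqsummable h ->
  ip (fun x => a * f x) h = a * ip f h.
Proof.
move=> Lf Lh; rewrite !ipE -int2Z; [|exact: sqsummableM..].
by congr int2; apply/funext => x; rewrite mulrA.
Qed.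

Definition nrm f : R := Num.sqrt (ip f f).

Lemma ip_ge0 f : 0 <= ip f f.
Proof. by apply: int2_ge0 => x _; rewrite -expr2 sqr_ge0. Qed.

Lemma nrm_ge0 f : 0 <= nrm f. Proof. exact: sqrtr_ge0. Qed.

Lemma sqr_nrm f : nrm f ^+ 2 = ip f f.
Proof. by rewrite sqr_sqrtr// ip_ge0. Qed.

(* The quadratic [s |-> ||f + s g||^2] is nonnegative. *)
Lemma cauchy_schwarz_sqr f g : sqsummable f -> sqsummable g ->
  ip f g ^+ 2 <= ip f f * ip g g.
Proof.
move=> Lf Lg.
have P s : 0 <= ip f f + 2 * s * ip f g + s ^+ 2 * ip g g.
  have := ip_ge0 (fun x => f x + s * g x).
  have Ls := sqsummableZ s Lg; have Lfs := sqsummableD Lf Ls.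
  rewrite ipDl// ipZl// ![ip _ (fun x => f x + _)]ipC !ipDl// !ipZl// [ip g f]ipC.
  by congr (_ <= _); ring.
have g0 := ip_ge0 g; have f0 := ip_ge0 f.
have [gz|gn0] := eqVneq (ip g g) 0.
  have [->|fgn0] := eqVneq (ip f g) 0; first by rewrite expr0n mulr_ge0.
  (* The quadratic is affine here, and this value of s makes it equal to -1. *)
  have := P (- (ip f f + 1) / (2 * ip f g)).
  rewrite gz mulr0 addr0.
  have -> : 2 * (- (ip f f + 1) / (2 * ip f g)) * ip f g = - (ip f f + 1) by field.
  by move=> H; exfalso; lra.
have gp : 0 < ip g g by rewrite lt_def gn0.
(* The minimizer of the quadratic. *)
have := P (- ip f g / ip g g).
have -> : ip f f + 2 * (- ip f g / ip g g) * ip f g + (- ip f g / ip g g) ^+ 2 * ip g g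
   = (ip f f * ip g g - ip f g ^+ 2) / ip g g by field.
by rewrite pmulr_lge0 ?invr_gt0// subr_ge0.
Qed.

Lemma cauchy_schwarz f g : sqsummable f -> sqsummable g ->
  `|ip f g| <= nrm f * nrm g.
Proof.
move=> Lf Lg; rewrite -sqrtr_sqr /nrm -sqrtrM ?ip_ge0// ler_sqrt ?sqr_ge0//.
  exact: cauchy_schwarz_sqr.
by rewrite mulr_ge0 ?ip_ge0.
Qed.

Lemma nrmD f g : sqsummable f -> sqsummable g ->
  nrm (fun x => f x + g x) <= nrm f + nrm g.
Proof.
move=> Lf Lg; rewrite -(@ler_pXn2r _ 2)// ?nnegrE ?nrm_ge0 ?addr_ge0 ?nrm_ge0//.
rewrite sqr_nrm sqrrD !sqr_nrm.
have Lfg := sqsummableD Lf Lg.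
rewrite ipDl// ![ip _ (fun x => f x + _)]ipC !ipDl// [ip g f]ipC.
have := cauchy_schwarz Lf Lg; rewrite ler_norml => /andP[_].
lra.
Qed.

Lemma nrmBC f g : nrm (fun x => f x - g x) = nrm (fun x => g x - f x).
Proof.
by rewrite /nrm !ipE; congr (Num.sqrt (int2 _)); apply/funext => x; ring.
Qed.

Lemma nrm_mulb f b B : sqsummable f -> mfun2 b -> 0 <= B ->
  (forall x, cell x -> `|b x| <= B) -> nrm (fun x => f x * b x) <= B * nrm f.
Proof.
move=> Lf mb B0 bB; rewrite -(@ler_pXn2r _ 2)// ?nnegrE ?mulr_ge0 ?nrm_ge0//.
rewrite exprMn !sqr_nrm -ipZl// !ipE; have Lfb := sqsummable_mulb Lf mb bB.
apply: le_int2.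
- exact: sqsummableM.
- by apply: sqsummableM => //; exact: sqsummableZ.
- move=> x cx; have : b x ^+ 2 <= B ^+ 2.
    by rewrite -(real_normK (num_real (b x))) lerXn2r ?nnegrE ?bB.
  have := sqr_ge0 (f x); nra.
Qed.

End L2_cell.

(** * Continuous functions on the cell *)

Section Continuous2.
Context {R : realType}.
Implicit Types (f g : R * R -> R).

(** An open set is the union of the rational rectangles that it contains. The other rectangles are
    replaced by the empty set, so that the union runs over a countable type. *)
Lemma open_measurable2 (A : set (R * R)) : open A ->
  measurable (A : set (measurableTypeR R * measurableTypeR R)).
Proof.
move=> oA.
pose F (q : (rat * rat) * (rat * rat)) : set (R * R) :=
  `]ratr q.1.1, ratr q.1.2[%classic `*` `]ratr q.2.1, ratr q.2.2[%classic.
have -> : A = \bigcup_q (if `[< F q `<=` A >] then F q else set0).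
  apply/seteqP; split=> [[x y] Axy|z [q _]]; last first.
    by case: asboolP => // FA /FA.
  have /= [[U V] [/= Ux Vy] UVA] := open_nbhs_nbhs (conj oA Axy).
  have ex (B : set R) (z : R) : nbhs z B -> exists p : rat * rat,
      `]ratr p.1, ratr p.2[%classic z /\ `]ratr p.1, ratr p.2[%classic `<=` B.
    move=> /nbhs_ballP[e /= e0 eB].
    have /rat_in_itvoo[p] : z - e < z by rewrite ltrBlDr ltrDl.
    have /rat_in_itvoo[q] : z < z + e by rewrite ltrDl.
    rewrite !in_itv /= => /andP[q1 q2] /andP[p1 p2].
    exists (p, q) => /=; rewrite in_itv /= p2 q1; split => // w /=.
    rewrite in_itv /= => /andP[w1 w2]; apply: eB; rewrite /ball /= ltr_norml.
    by apply/andP; split; lra.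
  have [p [px pU]] := ex _ _ Ux; have [q [qy qV]] := ex _ _ Vy.
  exists (p, q) => //; rewrite asboolT// => -[z w] /= [? ?].
  by apply: UVA; split; [exact: pU|exact: qV].
apply: countable_bigcupT_measurable; first exact: countableP.
move=> q; case: asboolP => _; last exact: measurable0.
by apply: measurableX; exact: measurable_itv.
Qed.

Lemma continuous_measurable2 f : continuous f ->
  measurable_fun [set: measurableTypeR R * measurableTypeR R] f.
Proof.
move=> /continuousP cf; apply: (measurability _ (RGenOpens.measurableE R)).
move=> _ [_ [a [b ->] <-]]; rewrite setTI; apply: open_measurable2.
exact/cf/interval_open.
Qed.

Lemma continuous_mfun2 f : continuous f -> mfun2 f.
Proof.
move=> /continuous_measurable2 mf; exact: measurable_funS mf.
Qed.

Lemma continuous_bounded_cell f : continuous f ->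
  exists2 B : R, 0 <= B & forall x, cell x -> `|f x| <= B.
Proof.
move=> cf.
(* The cell is half-open; the bound is taken on the closed square, which is compact. *)
have cK : compact (`[0, 2 * pi]%classic `*` `[0, 2 * pi]%classic : set (R * R)).
  by apply: compact_setX; exact: segment_compact.
have cfK : {within (`[0, 2 * pi]%classic `*` `[0, 2 * pi]%classic : set (R * R)),
    continuous f} by exact: continuous_subspaceT.
have /compact_bounded [M [Mr HM]] := continuous_compact cfK cK.
exists (Num.max 0 (M + 1)); first by rewrite le_max lexx.
move=> [x y] [/= ]; rewrite !in_itv /= => /andP[x0 /ltW x1] /andP[y0 /ltW y1].
have : `|f (x, y)| <= M + 1.
  apply: (HM (M + 1)); first by rewrite ltrDl.
  exists (x, y) => //; split => /=; rewrite in_itv /= ?x0 ?y0 //.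
by move=> /le_trans; apply; rewrite le_max lexx orbT.
Qed.

Lemma continuous_sqsummable f : continuous f -> sqsummable f.
Proof.
move=> cf; have [B B0 fB] := continuous_bounded_cell cf.
by apply: (@sqsummable_bounded _ _ B) => //; exact: continuous_mfun2.
Qed.

Lemma continuous_summable2 f : continuous f -> summable2 f.
Proof.
move=> cf; have [B B0 fB] := continuous_bounded_cell cf.
by apply: (@summable2_bounded _ _ B) => //; exact: continuous_mfun2.
Qed.

End Continuous2.

(** * Square truncations of the frequency lattice *)

Notation Z2 := (int * int)%type.

Section Box.
Implicit Types (n : nat) (k : Z2).

Definition zrange n : seq int := [seq i%:Z - n%:Z | i <- iota 0 (2 * n).+1].

(** Symmetric under k -> -k, as required by a basis in which differentiation exchanges k and -k. *)
Definition box n : seq Z2 := [seq (a, b) | a <- zrange n, b <- zrange n].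

Lemma mem_zrange n (a : int) : (a \in zrange n) = (`|a| <= n)%N.
Proof.
apply/mapP/idP => [ [j]|h]; first by rewrite mem_iota => /andP[_ hj] ->; lia.
by exists (absz (a + n%:Z)); [rewrite mem_iota; lia|lia].
Qed.

Lemma uniq_zrange n : uniq (zrange n).
Proof. by rewrite map_inj_uniq ?iota_uniq// => i j; lia. Qed.

Lemma mem_box n k : (k \in box n) = (`|k.1| <= n)%N && (`|k.2| <= n)%N.
Proof.
case: k => a b /=; rewrite -!mem_zrange; apply/allpairsP/andP.
  by move=> [[c d] /= [? ? [-> ->]]].
by move=> [? ?]; exists (a, b).
Qed.

Lemma uniq_box n : uniq (box n).
Proof. by apply: allpairs_uniq; rewrite ?uniq_zrange//; case=> ? ? [? ?] _ _ [-> ->]. Qed.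

Lemma box_opp n k : (- k \in box n) = (k \in box n).
Proof. by rewrite !mem_box /= !abszN. Qed.

Lemma box_leq m n k : (m <= n)%N -> k \in box m -> k \in box n.
Proof. by rewrite !mem_box => mn /andP[h1 h2]; rewrite !(leq_trans _ mn). Qed.

Lemma mem_box_ex (s : seq Z2) : exists n, {subset s <= box n}.
Proof.
elim: s => [|k s [n IH]]; first by exists 0%N.
exists (maxn n (maxn `|k.1| `|k.2|)) => l; rewrite inE => /predU1P[->|/IH].
  by rewrite mem_box; lia.
by apply: box_leq; exact: leq_maxl.
Qed.

Lemma perm_box_opp n : perm_eq [seq - k | k <- box n] (box n).
Proof.
apply: uniq_perm; [by rewrite map_inj_uniq ?uniq_box//; exact: oppr_inj|exact: uniq_box|].
move=> k; apply/mapP/idP => [ [l lb ->]|kb]; first by rewrite box_opp.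
by exists (- k); rewrite ?opprK ?box_opp.
Qed.

Lemma sum_box_opp (V : zmodType) n (F : Z2 -> V) :
  \sum_(k <- box n) F (- k) = \sum_(k <- box n) F k.
Proof. by rewrite -[RHS](perm_big _ (perm_box_opp n)) big_map. Qed.

Lemma sum_box_mono (V : numDomainType) m n (F : Z2 -> V) : (m <= n)%N ->
  (forall k, 0 <= F k) -> \sum_(k <- box m) F k <= \sum_(k <- box n) F k.
Proof.
move=> mn F0; rewrite [leRHS](bigID [in box m]) /=.
rewrite (_ : \sum_(k <- box n | k \in box m) F k = \sum_(k <- box m) F k).
  by rewrite lerDl; apply: sumr_ge0.
rewrite -big_filter; apply: perm_big; apply: uniq_perm.
- by rewrite filter_uniq ?uniq_box.
- exact: uniq_box.
- by move=> k; rewrite mem_filter andb_idr// => /(box_leq mn).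
Qed.

Lemma sum_box_indic (V : zmodType) m n (F : Z2 -> V) : (m <= n)%N ->
  \sum_(k <- box n) (if k \in box m then F k else 0) = \sum_(k <- box m) F k.
Proof.
move=> mn; rewrite -big_mkcond -big_filter; apply: perm_big; apply: uniq_perm.
- by rewrite filter_uniq ?uniq_box.
- exact: uniq_box.
- by move=> k; rewrite mem_filter andb_idr// => /(box_leq mn).
Qed.

End Box.

Arguments box n : simpl never.

(** * Integration by parts and the trigonometric basis *)

Section FTC.
Context {R : realType}.

Lemma is_derive_along (V : normedModType R) (f : V -> R) (x v : V) (s d : R) :
  is_derive (s *: v + x) v f d -> is_derive s 1 (fun h : R => f (h *: v + x)) d.
Proof.
move=> [dv <-].
have E : (fun h : R => h^-1 *: (((fun h => f (h *: v + x)) \o shift s) (h *: (1 : R)) -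
     f (s *: v + x))) =
   (fun h : R => h^-1 *: ((f \o shift (s *: v + x)) (h *: v) - f (s *: v + x))).
  by apply/funext => h /=; rewrite [h *: (1 : R)]mulr1 scalerDl addrA.
split; first by rewrite /derivable E.
by rewrite /derive E.
Qed.

Lemma is_derive_line (V : normedModType R) (f : V -> R) (x v : V) (d : R) :
  is_derive (0 : R) (1 : R) (fun h : R => f (h *: v + x)) d -> is_derive x v f d.
Proof.
move=> [dv <-].
have E : (fun h : R => h^-1 *: (((fun h => f (h *: v + x)) \o shift 0) (h *: (1 : R)) -
     f (0 *: v + x))) =
   (fun h : R => h^-1 *: ((f \o shift x) (h *: v) - f x)).
  by apply/funext => h /=; rewrite [h *: (1 : R)]mulr1 scale0r add0r addr0.
split; first by move: dv; rewrite /derivable E.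
by rewrite /derive E.
Qed.

Lemma is_derive_eqfun (V W : normedModType R) (f g : V -> W) (x v : V) (d e : W) :
  is_derive x v f d -> f =1 g -> d = e -> is_derive x v g e.
Proof. by move=> df /funext <- <-. Qed.

Lemma ftc_itv (g G : R -> R) (a b : R) : a < b -> continuous G ->
  (forall x, is_derive x (1 : R) g (G x)) ->
  (\int[lebesgue_measure]_(x in `[a, b]) (G x)%:E = (g b - g a)%:E)%E.
Proof.
move=> ab cG dg.
have cg x : {for x, continuous g}.
  by apply: differentiable_continuous; apply/derivable1_diffP; case: (dg x).
rewrite EFinB; apply: continuous_FTC2 => //.
- exact: continuous_subspaceT.
- split.
  + by move=> x _; case: (dg x).
  + exact/cvg_at_right_filter/cg.
  + exact/cvg_at_left_filter/cg.
- by move=> x _; rewrite derive1E; case: (dg x).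
Qed.

Lemma ftc_itvco (g G : R -> R) (a b : R) : a < b -> continuous G ->
  (forall x, is_derive x (1 : R) g (G x)) ->
  (\int[lebesgue_measure]_(x in `[a, b[) (G x)%:E = (g b - g a)%:E)%E.
Proof.
move=> ab cG dg; rewrite -(ftc_itv ab cG dg); apply: integral_itv_bndo_bndc.
apply/measurable_EFinP; apply: measurable_funS (continuous_measurable_fun cG) => //.
Qed.

End FTC.

Section IBP.
Context {R : realType}.
Implicit Types (f g F G : R * R -> R) (j : 'I_2) (k : Z2).

(** The derivative is carried as an explicit function, so that sum and product rules can build it by
    unification. *)
Definition C1_dir j F G := [/\ periodic2 F, continuous F, continuous G &
  forall x, is_derive x (@e_ R j) F (G x)].

Lemma int2_iter12 f : summable2 f -> int2 f =
  fine (\int[lebesgue_measure]_x \int[lebesgue_measure]_y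
     ((f (x, y))%:E * (\1_(cell) ((x, y) : R * R))%:E))%E.
Proof.
move=> If; rewrite /int2 /Rintegral; congr fine.
have mc := @measurable_cell R.
rewrite integral_mkcond -integral12_prod_meas1; last first.
  by move/(integrable_mkcond _ mc) : If => If'; exact: If'.
rewrite /fubini_F; apply: eq_integral => x _; apply: eq_integral => y _.
by rewrite patchE indicE; case: ifPn => _; rewrite ?mule1 ?mule0.
Qed.

Lemma int2_iter21 f : summable2 f -> int2 f =
  fine (\int[lebesgue_measure]_y \int[lebesgue_measure]_x
     ((f (x, y))%:E * (\1_(cell) ((x, y) : R * R))%:E))%E.
Proof.
move=> If; rewrite /int2 /Rintegral; congr fine.
have mc := @measurable_cell R.
rewrite integral_mkcond -integral21_prod_meas1; last first.
  by move/(integrable_mkcond _ mc) : If => If'; exact: If'.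
rewrite /fubini_G; apply: eq_integral => x _; apply: eq_integral => y _.
by rewrite patchE indicE; case: ifPn => _; rewrite ?mule1 ?mule0.
Qed.

Lemma is_derive_slice1 j F G (y : R) :
  (forall x, is_derive x (@e_ R j) F (G x)) -> j = ord0 ->
  forall x : R, is_derive x (1 : R) (fun x => F (x, y)) (G (x, y)).
Proof.
move=> dF j0 x; have H := is_derive_along (dF (x *: e_ j + (0, y))).
have E (h : R) : h *: (e_ j : R * R) + (0, y) = (h, y).
  by rewrite /e_ j0 eqxx; congr pair => /=; rewrite ?[h *: _]mulr1 ?addr0// scaler0 add0r.
by apply: (is_derive_eqfun H) => [h|]; [congr F; exact: E|congr G; exact: E].
Qed.

Lemma is_derive_slice2 j F G (y : R) :
  (forall x, is_derive x (@e_ R j) F (G x)) -> j != ord0 ->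
  forall x : R, is_derive x (1 : R) (fun x => F (y, x)) (G (y, x)).
Proof.
move=> dF j0 x; have H := is_derive_along (dF (x *: e_ j + (y, 0))).
have E (h : R) : h *: (e_ j : R * R) + (y, 0) = (y, h).
  by rewrite /e_ (negbTE j0); congr pair => /=; rewrite ?[h *: _]mulr1 ?addr0// scaler0 add0r.
by apply: (is_derive_eqfun H) => [h|]; [congr F; exact: E|congr G; exact: E].
Qed.

(** Fubini with the direction j innermost: the inner integral is the difference of [F] at the two
    ends of a period. *)
Lemma int2_partial j F G : C1_dir j F G -> int2 G = 0.
Proof.
move=> [pF _ cG dF]; have pi0 : 0 < 2 * pi :> R by rewrite mulr_gt0 ?pi_gt0.
have I (g h : R -> R) : continuous h -> (forall x, is_derive x (1 : R) g (h x)) ->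
  g (2 * pi) = g 0 ->
  (\int[lebesgue_measure]_x ((h x)%:E * (\1_(`[0%R, (2 * pi)%R[%classic) x)%:E) = 0)%E.
  move=> ch dg g2; transitivity (\int[lebesgue_measure]_(x in `[0%R, (2 * pi)%R[) (h x)%:E)%E.
    rewrite [RHS]integral_mkcond; apply: eq_integral => x _.
    by rewrite patchE indicE; case: ifPn => _; rewrite ?mule1 ?mule0.
  by rewrite (ftc_itvco pi0 ch dg) g2 subrr.
have IG := continuous_summable2 cG.
have c1 (x : R) : continuous (fun y : R => G (x, y)).
  move=> y; apply: (@cvg_comp _ _ _ (fun y => (x, y)) G _ (nbhs (x, y))); last exact: cG.
  by apply: (@cvg_pair _ _ _ (nbhs y) (nbhs x) (nbhs y)); [exact: cvg_cst|exact: cvg_id].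
have c2 (y : R) : continuous (fun x : R => G (x, y)).
  move=> x; apply: (@cvg_comp _ _ _ (fun x => (x, y)) G _ (nbhs (x, y))); last exact: cG.
  by apply: (@cvg_pair _ _ _ (nbhs x) (nbhs x) (nbhs y)); [exact: cvg_id|exact: cvg_cst].
have [j0|j1] := eqVneq j ord0.
  rewrite int2_iter21//; rewrite (_ : integral _ _ _ = 0%E)//.
  apply: integral0_eq => y _.
  transitivity ((\1_(`[0%R, (2 * pi)%R[%classic) y)%:E * \int[lebesgue_measure]_x
     ((G (x, y))%:E * (\1_(`[0%R, (2 * pi)%R[%classic) x)%:E))%E; last first.
    have per : F (2 * pi, y) = F (0, y) by have [+ _] := pF (0, y); rewrite /= add0r.
    rewrite (I (fun x => F (x, y)) (fun x => G (x, y)) (c2 y) _ per) ?mule0//.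
    exact: (is_derive_slice1 y (fun x => dF x) j0).
  rewrite indicE; case: (boolP (y \in _)) => /= hy.
    rewrite mul1e; apply: eq_integral => x _; congr (_ * (_%:E))%E.
    rewrite !indicE; congr (nat_of_bool _)%:R; apply/idP/idP; rewrite !inE => //.
      by case.
    by split => //=; move: hy; rewrite inE.
  rewrite mul0e; apply: integral0_eq => x _; rewrite indicE memNset ?mule0//.
  by case => /= _; move: hy; rewrite notin_setE.
rewrite int2_iter12//; rewrite (_ : integral _ _ _ = 0%E)//.
apply: integral0_eq => y _.
transitivity ((\1_(`[0%R, (2 * pi)%R[%classic) y)%:E * \int[lebesgue_measure]_x
   ((G (y, x))%:E * (\1_(`[0%R, (2 * pi)%R[%classic) x)%:E))%E; last first.
  have per : F (y, 2 * pi) = F (y, 0) by have [_ +] := pF (y, 0); rewrite /= add0r.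
  rewrite (I (fun x => F (y, x)) (fun x => G (y, x)) (c1 y) _ per) ?mule0//.
  exact: (is_derive_slice2 y (fun x => dF x) j1).
rewrite indicE; case: (boolP (y \in _)) => /= hy.
  rewrite mul1e; apply: eq_integral => x _; congr (_ * (_%:E))%E.
  rewrite !indicE; congr (nat_of_bool _)%:R; apply/idP/idP; rewrite !inE => //.
    by case.
  by split => //=; move: hy; rewrite inE.
rewrite mul0e; apply: integral0_eq => x _; rewrite indicE memNset ?mule0//.
by case => /= + _; move: hy; rewrite notin_setE.
Qed.

End IBP.

Section Trig.
Context {R : realType}.
Implicit Types (f g F G : R * R -> R) (j : 'I_2) (k l : Z2) (x : R * R).

(* Hartley's real form of [e^{i k.x}]: real functions have real coefficients, and the
   [x_j]-derivative maps [cas k] to [k_j cas (- k)]. *)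
Definition cas k x : R := cos (kdot k x) + sin (kdot k x).

Definition kc j k : R := (if j == ord0 then k.1 else k.2)%:~R.

Lemma kcN j k : kc j (- k) = - kc j k.
Proof. by rewrite /kc; case: ifP => _; rewrite /= mulrNz. Qed.

Lemma kdotN k x : kdot (- k) x = - kdot k x.
Proof. by rewrite /kdot /= !mulrNz !mulNr opprD. Qed.

Lemma kdotD k l x : kdot (k + l) x = kdot k x + kdot l x.
Proof. by rewrite /kdot /= !intrD; ring. Qed.

Lemma casN k x : cas (- k) x = cos (kdot k x) - sin (kdot k x).
Proof. by rewrite /cas kdotN cosN sinN. Qed.

Lemma kdot_line k j x (h : R) : kdot k (h *: e_ j + x) = h * kc j k + kdot k x.
Proof.
rewrite /kdot /e_ /kc /=; case: ifP => _ /=.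
  by rewrite scaler0 add0r [h *: _]mulr1; ring.
by rewrite scaler0 add0r [h *: _]mulr1; ring.
Qed.

Lemma is_derive_cas j k x : is_derive x (e_ j) (cas k) (kc j k * cas (- k) x).
Proof.
apply: is_derive_line; rewrite /cas.
under [X in is_derive _ _ X]eq_fun do rewrite kdot_line.
apply: is_derive_eq; rewrite kdotN cosN sinN mul0r add0r !scaler0 !addr0 ![_ *: _]mulr1.
by ring.
Qed.

Lemma continuous_kdot k : continuous (@kdot R k).
Proof.
move=> x; rewrite /kdot; apply: cvgD; apply: cvgM; try exact: cvg_cst.
  exact: cvg_fst.
exact: cvg_snd.
Qed.

Lemma continuous_cas k : continuous (cas k).
Proof.
move=> x; apply: cvgD.
  by apply: continuous_comp; [exact: continuous_kdot|exact: continuous_cos].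
by apply: continuous_comp; [exact: continuous_kdot|exact: continuous_sin].
Qed.

Lemma cas_bound k x : `|cas k x| <= 2.
Proof.
rewrite (le_trans (ler_normD _ _))// (_ : 2 = 1 + 1)//.
by rewrite lerD ?cos_max ?sin_max.
Qed.

Lemma cos_int (a : R) (m : int) : cos (a + m%:~R * (2 * pi)) = cos a.
Proof.
have P (n : nat) b : cos (b + n%:R * (2 * pi)) = cos b :> R.
  elim: n => [|n IH]; first by rewrite mul0r addr0.
  by rewrite -natr1 mulrDl mul1r addrA [2 * pi]mulr_natl cosD2pi -[pi *+ 2]mulr_natl IH.
case: m => n; first exact: P.
rewrite NegzE mulrNz mulNr -(P n.+1 (a - _)) subrK.
by [].
Qed.

Lemma sin_int (a : R) (m : int) : sin (a + m%:~R * (2 * pi)) = sin a.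
Proof.
have P (n : nat) b : sin (b + n%:R * (2 * pi)) = sin b :> R.
  elim: n => [|n IH]; first by rewrite mul0r addr0.
  by rewrite -natr1 mulrDl mul1r addrA [2 * pi]mulr_natl sinD2pi -[pi *+ 2]mulr_natl IH.
case: m => n; first exact: P.
rewrite NegzE mulrNz mulNr -(P n.+1 (a - _)) subrK.
by [].
Qed.

Lemma periodic2_cas k : periodic2 (cas k).
Proof.
move=> [x y]; rewrite /cas /kdot /=; split.
  rewrite (_ : _ + _ = (k.1%:~R * x + k.2%:~R * y) + k.1%:~R * (2 * pi)); last by ring.
  by rewrite cos_int sin_int.
rewrite (_ : _ + _ = (k.1%:~R * x + k.2%:~R * y) + k.2%:~R * (2 * pi)); last by ring.
by rewrite cos_int sin_int.
Qed.

(** Linearization of products. It yields the orthogonality of the basis, and it makes every [cas l]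
    a multiplier in the completeness proof. *)
Lemma casM k l x : cas k x * cas l x =
  2^-1 * ((cas (k - l) x + cas (l - k) x) + (cas (k + l) x - cas (- (k + l)) x)).
Proof.
have -> : l - k = - (k - l) by rewrite opprB.
rewrite !casN /cas !kdotD !kdotN; move: (kdot k x) (kdot l x) => a b.
by rewrite !cosD !sinD cosN sinN; field.
Qed.

Lemma cas0 x : cas 0 x = 1.
Proof. by rewrite /cas /kdot /= !mul0r addr0 cos0 sin0 addr0. Qed.

Lemma sqsummable_cas k : sqsummable (cas k).
Proof. exact/continuous_sqsummable/continuous_cas. Qed.

Lemma summable2_cas k : summable2 (cas k).
Proof. exact/continuous_summable2/continuous_cas. Qed.

(** For k nonzero, [cas k] is up to a nonzero factor a partial derivative of [cas (- k)], so its
    integral over a period vanishes. *)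
Lemma int2_cas k : int2 (cas k) = if k == 0 then (2 * pi) ^+ 2 else 0.
Proof.
case: eqVneq => [->|k0].
  by rewrite (_ : cas 0 = cst 1) ?int2_cst ?mul1r//; apply/funext => x; rewrite cas0.
have [j kj] : exists j, kc j k != 0.
  have : (k.1 != 0) || (k.2 != 0).
    by apply: contraNT k0; rewrite negb_or !negbK -xpair_eqE; case: k.
  by case/orP => h; [exists ord0|exists ord_max]; rewrite /kc /= intr_eq0.
have : int2 (fun x => kc j (- k) * cas (- (- k)) x) = 0.
  apply: (@int2_partial _ j (cas (- k))); split; [exact: periodic2_cas|exact: continuous_cas| |].
    by move=> x; apply: cvgM; [exact: cvg_cst|exact: continuous_cas].
  by move=> x; exact: is_derive_cas.
rewrite opprK int2Z; last exact: summable2_cas.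
by move/eqP; rewrite kcN mulf_eq0 oppr_eq0 (negbTE kj) => /eqP.
Qed.

Lemma ip_cas k l : ip (cas k) (cas l) = if k == l then (2 * pi) ^+ 2 else 0.
Proof.
have Ic := summable2_cas.
rewrite ipE; under [X in int2 X]eq_fun do rewrite casM.
have I1 := summable2D (Ic (k - l)) (Ic (l - k)).
have I2 : summable2 (fun x => cas (k + l) x - cas (- (k + l)) x).
  rewrite (_ : (fun x => _) = (fun x => cas (k + l) x + (-1) * cas (- (k + l)) x)).
    by apply: summable2D => //; exact: summable2Z.
  by apply/funext => x; rewrite mulN1r.
rewrite int2Z; last exact: summable2D.
rewrite int2D// int2D// int2B// !int2_cas oppr_eq0 subrr addr0.
rewrite !subr_eq0 [l == k]eq_sym; case: eqP => _; last by rewrite addr0 mulr0.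
by field.
Qed.

End Trig.

(** * Completeness of the trigonometric basis *)

Section Limits.
Context {R : realType}.

Lemma bernoulli_ge (y : R) (m : nat) : 0 <= y -> 1 + m%:R * y <= (1 + y) ^+ m.
Proof.
move=> y0; elim: m => [|m IH]; first by rewrite mul0r addr0 expr0.
rewrite exprS -natr1; apply: (le_trans _ (ler_wpM2l _ IH)); last by rewrite addr_ge0.
have : 0 <= m%:R * y ^+ 2 by rewrite mulr_ge0 ?sqr_ge0.
lra.
Qed.

Lemma bernoulli_le (y : R) (m : nat) : 0 <= y <= 1 -> 1 - m%:R * y <= (1 - y) ^+ m.
Proof.
move=> /andP[y0 y1]; elim: m => [|m IH]; first by rewrite mul0r subr0 expr0.
rewrite exprS -natr1; apply: (le_trans _ (ler_wpM2l _ IH)); last by rewrite subr_ge0.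
have : 0 <= m%:R * y ^+ 2 by rewrite mulr_ge0 ?sqr_ge0.
lra.
Qed.

Lemma cvg_natM_expr (r : R) : 0 <= r < 1 -> n%:R * r ^+ n @[n --> \oo] --> 0.
Proof.
move=> /andP[r0 r1]; have [->|rn0] := eqVneq r 0.
  apply: cvg_near_cst; near=> n.
  have n0 : (0 < n)%N by near: n; exact: nbhs_infty_gt.
  by rewrite expr0n gtn_eqF// mulr0.
have rp : 0 < r by rewrite lt_def rn0.
(* Half of the decay is spent on the factor n: Bernoulli's inequality for 1/p bounds n p^n, and the
   remaining p^n tends to 0. *)
pose p := Num.sqrt r; have p2 : r = p ^+ 2 by rewrite sqr_sqrtr.
have pp : 0 < p by rewrite sqrtr_gt0.
have p1 : p < 1 by rewrite -sqrtr1 ltr_sqrt.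
have d0 : 0 < p^-1 - 1 by rewrite subr_gt0 invf_gt1.
apply: (@squeeze_cvgr _ _ _ _ (cst 0) (fun n => (p^-1 - 1)^-1 * p ^+ n)).
- near=> n; rewrite mulr_ge0 ?exprn_ge0//= p2 exprAC expr2 mulrA.
  apply: ler_wpM2r; first by rewrite exprn_ge0 ?ltW.
  have h := bernoulli_ge n (ltW d0); rewrite subrKC in h.
  have q0 : 0 < p ^+ n by rewrite exprn_gt0.
  rewrite -[leRHS]mul1r ler_pdivlMr// mulrAC -ler_pdivlMr// mul1r -exprVn.
  by apply: le_trans h; rewrite lerDr.
- exact: cvg_cst.
- rewrite -[0 in X in _ --> X](mulr0 (p^-1 - 1)^-1); apply: cvgM; first exact: cvg_cst.
  by apply: cvg_expr; rewrite gtr0_norm.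
Unshelve. all: by end_near.
Qed.

(* Polynomials that converge boundedly to the indicator of [s < 1/2] on [0, 1]. *)
Lemma cvg_step (s : R) : 0 <= s <= 1 ->
  (1 - s ^+ n) ^+ (n * 2 ^ n) @[n --> \oo] --> ((s < 2^-1)%R%:R : R).
Proof.
move=> /andP[s0 s1].
have sn n : 0 <= s ^+ n <= 1 by rewrite exprn_ge0//= exprn_ile1.
(* With the exponent m = n 2^n one has m s^n = n (2 s)^n. For s < 1/2 this tends to 0, and
   Bernoulli's inequality bounds the power from below by 1 - n (2 s)^n. *)
have [sh|sh] := ltP s 2^-1.
  apply: (@squeeze_cvgr _ _ _ _ (fun n => 1 - n%:R * (2 * s) ^+ n) (cst 1)).
  - near=> n; apply/andP; split; last first.
      have /andP[a b] := sn n.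
      by rewrite exprn_ile1 ?subr_ge0// lerBlDr lerDl.
    apply: le_trans (bernoulli_le _ (sn n)).
    by rewrite natrM natrX exprMn mulrA.
  - rewrite -[X in _ --> X](subr0 1); apply: cvgB; first exact: cvg_cst.
    by apply: cvg_natM_expr; apply/andP; split; lra.
  - exact: cvg_cst.
(* For s >= 1/2 the power (1 + s^n)^m is at least 1 + n (2 s)^n >= n + 1, while its product with (1
   - s^n)^m is at most 1. *)
apply: (@squeeze_cvgr _ _ _ _ (cst 0) (fun n => (n.+1%:R)^-1)).
- near=> n; have /andP[a b] := sn n; apply/andP; split; first by rewrite exprn_ge0// subr_ge0.
  have h := bernoulli_ge (n * 2 ^ n) a.
  have c : n.+1%:R <= (1 + s ^+ n) ^+ (n * 2 ^ n).
    apply: le_trans h; rewrite natrM natrX -mulrA -exprMn -natr1 addrC lerD2l.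
    by rewrite -[leLHS]mulr1 ler_wpM2l// exprn_ege1//; lra.
  rewrite -[leRHS]mul1r ler_pdivlMr ?ltr0Sn//.
  apply: (le_trans (ler_wpM2l _ c)); first by rewrite exprn_ge0// subr_ge0.
  rewrite -exprMn exprn_ile1//; last by have := sqr_ge0 (s ^+ n); lra.
  by rewrite mulr_ge0//; lra.
- exact: cvg_cst.
- exact: (@cvg_harmonic R).
Unshelve. all: by end_near.
Qed.

End Limits.

Section Dominated.
Context {R : realType}.
Implicit Types (f g : R * R -> R).

Lemma mfun2_cvg (F : nat -> R * R -> R) f : (forall n, mfun2 (F n)) ->
  (forall x, cell x -> F n x @[n --> \oo] --> f x) -> mfun2 f.
Proof. by move=> mF Ff; exact: (measurable_fun_cvg mF Ff). Qed.

Lemma int2_dominated (F : nat -> R * R -> R) f g : (forall n, mfun2 (F n)) ->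
  summable2 g -> (forall n x, cell x -> `|F n x| <= g x) ->
  (forall x, cell x -> F n x @[n --> \oo] --> f x) ->
  summable2 f /\ int2 (F n) @[n --> \oo] --> int2 f.
Proof.
move=> mF Ig Fg Ff; have mf := mfun2_cvg mF Ff.
have If : summable2 f.
  apply: (summable2_le mf Ig) => x cx.
  apply: (ler_cvg_to (cvg_norm (Ff x cx)) (cvg_cst (g x))).
  by near=> n; exact: Fg.
split=> //; apply: fine_cvg.
rewrite (_ : (fine _)%:E = (\int[leb2]_(x in cell) (f x)%:E)%E); last first.
  by rewrite fineK//; exact: (integrable_fin_num measurable_cell If).
apply: (@dominated_cvg _ _ _ leb2 _ measurable_cell _ _ (EFin \o g)) => //.
- by move=> n; apply/measurable_EFinP; exact: mF.
- by move=> x cx; apply: cvg_EFin; [near=> n|exact: Ff].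
Unshelve. all: by end_near.
Qed.

End Dominated.

Section Completeness.
Context {R : realType}.
Variable f : R * R -> R.
Hypothesis If : summable2 f.
Implicit Types (g p : R * R -> R).

Definition bdd2 g := mfun2 g /\ exists B : R, forall x, cell x -> `|g x| <= B.

Definition annih g := bdd2 g /\ forall k, int2 (fun x => f x * g x * cas k x) = 0.

Definition multiplier p := bdd2 p /\ forall g, annih g -> annih (fun x => g x * p x).

Let sum2f g (k : Z2) : bdd2 g -> summable2 (fun x => f x * g x * cas k x).
Proof.
move=> [mg [B gB]]; apply: (@summable2_mulb _ _ _ 2).
- exact: (summable2_mulb If mg gB).
- exact: (continuous_mfun2 (@continuous_cas _ k)).
- by move=> x _; exact: cas_bound.
Qed.

Lemma bdd2_cst a : bdd2 (fun=> a).
Proof. by split; [exact: mfun2_cst|exists `|a|]. Qed.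

Lemma bdd2_cas k : bdd2 (cas k).
Proof. by split; [exact: (continuous_mfun2 (@continuous_cas _ k))|exists 2 => x _; exact: cas_bound]. Qed.

Lemma bdd2D g p : bdd2 g -> bdd2 p -> bdd2 (fun x => g x + p x).
Proof.
move=> [mg [B gB]] [mp [C pC]]; split; first exact: measurable_funD.
by exists (B + C) => x cx; rewrite (le_trans (ler_normD _ _))// lerD ?gB ?pC.
Qed.

Lemma bdd2M g p : bdd2 g -> bdd2 p -> bdd2 (fun x => g x * p x).
Proof.
move=> [mg [B gB]] [mp [C pC]]; split; first exact: measurable_funM.
by exists (B * C) => x cx; rewrite normrM ler_pM ?gB ?pC.
Qed.

Lemma annihD g p : annih g -> annih p -> annih (fun x => g x + p x).
Proof.
move=> [bg Ng] [bp Np]; split; first exact: bdd2D.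
move=> k; transitivity (int2 (fun x => f x * g x * cas k x + f x * p x * cas k x)).
  by congr int2; apply/funext => x; ring.
by rewrite int2D ?Ng ?Np ?addr0//; exact: sum2f.
Qed.

Lemma annihZ a g : annih g -> annih (fun x => a * g x).
Proof.
move=> [bg Ng]; split; first by apply: bdd2M => //; exact: bdd2_cst.
move=> k; transitivity (int2 (fun x => a * (f x * g x * cas k x))).
  by congr int2; apply/funext => x; ring.
by rewrite int2Z ?Ng ?mulr0//; exact: sum2f.
Qed.

Lemma multiplierM p q : multiplier p -> multiplier q -> multiplier (fun x => p x * q x).
Proof.
move=> [bp Mp] [bq Mq]; split; first exact: bdd2M.
move=> g Ng; rewrite (_ : (fun x => _) = (fun x => g x * p x * q x)).
  by apply: Mq; exact: Mp.
by apply/funext => x; rewrite mulrA.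
Qed.

Lemma multiplierD p q : multiplier p -> multiplier q -> multiplier (fun x => p x + q x).
Proof.
move=> [bp Mp] [bq Mq]; split; first exact: bdd2D.
move=> g Ng; rewrite (_ : (fun x => _) = (fun x => g x * p x + g x * q x)).
  by apply: annihD; [exact: Mp|exact: Mq].
by apply/funext => x; rewrite mulrDr.
Qed.

Lemma multiplier_cst a : multiplier (fun=> a).
Proof.
split; first exact: bdd2_cst.
move=> g Ng; rewrite (_ : (fun x => _) = (fun x => a * g x)); first exact: annihZ.
by apply/funext => x; rewrite mulrC.
Qed.

Lemma multiplierZ a p : multiplier p -> multiplier (fun x => a * p x).
Proof. by move=> Mp; apply: multiplierM => //; exact: multiplier_cst. Qed.

Lemma multiplierX p n : multiplier p -> multiplier (fun x => p x ^+ n).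
Proof.
move=> Mp; elim: n => [|n IH].
  rewrite (_ : (fun x => _) = (fun=> 1)); first exact: multiplier_cst.
  by apply/funext => x; rewrite expr0.
rewrite (_ : (fun x => _) = (fun x => p x * p x ^+ n)); first exact: multiplierM.
by apply/funext => x; rewrite exprS.
Qed.

Lemma multiplier_cas l : multiplier (cas l).
Proof.
split; first exact: bdd2_cas.
move=> g [bg Ng]; split; first by apply: bdd2M => //; exact: bdd2_cas.
move=> k.
pose h (m : Z2) x := f x * g x * cas m x.
transitivity (int2 (fun x => 2^-1 * ((h (l - k) x + h (k - l) x) +
    (h (l + k) x + (-1) * h (- (l + k)) x)))).
  congr int2; apply/funext => x; rewrite /h.
  have -> : f x * (g x * cas l x) * cas k x = f x * g x * (cas l x * cas k x) by ring.
  by rewrite casM; ring.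
have S m : summable2 (h m) by exact: sum2f.
have S1 : summable2 (fun x => h (l - k) x + h (k - l) x) by exact: summable2D.
have S2 : summable2 (fun x => -1 * h (- (l + k)) x) by exact: summable2Z.
have S3 : summable2 (fun x => h (l + k) x + -1 * h (- (l + k)) x) by exact: summable2D.
by rewrite int2Z ?int2D ?int2Z ?Ng ?mulr0 ?addr0 ?mulr0//; exact: summable2D.
Qed.

Lemma multiplier_ext p q : multiplier p -> (forall x, cell x -> p x = q x) ->
  multiplier q.
Proof.
move=> [bp Mp] pq.
have bq : bdd2 q.
  have [mp [B pB]] := bp; split; last by exists B => x cx; rewrite -pq// pB.
  by apply: eq_measurable_fun mp => x; rewrite inE => /pq.
split=> // g Ng; have [_ Np] := Mp _ Ng; split; first by apply: bdd2M => //; case: Ng.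
by move=> k; rewrite -(Np k); apply: eq_int2 => x cx; rewrite pq.
Qed.

Lemma multiplier_lim (P : nat -> R * R -> R) p B : (forall n, multiplier (P n)) ->
  (forall n x, cell x -> `|P n x| <= B) ->
  (forall x, cell x -> P n x @[n --> \oo] --> p x) -> multiplier p.
Proof.
move=> MP PB Pp.
have bp : bdd2 p.
  split; first by apply: mfun2_cvg Pp => n; case: (MP n) => -[].
  exists B => x cx; apply: (ler_cvg_to (cvg_norm (Pp x cx)) (cvg_cst B)).
  by near=> n; exact: PB.
split=> // g Ng; have [bg _] := Ng; split; first exact: bdd2M.
move=> k.
have [] := @int2_dominated _ (fun n x => f x * (g x * P n x) * cas k x)
  (fun x => f x * (g x * p x) * cas k x) (fun x => B * `|f x * g x * cas k x|).
- by move=> n; apply: measurable_summable2; apply: sum2f; apply: bdd2M => //; case: (MP n).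
- apply: summable2Z; rewrite /summable2 (_ : _ \o _ =
    abse \o (EFin \o (fun x => f x * g x * cas k x)))//.
  by apply: integrable_abse; exact: sum2f.
- move=> n x cx.
  have -> : f x * (g x * P n x) * cas k x = P n x * (f x * g x * cas k x) by ring.
  by rewrite normrM ler_wpM2r// PB.
- move=> x cx; apply: cvgM; last exact: cvg_cst.
  apply: cvgM; first exact: cvg_cst.
  by apply: cvgM; [exact: cvg_cst|exact: Pp].
move=> _ /cvg_lim <-//; apply/cvg_lim => //; apply: cvg_near_cst; near=> n.
by have [_ +] := MP n; move=> /(_ _ Ng)[_ /(_ k)].
Unshelve. all: by end_near.
Qed.

(** The polynomials of [cvg_step], evaluated at a multiplier, are multipliers, and they converge
    boundedly to this indicator. *)
Lemma multiplier_step p : multiplier p -> (forall x, cell x -> 0 <= p x <= 1) ->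
  multiplier (fun x => ((p x < 2^-1)%R%:R)).
Proof.
move=> Mp p01.
apply: (@multiplier_lim (fun n x => (1 - p x ^+ n) ^+ (n * 2 ^ n)) _ 1).
- move=> n; apply: multiplierX.
  apply: (@multiplier_ext (fun x => 1 + (-1) * p x ^+ n)).
    apply: multiplierD; [exact: multiplier_cst|].
    by apply: multiplierZ; exact: multiplierX.
  by move=> x _; rewrite mulN1r.
- move=> n x cx; have /andP[p0 p1] := p01 x cx.
  have q0 : 0 <= p x ^+ n by rewrite exprn_ge0.
  have q1 : p x ^+ n <= 1 by rewrite exprn_ile1.
  by rewrite ger0_norm ?exprn_ge0 ?exprn_ile1 ?subr_ge0// lerBlDr lerDl.
- by move=> x cx; apply: cvg_step; exact: p01.
Qed.

Let msets : set (set (R * R)) := [set C | multiplier (\1_C : R * R -> R)].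

Let msets_C C : msets C -> msets (~` C).
Proof.
move=> MC; apply: (@multiplier_ext (fun x => 1 + (-1) * \1_C x)).
  by apply: multiplierD; [exact: multiplier_cst|exact: multiplierZ].
by move=> x _; rewrite !indicE in_setC; case: (x \in C) => /=; ring.
Qed.

Let msets_sigma : sigma_algebra setT msets.
Proof.
have m0 : msets set0.
  apply: (multiplier_ext (multiplier_cst 0)) => x _.
  by rewrite indicE in_set0.
split=> //; first by move=> C MC; rewrite setTD; exact: msets_C.
move=> A MA.
have fin n : msets (\bigcup_(k < n) A k).
  elim: n => [|n IH]; first by rewrite bigcup_mkord big_ord0.
  rewrite bigcup_mkord big_ord_recr /= -bigcup_mkord -[X in msets X]setCK setCU.
  apply: msets_C; apply: (@multiplier_ext (fun x => \1_(~` \bigcup_(k < n) A k) x *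
    \1_(~` A n) x)).
    by apply: multiplierM; exact: msets_C.
  by move=> x _; rewrite !indicE in_setI; case: (x \in _); case: (x \in _); rewrite /=; ring.
apply: (@multiplier_lim (fun n => \1_(\bigcup_(k < n) A k)) _ 1).
- exact: fin.
- by move=> n x _; rewrite indicE; case: (x \in _); rewrite ?normr1 ?normr0.
- move=> x _; apply: cvg_near_cst.
  have [[m _ Am]|nA] := pselect ((\bigcup_k A k) x).
    near=> n; rewrite !indicE !mem_set//; first by exists m.
    by exists m => //=; near: n; exact: nbhs_infty_gt.
  near=> n; rewrite !indicE !memNset// => -[m _ Am].
  by apply: nA; exists m.
Unshelve. all: by end_near.
Qed.

(** The points of the circle at distance at most b/2 from b/2 form the arc from 0 to b. A single
    cosine thus separates a half-line within one period. *)
Let cos_lt_iff (b x : R) : 0 <= b < 2 * pi -> 0 <= x < 2 * pi ->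
  (cos (x - b / 2) < cos (b / 2)) = (b < x).
Proof.
move=> /andP[b0 b2] /andP[x0 x2].
have E : cos (x - b / 2) - cos (b / 2) = 2 * (sin (x / 2) * sin ((b - x) / 2)).
  have -> : x - b / 2 = x / 2 - (b - x) / 2 by field.
  have -> : b / 2 = x / 2 + (b - x) / 2 by field.
  by rewrite cosB cosD; ring.
rewrite -subr_lt0 E; have [bx|xb] := ltP b x.
  rewrite pmulr_rlt0// pmulr_rlt0; last by apply: sin_gt0_pi; apply/andP; split; lra.
  have -> : (b - x) / 2 = - ((x - b) / 2) by ring.
  by rewrite sinN oppr_lt0; apply: sin_gt0_pi; apply/andP; split; lra.
apply/negbTE; rewrite -leNgt !mulr_ge0//; apply: sin_ge0_pi; apply/andP; split; lra.
Qed.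

Let multiplier_cos (k : Z2) (c : R) : multiplier (fun x => cos (kdot k x - c)).
Proof.
apply: (@multiplier_ext (fun x => (cos c / 2) * (cas k x + cas (- k) x) +
  (sin c / 2) * (cas k x + (-1) * cas (- k) x))).
  by repeat first [exact: multiplier_cas | apply: multiplierZ | apply: multiplierD].
by move=> x _; rewrite casN /cas cosB; field.
Qed.

Let half_line (k : Z2) (pr : R * R -> R) : (forall x, kdot k x = pr x) ->
  (forall x, cell x -> 0 <= pr x < 2 * pi) ->
  forall b : R, msets (pr @^-1` [set x | x <= b]).
Proof.
move=> kp prc b.
have [b0|b0] := ltP b 0.
  apply: (multiplier_ext (multiplier_cst 0)) => x /prc/andP[h _].
  by rewrite indicE memNset//= => /(le_trans h); rewrite leNgt b0.
have [b2|b2] := ltP b (2 * pi); last first.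
  apply: (multiplier_ext (multiplier_cst 1)) => x /prc/andP[_ h].
  by rewrite indicE mem_set//=; apply: le_trans b2; exact: ltW.
rewrite -[X in msets X]setCK; apply: msets_C.
(* An affine rescaling brings the cosine into [0, 1] and the threshold to 1/2, as [multiplier_step]
   requires. The sublevel set is the complement of the half-line. *)
apply: (@multiplier_ext (fun x =>
  ((2^-1 + (cos (pr x - b / 2) - cos (b / 2)) / 4 < 2^-1)%R%:R))).
  apply: multiplier_step; last first.
    move=> x _; have := cos_le1 (pr x - b / 2); have := cos_geN1 (pr x - b / 2).
    by have := cos_le1 (b / 2); have := cos_geN1 (b / 2); lra.
  apply: (@multiplier_ext (fun x => (2^-1 - cos (b / 2) / 4) +
     4^-1 * cos (kdot k x - b / 2))).
    apply: multiplierD; [exact: multiplier_cst|].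
    by apply: multiplierZ; exact: multiplier_cos.
  by move=> x _; rewrite kp; field.
move=> x cx; rewrite indicE in_setC.
rewrite -[X in _ < X]addr0 ltrD2l pmulr_llt0// subr_lt0 cos_lt_iff ?b0//; last exact: prc.
by congr (nat_of_bool _)%:R; rewrite ltNge; congr negb; apply/idP/idP; rewrite inE.
Qed.

Let msets_measurable (C : set (measurableTypeR R * measurableTypeR R)) :
  measurable C -> msets C.
Proof.
(* Intervals ]a, b] generate the Borel sets and are Boolean combinations of half-lines; preimages
   under the two projections generate the product sigma-algebra. *)
have pre (pr : R * R -> R) : (forall b : R, msets (pr @^-1` [set x | x <= b])) ->
    forall B : set (measurableTypeR R), measurable B -> msets (pr @^-1` B).
  move=> hb; apply: smallest_sub.
    have [m0 mC mU] := msets_sigma; split.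
    - by rewrite preimage_set0.
    - by move=> A /mC; rewrite !setTD -preimage_setC.
    - by move=> A /mU; rewrite preimage_bigcup.
  move=> _ [[a b] _ <-] /=.
  have -> : pr @^-1` `]a, b]%classic =
      ~` (pr @^-1` [set x | x <= a] `|` ~` (pr @^-1` [set x | x <= b])).
    apply/seteqP; split=> x /=; rewrite in_itv /= ltNge.
      by move=> /andP[/negP ? ?] [].
    move=> /not_orP[? /contrapT h]; rewrite h andbT; exact/negP.
  apply: msets_C; have [m0 mC mU] := msets_sigma.
  rewrite -bigcup2E; apply: mU => -[|[|n]] //=; apply: msets_C; exact: hb.
apply: smallest_sub; first exact: msets_sigma.
move=> A [[B mB <-]|[B mB <-]]; rewrite setTI; apply: pre => //.
  apply: (@half_line (1, 0)) => [x|x [/= + _]]; first by rewrite /kdot /= mul1r mul0r addr0.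
  by rewrite in_itv.
apply: (@half_line (0, 1)) => [x|x [/= _ +]]; first by rewrite /kdot /= mul1r mul0r add0r.
by rewrite in_itv.
Qed.

(* A summable function whose Fourier coefficients vanish is orthogonal to the
   indicator of [f > 0]. *)
Lemma fourier_complete : (forall k, int2 (fun x => f x * cas k x) = 0) ->
  {ae leb2, forall x, cell x -> f x = 0}.
Proof.
move=> f0.
have N1 : annih (fun=> 1).
  split; first exact: bdd2_cst.
  by move=> k; rewrite -(f0 k); congr int2; apply/funext => x; rewrite mulr1.
have mf := measurable_summable2 If.
have pos (C : set (measurableTypeR R * measurableTypeR R)) : measurable C ->
    int2 (fun x => f x * \1_C x) = 0.
  move=> /msets_measurable [_ /(_ _ N1) [_ /(_ 0)]] <-.
  by congr int2; apply/funext => x; rewrite cas0 mul1r mulr1.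
pose P : set (measurableTypeR R * measurableTypeR R) := cellR `&` f @^-1` `[0, +oo[%classic.
have mP : measurable P.
  by apply: mf; [exact: measurable_cell|exact: measurable_itv].
have absf : int2 (fun x => `|f x|) = 0.
  (* On the cell, |f| is twice the part of f on [P] minus f, and both parts integrate to 0 by
     [pos]. *)
  transitivity (int2 (fun x => 2 * (f x * \1_P x) - f x * \1_cellR x)).
    apply: eq_int2 => x cx; rewrite [\1_cellR x]indicE mem_set// mulr1 indicE.
    have [fx|fx] := leP 0 (f x).
      by rewrite mem_set//= ?ger0_norm ?mulr1//; [ring|split => //=; rewrite in_itv /= fx].
    rewrite memNset//= ?ltr0_norm// ?mulr0 ?mulr0 ?sub0r// => -[_] /=.
    by rewrite in_itv /= andbT leNgt fx.
  have S (C : set (measurableTypeR R * measurableTypeR R)) : measurable C ->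
      summable2 (fun x => f x * \1_C x).
    move=> mC; apply: (@summable2_mulb _ _ _ 1) => //; first exact: measurable_indic.
    by move=> x _; rewrite indicE; case: (x \in _); rewrite ?normr1 ?normr0.
  have mc := @measurable_cell R.
  rewrite int2B ?int2Z ?pos ?mulr0 ?subr0//; [exact: S|exact: summable2Z (S _ mP)|exact: S].
have Ia : leb2.-integrable cell (abse \o (EFin \o f)) by exact: integrable_abse.
have E0 : (\int[leb2]_(x in cell) `|(EFin \o f) x|)%E = 0%E.
  rewrite -[LHS]fineK; last exact: (integrable_fin_num measurable_cell Ia).
  by congr EFin; exact: absf.
have /ae_eq_integral_abs H := E0.
have mfE : measurable_fun cellR (EFin \o f) by apply/measurable_EFinP.
have := H measurable_cell mfE.
by apply: filterS => x h cx; have := h cx => -[].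
Qed.

End Completeness.

(** * Riesz-Fischer and Parseval *)

Section FourierSeries.
Context {R : realType}.
Implicit Types (f g : R * R -> R) (c d : Z2 -> R).

Definition kap : R := ((2 * pi) ^+ 2)^-1.

Lemma twopi_gt0 : 0 < 2 * pi :> R. Proof. by rewrite mulr_gt0 ?pi_gt0. Qed.

Lemma kap_gt0 : 0 < kap. Proof. by rewrite invr_gt0 exprn_gt0 ?twopi_gt0. Qed.

Lemma kap_ge0 : 0 <= kap. Proof. exact: ltW kap_gt0. Qed.

Lemma twopi_ge0 : 0 <= 2 * pi :> R. Proof. exact: ltW twopi_gt0. Qed.

Lemma kapK : kap * (2 * pi) ^+ 2 = 1.
Proof. by rewrite mulVf// expf_neq0// gt_eqF ?twopi_gt0. Qed.

Definition fcoef f (k : Z2) : R := ip f (cas k).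

Definition trig (n : nat) c (x : R * R) : R := kap * \sum_(k <- box n) c k * cas k x.

Lemma continuous_trig n c : continuous (trig n c).
Proof.
move=> x; apply: cvgM; first exact: cvg_cst.
elim: (box n) => [|k s IH].
  rewrite big_nil; apply: cvg_near_cst; near=> y; by rewrite big_nil.
rewrite big_cons; under [X in X @ _ --> _]eq_fun do rewrite big_cons.
by apply: cvgD => //; apply: cvgM; [exact: cvg_cst|exact: continuous_cas].
Unshelve. all: by end_near.
Qed.

Lemma sqsummable_trig n c : sqsummable (trig n c).
Proof. exact: (continuous_sqsummable (@continuous_trig n c)). Qed.

Lemma mfun2_trig n c : mfun2 (trig n c).
Proof. exact: (continuous_mfun2 (@continuous_trig n c)). Qed.

Lemma periodic2_trig n c : periodic2 (trig n c).
Proof.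
by move=> x; split; rewrite /trig; congr (_ * _); apply: eq_bigr => k _;
  have [p1 p2] := @periodic2_cas R k x; rewrite ?p1 ?p2.
Qed.

(** Coefficients of the x_j-derivative: differentiation turns c_k [cas k] into c_k k_j [cas (- k)],
    and k is then replaced by -k. *)
Definition dcoef (j : 'I_2) c (k : Z2) : R := - kc j k * c (- k).

Lemma is_derive_trig j n c x : is_derive x (e_ j) (trig n c) (trig n (dcoef j c) x).
Proof.
have D (s : seq Z2) : is_derive x (e_ j) (fun x => \sum_(k <- s) c k * cas k x)
    (\sum_(k <- s) c k * (kc j k * cas (- k) x)).
  elim: s => [|k s IH].
    rewrite big_nil (_ : (fun x => _) = cst 0); first exact: is_derive_cst.
    by apply/funext => y; rewrite big_nil.
  rewrite big_cons (_ : (fun x => _) = (fun x => c k *: cas k x) +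
     (fun x => \sum_(k <- s) c k * cas k x)); last first.
    by apply/funext => y; rewrite big_cons.
  by apply: is_deriveD; apply: is_deriveZ; exact: is_derive_cas.
have := is_deriveZ kap (D (box n)).
move=> H; apply: (is_derive_eqfun H) => // ; rewrite /trig; congr (_ * _).
rewrite -sum_box_opp; apply: eq_bigr => k _.
by rewrite /dcoef opprK kcN; ring.
Qed.

Lemma C1_trig j n c : C1_dir j (trig n c) (trig n (dcoef j c)).
Proof.
by split; [exact: periodic2_trig|exact: continuous_trig|exact: continuous_trig|
  exact: is_derive_trig].
Qed.

Lemma int2_trig n c f : summable2 f ->
  int2 (fun x => f x * trig n c x) = kap * \sum_(k <- box n) c k * int2 (fun x => f x * cas k x).
Proof.
move=> If.
have S k : summable2 (fun x => f x * cas k x).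
  apply: (@summable2_mulb _ _ _ 2) => //; first exact: (continuous_mfun2 (@continuous_cas _ k)).
  by move=> x _; exact: cas_bound.
transitivity (int2 (fun x => kap * \sum_(k <- box n) c k * (f x * cas k x))).
  congr int2; apply/funext => x; rewrite /trig mulrCA; congr (kap * _).
  by rewrite mulr_sumr; apply: eq_bigr => k _; ring.
rewrite int2Z ?int2_sum//; last 2 first.
- by move=> k; exact: summable2Z.
- by apply: summable2_sum => k; exact: summable2Z.
by congr (_ * _); apply: eq_bigr => k _; rewrite int2Z.
Qed.

Lemma ip_trigr n c f : sqsummable f ->
  ip f (trig n c) = kap * \sum_(k <- box n) c k * fcoef f k.
Proof.
move=> Lf; have If : summable2 f.
  rewrite (_ : f = fun x => f x * 1); last by apply/funext => x; rewrite mulr1.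
  apply: sqsummableM => //; apply: (@sqsummable_bounded _ _ 1); first exact: mfun2_cst.
  by move=> x _; rewrite normr1.
exact: int2_trig.
Qed.

Lemma fcoef_trig n c k : fcoef (trig n c) k = if k \in box n then c k else 0.
Proof.
rewrite /fcoef ipC ip_trigr; last exact: sqsummable_cas.
transitivity (kap * \sum_(l <- box n) (if l == k then c l * (2 * pi) ^+ 2 else 0)).
  congr (_ * _); apply: eq_bigr => l _.
  by rewrite /fcoef ip_cas eq_sym; case: eqP => //; rewrite mulr0.
case: ifPn => kn.
  rewrite (bigD1_seq k) ?uniq_box//= eqxx big1 ?addr0; first by rewrite mulrCA kapK mulr1.
  by move=> l /negbTE ->.
rewrite big1_seq ?mulr0// => l /andP[_ h]; case: eqP => // lk.
by rewrite -lk h in kn.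
Qed.

Lemma ip_trig n c d : ip (trig n c) (trig n d) = kap * \sum_(k <- box n) c k * d k.
Proof.
rewrite ip_trigr; last exact: sqsummable_trig.
by congr (_ * _); apply: eq_big_seq => k kn; rewrite fcoef_trig kn mulrC.
Qed.

Lemma trig_box m n c : (m <= n)%N ->
  trig m c = trig n (fun k => if k \in box m then c k else 0).
Proof.
move=> mn; apply/funext => x; rewrite /trig; congr (_ * _).
rewrite -(sum_box_indic _ mn); apply: eq_bigr => k _.
by case: ifP => _; rewrite ?mul0r.
Qed.

Lemma trigB n c d x : trig n c x - trig n d x = trig n (fun k => c k - d k) x.
Proof.
rewrite /trig -mulrBr; congr (_ * _); rewrite -sumrB.
by apply: eq_bigr => k _; rewrite mulrBl.
Qed.

Definition bsum n c : R := \sum_(k <- box n) c k ^+ 2.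

Lemma bsum_ge0 n c : 0 <= bsum n c.
Proof. by apply: sumr_ge0 => k _; exact: sqr_ge0. Qed.

Lemma bsum_mono m n c : (m <= n)%N -> bsum m c <= bsum n c.
Proof. by move=> mn; apply: sum_box_mono => // k; exact: sqr_ge0. Qed.

Lemma nrm_trigB m n c : (m <= n)%N ->
  nrm (fun x => trig n c x - trig m c x) ^+ 2 = kap * (bsum n c - bsum m c).
Proof.
move=> mn; rewrite sqr_nrm (trig_box c mn).
under [X in ip X _]eq_fun do rewrite trigB.
under [X in ip _ X]eq_fun do rewrite trigB.
rewrite ip_trig; congr (_ * _); rewrite /bsum -(sum_box_indic _ mn) -sumrB.
by apply: eq_bigr => k _; case: ifP => _; ring.
Qed.

Lemma nrm_trigB_abs m n c :
  nrm (fun x => trig n c x - trig m c x) ^+ 2 = kap * `|bsum n c - bsum m c|.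
Proof.
have [mn|/ltnW nm] := leqP m n.
  by rewrite nrm_trigB// ger0_norm// subr_ge0 bsum_mono.
by rewrite nrmBC nrm_trigB// distrC ger0_norm// subr_ge0 bsum_mono.
Qed.

Lemma nrm_subtrig n f : sqsummable f ->
  nrm (fun x => f x - trig n (fcoef f) x) ^+ 2 = ip f f - kap * bsum n (fcoef f).
Proof.
move=> Lf; have LT := sqsummable_trig n (fcoef f).
rewrite sqr_nrm ipBl ?[ip _ (fun x => f x - _)]ipC ?ipBl//; last exact: sqsummableB.
have E : ip f (trig n (fcoef f)) = kap * bsum n (fcoef f) by rewrite ip_trigr.
rewrite [ip (trig _ _) f]ipC E ip_trig.
have -> : \sum_(k <- box n) fcoef f k * fcoef f k = bsum n (fcoef f).
  by apply: eq_bigr => k _; rewrite expr2.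
by ring.
Qed.

Lemma bessel n f : sqsummable f -> kap * bsum n (fcoef f) <= ip f f.
Proof. by move=> Lf; rewrite -subr_ge0 -nrm_subtrig// sqr_ge0. Qed.

Definition square_summable c := exists E : R, forall n, bsum n c <= E.

Lemma square_summable_fcoef f : sqsummable f -> square_summable (fcoef f).
Proof.
move=> Lf; exists (ip f f / kap) => n; rewrite ler_pdivlMr ?kap_gt0// mulrC.
exact: bessel.
Qed.

Lemma bsum_cvg c : square_summable c -> exists E : R,
  bsum n c @[n --> \oo] --> E /\ forall n, bsum n c <= E.
Proof.
move=> [B cB].
have ub : has_ubound (range (bsum^~ c)) by exists B => _ [n _ <-].
exists (sup (range (bsum^~ c))); split.
  by apply: nondecreasing_cvgn => // m n mn; exact: bsum_mono.
by move=> n; apply: ub_le_sup => //; exists n.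
Qed.

(** The upper limit is defined at every point, so it inherits periodicity and measurability exactly
    and not just almost everywhere. [fine] turns infinite values into 0. *)
Lemma mfun2_periodic_limsup (g : nat -> R * R -> R) : (forall m, mfun2 (g m)) ->
  (forall m, periodic2 (g m)) ->
  exists f, [/\ periodic2 f, mfun2 f &
    forall x, cvgn (g^~ x) -> g n x @[n --> \oo] --> f x].
Proof.
move=> mg pg; exists (fun x => fine (limn_esup (fun m => (g m x)%:E))); split.
- move=> x; split; congr (fine (limn_esup _)); apply/funext => m; congr EFin;
  by have [p1 p2] := pg m x.
- apply: (@measurableT_comp _ _ _ _ _ _ (@fine R)).
    exact: fine_measurable.
  apply: (@measurable_fun_limn_esup _ _ _ cellR (fun m x => (g m x)%:E)) => m.
  by apply/measurable_EFinP; exact: mg.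
- move=> x cg; have [l gl] : exists l : R, g n x @[n --> \oo] --> l by exists (limn (g^~ x)).
  have /cvg_limn_einf_sup[_ ->] // : (g n x)%:E @[n --> \oo] --> l%:E.
  by apply: cvg_EFin => //; near=> n.
Unshelve. all: by end_near.
Qed.

Lemma int2_ae f g : mfun2 f -> mfun2 g -> {ae leb2, forall x, cell x -> f x = g x} ->
  int2 f = int2 g.
Proof.
move=> mf mg fg; rewrite /int2 /Rintegral; congr fine.
apply: (@ae_eq_integral _ _ _ leb2 cellR) => //.
- exact: measurable_cell.
- exact/measurable_EFinP.
- exact/measurable_EFinP.
- by move: fg; apply: filterS => x h cx; rewrite h.
Qed.

Lemma cvg_le (T : topologicalType) (F : set_system T) {FF : ProperFilter F} (u : T -> R) l B :
  u x @[x --> F] --> l -> (forall x, u x <= B) -> l <= B.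
Proof. by move=> ul uB; apply: (ler_cvg_to ul (cvg_cst B)); near=> x; exact: uB.
Unshelve. all: by end_near. Qed.

(** By monotone convergence the sum of the series has a finite integral, so it is finite almost
    everywhere. *)
Lemma int2_summable_series (D : nat -> R * R -> R) B : (forall m, sqsummable (D m)) ->
  (forall m x, 0 <= D m x) -> (forall n, \sum_(0 <= m < n) int2 (D m) <= B) ->
  {ae leb2, forall x, cell x -> cvgn (series (D^~ x))}.
Proof.
move=> LD D0 DB.
have ID m : summable2 (D m).
  rewrite (_ : D m = fun x => D m x * 1); last by apply/funext => x; rewrite mulr1.
  apply: sqsummableM => //; apply: (@sqsummable_bounded _ _ 1); first exact: mfun2_cst.
  by move=> x _; rewrite normr1.
have mD m : measurable_fun cellR (fun x => (D m x)%:E).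
  by apply/measurable_EFinP; case: (LD m).
have E := @integral_nneseries _ _ R leb2 cellR (@measurable_cell R) (fun m x => (D m x)%:E)
  mD (fun m x _ => D0 m x).
have fin : (\int[leb2]_(x in cellR) (\sum_(0 <= m <oo) (D m x)%:E) < +oo)%E.
  rewrite E; apply: (@le_lt_trans _ _ B%:E); last exact: ltry.
  apply: lime_le.
    by apply: is_cvg_nneseries => m _ _; apply: integral_ge0 => x _; rewrite lee_fin.
  near=> n; rewrite (eq_bigr (fun m => (int2 (D m))%:E)); first by rewrite sumEFin lee_fin.
  by move=> m _; rewrite /int2 /Rintegral fineK//; exact: (integrable_fin_num measurable_cell (ID m)).
have I : leb2.-integrable cellR (fun x => \sum_(0 <= m <oo) (D m x)%:E)%E.
  apply/integrableP; split.
    apply: (@ge0_emeasurable_sum _ _ R cellR (fun m x => (D m x)%:E) xpredT) => //.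
    by move=> m x _ _; rewrite lee_fin.
  apply: le_lt_trans fin; apply: ge0_le_integral => //.
  - exact: measurable_cell.
  - apply: measurableT_comp => //.
    apply: (@ge0_emeasurable_sum _ _ R cellR (fun m x => (D m x)%:E) xpredT) => //.
    by move=> m x _ _; rewrite lee_fin.
  - apply: (@ge0_emeasurable_sum _ _ R cellR (fun m x => (D m x)%:E) xpredT) => //.
    by move=> m x _ _; rewrite lee_fin.
  - by move=> x _; rewrite gee0_abs// nneseries_ge0// => m _ _; rewrite lee_fin.
have := integrable_ae (@measurable_cell R) I.
apply: filterS => x h cx; apply: nnseries_is_cvg => //.
by rewrite -ge0_fin_numE ?h//; apply: nneseries_ge0 => m _ _; rewrite lee_fin.
Unshelve. all: by end_near.
Qed.

Lemma int2_fatou (g : nat -> R * R -> R) f B : (forall m, mfun2 (g m)) -> mfun2 f ->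
  (forall m x, 0 <= g m x) -> (forall m, summable2 (g m)) ->
  {ae leb2, forall x, cell x -> g m x @[m --> \oo] --> f x} ->
  int2 (g m) @[m --> \oo] --> B ->
  summable2 f /\ int2 f <= B.
Proof.
move=> mg mf g0 Ig gf gB.
have mgE m : measurable_fun cellR (fun x => (g m x)%:E).
  by apply/measurable_EFinP; exact: mg.
have mfE : measurable_fun cellR (EFin \o f) by apply/measurable_EFinP.
have := @fatou _ _ R leb2 cellR (@measurable_cell R) (fun m x => (g m x)%:E) mgE
   (fun m x _ => g0 m x).
have -> : limn_einf (fun m => \int[leb2]_(x in cellR) (g m x)%:E)%E = B%:E.
  suff /cvg_limn_einf_sup[] : (\int[leb2]_(x in cellR) (g m x)%:E)%E @[m --> \oo] --> B%:E by [].
  apply: cvg_EFin; last exact: gB.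
  by near=> m; exact: (integrable_fin_num measurable_cell (Ig m)).
have Ef : ae_eq leb2 cellR (fun x => `|(f x)%:E|)%E (fun x => limn_einf (fun m => (g m x)%:E)).
  move: gf; apply: filterS => x h cx; have gx := h cx; apply/esym.
  have f0 : 0 <= f x.
    by apply: (ler_cvg_to (cvg_cst 0) gx); near=> m; exact: g0.
  rewrite /= ger0_norm//.
  suff /cvg_limn_einf_sup[] : (g m x)%:E @[m --> \oo] --> (f x)%:E by [].
  by apply: cvg_EFin => //; near=> m.
rewrite -(@ae_eq_integral _ _ R leb2 cellR _ _ _ _ _ Ef); last 3 first.
- exact: measurable_cell.
- exact: measurableT_comp.
- under eq_fun do rewrite -[limn_einf _]oppeK -limn_esupN.
  apply: measurableT_comp => //; apply: measurable_fun_limn_esup => m.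
  exact: measurableT_comp.
move=> h; have If : summable2 f.
  apply/integrableP; split=> //; apply: le_lt_trans h _; exact: ltry.
split=> //; rewrite -lee_fin; apply: le_trans h.
rewrite /int2 /Rintegral fineK; last exact: (integrable_fin_num measurable_cell If).
apply: le_trans (le_abse_integral leb2 measurable_cell mfE).
exact: lee_abs.
Unshelve. all: by end_near.
Qed.

Lemma sqsummable_subtrig n c f : sqsummable f -> sqsummable (fun x => f x - trig n c x).
Proof. by move=> Lf; apply: sqsummableB => //; exact: sqsummable_trig. Qed.

Lemma summable2_sqsummable f : sqsummable f -> summable2 f.
Proof.
move=> Lf; rewrite (_ : f = fun x => f x * 1); last by apply/funext => x; rewrite mulr1.
apply: sqsummableM => //; apply: (@sqsummable_bounded _ _ 1); first exact: mfun2_cst.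
by move=> x _; rewrite normr1.
Qed.

Lemma nrm_cst1 : nrm (fun=> 1) = 2 * pi :> R.
Proof.
rewrite /nrm ipE (_ : (fun x => _) = cst 1); last by apply/funext => x; rewrite mulr1.
by rewrite int2_cst mul1r sqrtr_sqr ger0_norm// ltW// twopi_gt0.
Qed.

Lemma sqsummable_norm f : sqsummable f -> sqsummable (fun x => `|f x|).
Proof.
move=> [mf If]; split; first exact: measurableT_comp.
by under eq_fun do rewrite real_normK ?num_real//.
Qed.

Lemma nrm_norm f : nrm (fun x => `|f x|) = nrm f.
Proof.
rewrite /nrm !ipE; congr (Num.sqrt (int2 _)); apply/funext => x.
by rewrite -!expr2 real_normK ?num_real.
Qed.

Lemma int2_norm_le f : sqsummable f -> int2 (fun x => `|f x|) <= nrm f * (2 * pi).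
Proof.
move=> Lf; have L1 : sqsummable (fun=> 1 : R).
  apply: (@sqsummable_bounded _ _ 1); first exact: mfun2_cst.
  by move=> x _; rewrite normr1.
have := cauchy_schwarz (sqsummable_norm Lf) L1; rewrite nrm_norm nrm_cst1.
apply: le_trans; rewrite (le_trans _ (ler_norm _))// ipE.
by under [X in _ <= int2 X]eq_fun do rewrite mulr1.
Qed.

(** A rapidly convergent subsequence of partial sums converges almost everywhere, and its upper
    limit is a genuine periodic function. Fatou's lemma compares that function with all partial
    sums. *)
Theorem riesz_fischer c : square_summable c -> exists f,
  [/\ periodic2 f, sqsummable f & nrm (fun x => f x - trig n c x) @[n --> \oo] --> 0].
Proof.
move=> /bsum_cvg[E [cE uE]].
(* Tails of size 4^-m in squared norm make consecutive differences of the subsequence of order 2^-m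
   in norm, hence summable. *)
have /choice[N NE] : forall m : nat, exists N : nat,
    forall n, (N <= n)%N -> E - bsum n c <= (4^-1) ^+ m.
  move=> m.
  have p4 : 0 < (4^-1 : R) ^+ m by rewrite exprn_gt0.
  have := cvgr_dist_le _ _ cE _ p4 => -[N _ H].
  by exists N => n Nn; apply: le_trans (H n Nn); exact: ler_norm.
pose g m := trig (N m) c.
pose D m x := `|g m.+1 x - g m x|.
have LgB m n : sqsummable (fun x => g m x - trig n c x).
  by apply: sqsummable_subtrig; exact: sqsummable_trig.
have LD m : sqsummable (D m) by apply: sqsummable_norm; exact: LgB.
have nD m : nrm (D m) <= Num.sqrt kap * (2^-1) ^+ m.
  rewrite nrm_norm -(@ler_pXn2r _ 2)// ?nnegrE ?nrm_ge0 ?mulr_ge0 ?sqrtr_ge0 ?exprn_ge0//.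
  rewrite nrm_trigB_abs exprMn sqr_sqrtr ?kap_ge0//; apply: ler_wpM2l; first exact: kap_ge0.
  rewrite -exprM mulnC exprM (_ : 2^-1 ^+ 2 = 4^-1); last by field.
  have h1 := NE m _ (leqnn _); have h2 := NE m.+1 _ (leqnn _).
  have u1 := uE (N m); have u2 := uE (N m.+1); have p4 : 0 <= (4^-1 : R) ^+ m by rewrite exprn_ge0.
  by rewrite exprS in h2; rewrite ler_norml; apply/andP; split; lra.
have sD n : \sum_(0 <= m < n) int2 (D m) <= Num.sqrt kap * (2 * pi) * 2.
  have h : \sum_(0 <= m < n) int2 (D m) <=
      \sum_(0 <= m < n) Num.sqrt kap * (2 * pi) * (2^-1) ^+ m.
    apply: ler_sum => m _.
    have -> : int2 (D m) = int2 (fun x => `|D m x|).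
      by congr int2; apply/funext => x; rewrite /D normr_id.
    apply: le_trans (int2_norm_le (LD m)) _; rewrite mulrAC ler_wpM2r ?nD//.
    exact: twopi_ge0.
  apply: le_trans h _; rewrite -mulr_sumr; apply: ler_wpM2l.
    by rewrite mulr_ge0 ?sqrtr_ge0 ?twopi_ge0.
  suff -> : \sum_(0 <= i < n) (2^-1 : R) ^+ i = 2 - 2 * 2^-1 ^+ n.
    by rewrite lerBlDr lerDl mulr_ge0 ?exprn_ge0.
  elim: n => [|n IH]; first by rewrite big_geq// expr0 mulr1 subrr.
  by rewrite big_nat_recr//= IH exprS; field.
have cD := int2_summable_series LD (fun m x => normr_ge0 _) sD.
have [f [pf mf fg]] := @mfun2_periodic_limsup g (fun m => mfun2_trig _ _)
  (fun m => periodic2_trig _ _).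
have gf : {ae leb2, forall x, cell x -> g m x @[m --> \oo] --> f x}.
  move: cD; apply: filterS => x h cx; apply: fg.
  have : cvgn (series (telescope (g^~ x))) by apply: normed_cvg; exact: h.
  rewrite telescopeK => cB.
  rewrite (_ : g^~ x = (fun m => (g m x - g 0%N x) + g 0%N x)); last first.
    by apply/funext => m; rewrite subrK.
  by apply: is_cvgD => //; exact: is_cvg_cst.
(* Fatou's lemma in m with n fixed: the squared distance from [g m] to the n-th partial sum is [kap]
   times the difference of two partial sums of squares, which converges as m grows. *)
have key n : summable2 (fun x => (f x - trig n c x) ^+ 2) /\
    int2 (fun x => (f x - trig n c x) ^+ 2) <= kap * `|E - bsum n c|.
  apply: (@int2_fatou (fun m x => (g m x - trig n c x) ^+ 2)).
  - by move=> m; case: (LgB m n) => + _; exact: measurable_funX.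
  - by apply: measurable_funX; apply: measurable_funB => //; exact: mfun2_trig.
  - by move=> m x; exact: sqr_ge0.
  - by move=> m; case: (LgB m n).
  - move: gf; apply: filterS => x h cx; have := h cx => {}h.
    rewrite expr2; under eq_fun do rewrite expr2.
    by apply: cvgM; apply: cvgB => //; exact: cvg_cst.
  - have -> : (fun m => int2 (fun x => (g m x - trig n c x) ^+ 2)) =
       (fun m => kap * `|bsum (N m) c - bsum n c|).
      apply/funext => m; rewrite -nrm_trigB_abs sqr_nrm ipE.
      by congr int2; apply/funext => x; rewrite expr2.
    apply: cvgM; first exact: cvg_cst.
    apply: cvg_norm; apply: cvgB; last exact: cvg_cst.
    apply/cvgrPdist_le => e e0.
    have /cvgr_dist_le/(_ _ e0) : (4^-1 : R) ^+ m @[m --> \oo] --> 0.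
      by apply: cvg_expr; rewrite ger0_norm//; lra.
    apply: filterS => m; rewrite sub0r normrN ger0_norm ?exprn_ge0// => h.
    by rewrite ger0_norm ?subr_ge0//; apply: le_trans h; exact: NE.
have Lf : sqsummable f.
  have [S _] := key 0%N.
  have L0 : sqsummable (fun x => f x - trig 0 c x).
    by split=> //; apply: measurable_funB => //; exact: mfun2_trig.
  rewrite (_ : f = fun x => (f x - trig 0 c x) + trig 0 c x).
    by apply: sqsummableD => //; exact: sqsummable_trig.
  by apply/funext => x; rewrite subrK.
exists f; split=> //.
apply: (@squeeze_cvgr _ _ _ _ (cst 0) (fun n => Num.sqrt (kap * `|E - bsum n c|))).
- near=> n; rewrite nrm_ge0 /= /nrm ler_wsqrtr// ipE.
  have [_ h] := key n; apply: le_trans h.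
  by under eq_fun do rewrite -expr2.
- exact: cvg_cst.
- rewrite -[X in _ --> X](sqrtr0 R); apply: continuous_cvg; first exact: sqrt_continuous.
  rewrite -[X in _ --> X](mulr0 kap); apply: cvgM; first exact: cvg_cst.
  rewrite -[X in _ --> X](normr0 R) -[X in `|X|](subrr E); apply: cvg_norm.
  by apply: cvgB => //; exact: cvg_cst.
Unshelve. all: by end_near.
Qed.

Lemma ip_dist (u v u0 v0 : R * R -> R) : sqsummable u -> sqsummable v ->
  sqsummable u0 -> sqsummable v0 ->
  `|ip u0 v0 - ip u v| <= nrm (fun x => u0 x - u x) * (nrm v0 + nrm (fun x => v0 x - v x)) +
     nrm u0 * nrm (fun x => v0 x - v x).
Proof.
move=> Lu Lv Lu0 Lv0; have Du := sqsummableB Lu0 Lu; have Dv := sqsummableB Lv0 Lv.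
have -> : ip u0 v0 - ip u v = ip (fun x => u0 x - u x) v + ip u0 (fun x => v0 x - v x).
  by rewrite ipBl// (ipC u0 (fun x => v0 x - v x)) ipBl// (ipC v0) (ipC v u0); ring.
apply: le_trans (ler_normD _ _) _; apply: lerD; last exact: cauchy_schwarz.
apply: le_trans (cauchy_schwarz Du Lv) _; apply: ler_wpM2l; first exact: nrm_ge0.
rewrite nrmBC; apply: le_trans (nrmD Lv0 (sqsummableB Lv Lv0)).
have vE : (fun x => v0 x + (v x - v0 x)) = v by apply/funext => x; rewrite subrKC.
by rewrite vE.
Qed.

Lemma cvg_ip (T : Type) (F : set_system T) {FF : Filter F} (u v : T -> R * R -> R)
    (u0 v0 : R * R -> R) :
  (forall a, sqsummable (u a)) -> (forall a, sqsummable (v a)) ->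
  sqsummable u0 -> sqsummable v0 ->
  nrm (fun x => u0 x - u a x) @[a --> F] --> 0 ->
  nrm (fun x => v0 x - v a x) @[a --> F] --> 0 ->
  ip (u a) (v a) @[a --> F] --> ip u0 v0.
Proof.
move=> Lu Lv Lu0 Lv0 cu cv.
have H : nrm (fun x => u0 x - u a x) * (nrm v0 + nrm (fun x => v0 x - v a x)) +
     nrm u0 * nrm (fun x => v0 x - v a x) @[a --> F] --> 0.
  rewrite -[X in _ --> X](addr0 0); apply: cvgD.
    rewrite -[X in _ --> X](mul0r (nrm v0 + 0)); apply: cvgM => //.
    by apply: cvgD => //; exact: cvg_cst.
  by rewrite -[X in _ --> X](mulr0 (nrm u0)); apply: cvgM => //; exact: cvg_cst.
apply/cvgrPdist_le => e e0; move/cvgr_dist_le : H => /(_ _ e0); apply: filterS => a h.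
apply: le_trans (ip_dist (Lu a) (Lv a) Lu0 Lv0) _; apply: le_trans h.
by rewrite sub0r normrN ler_norm.
Qed.

(** The filter is arbitrary because the convective term passes to the limit along truncations, along
    pairs (N, s), and in time. *)
Lemma cvg_int2_mulb (T : Type) (F : set_system T) {FF : Filter F} (u v : T -> R * R -> R)
    (u0 v0 b : R * R -> R) B :
  (forall a, sqsummable (u a)) -> (forall a, sqsummable (v a)) ->
  sqsummable u0 -> sqsummable v0 -> mfun2 b -> (forall x, cell x -> `|b x| <= B) ->
  nrm (fun x => u0 x - u a x) @[a --> F] --> 0 ->
  nrm (fun x => v0 x - v a x) @[a --> F] --> 0 ->
  int2 (fun x => u a x * v a x * b x) @[a --> F] --> int2 (fun x => u0 x * v0 x * b x).
Proof.
move=> Lu Lv Lu0 Lv0 mb bB cu cv.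
have B0 : 0 <= B.
  apply: le_trans (bB (0, 0) _); first exact: normr_ge0.
  by split; rewrite /= in_itv /= lexx twopi_gt0.
have E w z : int2 (fun x => w x * z x * b x) = ip w (fun x => z x * b x).
  by rewrite ipE; congr int2; apply/funext => x; rewrite mulrA.
rewrite E; under eq_fun do rewrite E.
apply: cvg_ip => //.
- by move=> a; exact: (sqsummable_mulb _ mb bB).
- exact: (sqsummable_mulb _ mb bB).
- have H : B * nrm (fun x => v0 x - v a x) @[a --> F] --> 0.
    by rewrite -[X in _ --> X](mulr0 B); apply: cvgM => //; exact: cvg_cst.
  apply: (@squeeze_cvgr _ _ _ _ (cst 0) _ _ _ _ _ H); last exact: cvg_cst.
  apply: nearW => a; rewrite nrm_ge0 /=.
  have -> : (fun x => v0 x * b x - v a x * b x) = (fun x => (v0 x - v a x) * b x).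
    by apply/funext => x; rewrite mulrBl.
  by apply: nrm_mulb => //; exact: sqsummableB.
Qed.

Lemma nrm_ae f g h : sqsummable f -> sqsummable g -> sqsummable h ->
  {ae leb2, forall x, cell x -> f x = g x} ->
  nrm (fun x => f x - h x) = nrm (fun x => g x - h x).
Proof.
move=> Lf Lg Lh fg; rewrite /nrm !ipE; congr Num.sqrt.
have [m1 _] := sqsummableB Lf Lh; have [m2 _] := sqsummableB Lg Lh.
apply: int2_ae; [exact: measurable_funM|exact: measurable_funM|].
by move: fg; apply: filterS => x e cx; rewrite e.
Qed.

Lemma nrm0 : nrm (fun=> 0) = 0 :> R.
Proof.
by rewrite /nrm ipE; under [X in int2 X]eq_fun do rewrite mulr0; rewrite int2_cst mul0r sqrtr0.
Qed.

Lemma fcoef_inj f g : sqsummable f -> sqsummable g -> (forall k, fcoef f k = fcoef g k) ->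
  {ae leb2, forall x, cell x -> f x = g x}.
Proof.
move=> Lf Lg fg; have LB := sqsummableB Lf Lg.
have := fourier_complete (summable2_sqsummable LB).
have H k : int2 (fun x => (f x - g x) * cas k x) = 0.
  by rewrite -ipE ipBl ?[ip f _]fg ?subrr//; exact: sqsummable_cas.
move=> /(_ H); apply: filterS => x e cx; apply/eqP.
by rewrite -subr_eq0 e.
Qed.

Lemma riesz_fischer_coef c f : sqsummable f ->
  nrm (fun x => f x - trig n c x) @[n --> \oo] --> 0 -> forall k, fcoef f k = c k.
Proof.
move=> Lf cf k.
have h : ip (trig n c) (cas k) @[n --> \oo] --> ip f (cas k).
  apply: cvg_ip => //.
  - by move=> n; exact: sqsummable_trig.
  - by move=> n; exact: sqsummable_cas.
  - exact: sqsummable_cas.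
  - rewrite (_ : (fun n => _) = cst 0); first exact: cvg_cst.
    apply/funext => n; under [X in nrm X]eq_fun do rewrite subrr; exact: nrm0.
rewrite /fcoef; apply: (cvg_unique _ h) => //; apply: cvg_near_cst.
have [n kn] := mem_box_ex [:: k].
near=> m; rewrite -[LHS]/(fcoef _ _) fcoef_trig (_ : k \in box m)//.
apply: (@box_leq n); last by apply: kn; rewrite inE.
by near: m; exact: nbhs_infty_ge.
Unshelve. all: by end_near.
Qed.

(** By Riesz-Fischer the series converges to some g with the same coefficients as f; by completeness
    g agrees with f almost everywhere. *)
Theorem parseval_cvg f : sqsummable f ->
  nrm (fun x => f x - trig n (fcoef f) x) @[n --> \oo] --> 0.
Proof.
move=> Lf; have [g [pg Lg cg]] := riesz_fischer (square_summable_fcoef Lf).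
have fg := fcoef_inj Lg Lf (riesz_fischer_coef Lg cg).
rewrite (_ : (fun n => _) = fun n => nrm (fun x => g x - trig n (fcoef f) x))//.
apply/funext => n; apply/esym; apply: nrm_ae => //; exact: sqsummable_trig.
Qed.

Theorem parseval_ip f g : sqsummable f -> sqsummable g ->
  kap * (\sum_(k <- box n) fcoef f k * fcoef g k) @[n --> \oo] --> ip f g.
Proof.
move=> Lf Lg; have := @cvg_ip _ _ _ (fun n => trig n (fcoef f)) (fun n => trig n (fcoef g)) f g.
move=> /(_ \oo _ (fun n => sqsummable_trig _ _) (fun n => sqsummable_trig _ _) Lf Lg).
move=> /(_ (parseval_cvg Lf) (parseval_cvg Lg)).
by under eq_fun do rewrite ip_trig.
Qed.

Lemma parseval f : sqsummable f -> kap * bsum n (fcoef f) @[n --> \oo] --> ip f f.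
Proof.
move=> Lf; have := parseval_ip Lf Lf.
by under eq_fun do under eq_bigr do rewrite -expr2.
Qed.

Lemma parseval_le f B : sqsummable f -> (forall n, bsum n (fcoef f) <= B) ->
  ip f f <= kap * B.
Proof.
move=> Lf fB; apply: (cvg_le (parseval Lf)) => n.
by rewrite ler_wpM2l// kap_ge0.
Qed.

Lemma riesz_fischer_fcoef c : square_summable c -> exists f,
  [/\ periodic2 f, sqsummable f & forall k, fcoef f k = c k].
Proof.
move=> /riesz_fischer[f [pf Lf cf]]; exists f; split=> //; exact: riesz_fischer_coef.
Qed.

End FourierSeries.

(** * The Euler-Galerkin scheme and its enstrophy bound *)

Section Cancellation.
Context {R : realType}.
Implicit Types (c : Z2 -> R) (v : 'I_2 -> Z2 -> R) (k : Z2).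

Lemma dcoefC i j c : dcoef i (dcoef j c) = dcoef j (dcoef i c).
Proof. by apply/funext => k; rewrite /dcoef !kcN; ring. Qed.

Lemma continuousM2 (f g : R * R -> R) : continuous f -> continuous g ->
  continuous (fun x => f x * g x).
Proof. by move=> cf cg x; apply: cvgM; [exact: cf|exact: cg]. Qed.

Lemma continuousD2 (f g : R * R -> R) : continuous f -> continuous g ->
  continuous (fun x => f x + g x).
Proof. by move=> cf cg x; apply: cvgD; [exact: cf|exact: cg]. Qed.

Lemma continuous_cst2 (a : R) : continuous (fun _ : R * R => a).
Proof. by move=> x; exact: cvg_cst. Qed.

Lemma C1_dirM j (f df g dg : R * R -> R) : C1_dir j f df -> C1_dir j g dg ->
  C1_dir j (fun x => f x * g x) (fun x => df x * g x + f x * dg x).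
Proof.
move=> [pf cf cdf Df] [pg cg cdg Dg]; split.
- by move=> x; have [-> ->] := pf x; have [-> ->] := pg x.
- exact: continuousM2.
- by apply: continuousD2; exact: continuousM2.
- move=> x; have := is_deriveM (Df x) (Dg x).
  by move=> H; apply: (is_derive_eqfun H) => //; rewrite /GRing.scale /=; ring.
Qed.

Lemma C1_dirD j (f df g dg : R * R -> R) : C1_dir j f df -> C1_dir j g dg ->
  C1_dir j (fun x => f x + g x) (fun x => df x + dg x).
Proof.
move=> [pf cf cdf Df] [pg cg cdg Dg]; split.
- by move=> x; have [-> ->] := pf x; have [-> ->] := pg x.
- exact: continuousD2.
- exact: continuousD2.
- move=> x; have := is_deriveD (Df x) (Dg x).
  by move=> H; apply: (is_derive_eqfun H).
Qed.

Lemma C1_dir_cst j a : C1_dir j (fun=> a) (fun=> 0 : R).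
Proof.
split; [by []|exact: continuous_cst2|exact: continuous_cst2|].
by move=> x; exact: is_derive_cst.
Qed.

(* The vortex stretching term vanishes in dimension two: with [u = grad^perp psi + cst],
   [\int (u . grad u) . Delta u = 0]. The two fluxes below exhibit the integrand as a
   divergence. *)
Lemma enstrophy_cancel n v : (forall k, \sum_(j < 2) kc j k * v j k = 0) ->
  \sum_(i < 2) \sum_(j < 2) int2 (fun x => trig n (v i) x * trig n (v j) x *
     trig n (dcoef j (fun k => ksq k * v i k)) x) = 0.
Proof.
move=> dv; rewrite !big_ord_recl !big_ord0 /= !addr0.
pose o1 : 'I_2 := lift ord0 ord0.
rewrite -/o1; set a := v ord0; set b := v o1.
pose D0 := @dcoef R ord0; pose D1 := @dcoef R o1; pose T := @trig R n.
have Db : D1 b = fun k => - D0 a k.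
  apply/funext => k; have := dv (- k); rewrite !big_ord_recl big_ord0 addr0 -/o1 !kcN => h.
  by rewrite /D1 /D0 /dcoef /a /b; lra.
(* Multiplication by |k|^2 is minus the Laplacian, written as two successive derivatives. *)
have K c : (fun k => ksq k * c k) = fun k => - (D0 (D0 c) k + D1 (D1 c) k).
  by apply/funext => k; rewrite /D0 /D1 /dcoef opprK !kcN /ksq /kc /=; ring.
have dN0 c : D0 (fun k => - c k) = fun k => - D0 c k.
  by apply/funext => k; rewrite /D0 /dcoef mulrN.
have dN1 c : D1 (fun k => - c k) = fun k => - D1 c k.
  by apply/funext => k; rewrite /D1 /dcoef mulrN.
have dD0 c d : D0 (fun k => c k + d k) = fun k => D0 c k + D0 d k.
  by apply/funext => k; rewrite /D0 /dcoef mulrDr.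
have dD1 c d : D1 (fun k => c k + d k) = fun k => D1 c k + D1 d k.
  by apply/funext => k; rewrite /D1 /dcoef mulrDr.
have tN c x : T (fun k => - c k) x = - T c x :> R.
  by rewrite /T /trig -mulrN -sumrN; congr (_ * _); apply: eq_bigr => k _; rewrite mulNr.
have tD c d x : T (fun k => c k + d k) x = T c x + T d x :> R.
  by rewrite /T /trig -mulrDr -big_split; congr (_ * _); apply: eq_bigr => k _; rewrite mulrDl.
have E10 c : D1 (D0 c) = D0 (D1 c) by exact: dcoefC.
have C0 c : C1_dir ord0 (T c) (T (D0 c)) by exact: C1_trig.
have C1 c : C1_dir o1 (T c) (T (D1 c)) by exact: C1_trig.
have cT c : continuous (T c) by exact: continuous_trig.
(* With u = (a, b), [e] is u . Delta u + |grad u|^2 / 2, and the flux in direction j is u_j e - (u .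
   grad u) . d_j u. *)
pose e x := T a x * (T (D0 (D0 a)) x + T (D1 (D1 a)) x) +
  T b x * (T (D0 (D0 b)) x + T (D1 (D1 b)) x) + 2^-1 * (T (D0 a) x * T (D0 a) x +
  T (D1 a) x * T (D1 a) x + (T (D0 b) x * T (D0 b) x + T (D1 b) x * T (D1 b) x)).
pose F (D : (Z2 -> R) -> Z2 -> R) c x := T c x * e x +
  (-1) * ((T a x * T (D0 a) x + T b x * T (D1 a) x) * T (D a) x +
   (T a x * T (D0 b) x + T b x * T (D1 b) x) * T (D b) x).
(* The derivative of the flux is left open and is filled in by the sum and product rules. *)
evar (G0 : R * R -> R); have H0 : C1_dir ord0 (F D0 a) G0.
  rewrite /F /e /G0.
  by repeat first [exact: C0|exact: C1_dir_cst|apply: C1_dirD|apply: C1_dirM].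
evar (G1 : R * R -> R); have H1 : C1_dir o1 (F D1 b) G1.
  rewrite /F /e /G1.
  by repeat first [exact: C1|exact: C1_dir_cst|apply: C1_dirD|apply: C1_dirM].
pose t (j : 'I_2) c d x := T c x * T d x * T (dcoef j (fun k => ksq k * c k)) x.
have St j c d : summable2 (t j c d).
  by apply: continuous_summable2; apply: continuousM2; [apply: continuousM2|].
have SD f g : summable2 f -> summable2 g -> summable2 (fun x : R * R => f x + g x : R).
  exact: summable2D.
have [S0 S1] : summable2 G0 /\ summable2 G1.
  by case: H0 H1 => _ _ c0 _ [_ _ c1 _]; split; exact: continuous_summable2.
have : int2 (fun x => (t ord0 a a x + t o1 a b x) + (t ord0 b a x + t o1 b b x)) =
    int2 (fun x => -1 * (G0 x + G1 x)).
  (* Pointwise, the integrand plus the divergence of the flux equals minus the sum of d_j u_l d_l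
     u_i d_j u_i. This vanishes because a traceless 2 x 2 matrix A satisfies A^2 = - det A times the
     identity, whose product with A has trace 0. *)
  congr int2; apply/funext => x; rewrite /t !K -/(D0 _) -/(D1 _) -/(D0 (fun k => _)) -/(D1 (fun k => _)).
  rewrite !dN0 !dN1 !dD0 !dD1 /G0 /G1 /F /e.
  rewrite !E10 !Db ?dN0 ?dN1 !E10 ?dN0 ?dN1 !tN !tD ?tN.
  cbv beta; repeat match goal with |- context [T ?c x] => generalize (T c x); intro end.
  by field.
rewrite int2Z; last exact: SD.
rewrite (int2D S0 S1) (int2_partial H0) (int2_partial H1) addr0 mulr0 => <-.
rewrite (int2D (SD _ _ (St ord0 a a) (St o1 a b)) (SD _ _ (St ord0 b a) (St o1 b b))).
by rewrite (int2D (St ord0 a a) (St o1 a b)) (int2D (St ord0 b a) (St o1 b b)).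
Qed.

End Cancellation.
Section Scheme.
Context {R : realType}.
Variables (nu : R) (K : set (int * int)).
Hypothesis nu0 : 0 < nu.
Implicit Types (c : Z2 -> R) (v : 'I_2 -> Z2 -> R) (k : Z2) (u : 'I_2 -> R * R -> R).

(** The symbol of -Y. *)
Definition lam k : R := if k \in K then 0 else ksq k.

(* Coefficients of the orthogonal projection on divergence-free fields; at [k = 0]
   the quotient is [0] and the projection is the identity. *)
Definition leray i j k : R := (i == j)%:R - kc i k * kc j k / ksq k.

(* Coefficients of [(u . grad) u_i = div (u_i u)]. *)
Definition convect u i k : R :=
  - \sum_(j < 2) kc j k * int2 (fun x => u i x * u j x * cas (- k) x).

Definition rhs u v i k : R :=
  - \sum_(j < 2) leray i j k * convect u j k - nu * lam k * v i k.

Definition divfree v := forall k, \sum_(j < 2) kc j k * v j k = 0.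

Definition trigv n v i := trig n (v i).

Definition nsq v k : R := \sum_(i < 2) v i k ^+ 2.

Definition ens n v : R := \sum_(k <- box n) ksq k * nsq v k.

(** The factor 2 [nu] makes this the rate at which the truncated flow loses the enstrophy [ens], a
    sum of squares. *)
Definition dis n v : R := 2 * nu * \sum_(k <- box n) lam k * ksq k * nsq v k.

Lemma ksq_ge0 k : 0 <= ksq k :> R.
Proof. by rewrite /ksq addr_ge0 ?sqr_ge0. Qed.

Lemma ksq_kc k : ksq k = \sum_(j < 2) kc j k ^+ 2 :> R.
Proof. by rewrite !big_ord_recl big_ord0 addr0. Qed.

Lemma ksq0 k : k != 0 -> 1 <= ksq k :> R.
Proof.
move=> k0; have : (k.1 != 0) || (k.2 != 0).
  by apply: contraNT k0; rewrite negb_or !negbK -xpair_eqE; case: k.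
have s1 (a : int) : a != 0 -> 1 <= (a%:~R : R) ^+ 2.
  move=> a0; rewrite -rmorphXn /= -[1]/(1%:~R) ler_int.
  by rewrite -gtz0_ge1 lt_def sqr_ge0 sqrf_eq0 a0.
have p (a : int) : 0 <= (a%:~R : R) ^+ 2 by exact: sqr_ge0.
by case/orP => /s1; rewrite /ksq; [have := p k.2|have := p k.1]; lra.
Qed.

Lemma lam_ge0 k : 0 <= lam k.
Proof. by rewrite /lam; case: ifP => // _; exact: ksq_ge0. Qed.

Lemma lam_le k : lam k <= ksq k.
Proof. by rewrite /lam; case: ifP => // _; exact: ksq_ge0. Qed.

Lemma nsq_ge0 v k : 0 <= nsq v k.
Proof. by apply: sumr_ge0 => i _; exact: sqr_ge0. Qed.

Lemma ord2P (j : 'I_2) : j = ord0 \/ j = lift ord0 ord0.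
Proof. by case: j => -[|[|//]] h; [left|right]; exact: val_inj. Qed.

Lemma leray_kc j k : \sum_(i < 2) kc i k * leray i j k = 0.
Proof.
have [->|k0] := eqVneq k 0.
  by rewrite big1 // => i _; rewrite /kc; case: ifP; rewrite mul0r.
have K0 : ksq k != 0 :> R by rewrite gt_eqF// (lt_le_trans _ (ksq0 k0)).
move: K0; rewrite ksq_kc !big_ord_recl !big_ord0 !addr0 /leray ksq_kc !big_ord_recl big_ord0 addr0.
by case: (ord2P j) => ->; rewrite ?eqxx /=; move: (kc _ k) (kc _ k) => p q K0; field.
Qed.

Lemma divfree_rhs u v k : \sum_(i < 2) kc i k * v i k = 0 ->
  \sum_(i < 2) kc i k * rhs u v i k = 0.
Proof.
move=> dv; rewrite /rhs.
transitivity (- \sum_(i < 2) \sum_(j < 2) convect u j k * (kc i k * leray i j k)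
  - nu * lam k * \sum_(i < 2) kc i k * v i k).
  rewrite [in RHS]mulr_sumr -sumrN -sumrB; apply: eq_bigr => i _.
  rewrite mulrBr mulrN mulr_sumr; congr (- _ - _); last by ring.
  by apply: eq_bigr => j _; ring.
rewrite dv mulr0 subr0 exchange_big big1 ?oppr0// => j _.
by rewrite -mulr_sumr leray_kc mulr0.
Qed.

Lemma sum_rhs u v k : \sum_(i < 2) kc i k * v i k = 0 ->
  \sum_(i < 2) v i k * rhs u v i k =
  - \sum_(j < 2) v j k * convect u j k - nu * lam k * nsq v k.
Proof.
move=> dv; rewrite /rhs.
transitivity (- \sum_(i < 2) \sum_(j < 2) convect u j k * (v i k * leray i j k)
  - nu * lam k * nsq v k).
  rewrite [in RHS]mulr_sumr -sumrN -sumrB; apply: eq_bigr => i _.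
  rewrite mulrBr mulrN mulr_sumr; congr (- _ - _); last by ring.
  by apply: eq_bigr => j _; ring.
congr (- _ - _); rewrite exchange_big; apply: eq_bigr => j _.
rewrite -mulr_sumr mulrC; congr (_ * _).
transitivity (v j k - kc j k / ksq k * \sum_(i < 2) kc i k * v i k); last first.
  by rewrite dv mulr0 subr0.
rewrite mulr_sumr !big_ord_recl !big_ord0 /leray.
by case: (ord2P j) => ->; rewrite ?eqxx /=; ring.
Qed.

(** This is [enstrophy_cancel] read on coefficients: expanding the differentiated factor in modes
    leaves the coefficients of the convective term. *)
Lemma sum_convect n v : divfree v ->
  \sum_(k <- box n) ksq k * \sum_(j < 2) v j k * convect (trigv n v) j k = 0.
Proof.
move=> dv.
have S i j : summable2 (fun x => trigv n v i x * trigv n v j x).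
  by apply: continuous_summable2; apply: continuousM2; exact: continuous_trig.
have := enstrophy_cancel n dv.
have E i j : int2 (fun x => trig n (v i) x * trig n (v j) x *
     trig n (dcoef j (fun k => ksq k * v i k)) x) =
   kap * \sum_(k <- box n) ksq k * v i k * (kc j k *
       int2 (fun x => trigv n v i x * trigv n v j x * cas (- k) x)).
  rewrite (int2_trig n _ (S i j)); congr (_ * _); rewrite -sum_box_opp.
  by apply: eq_bigr => k _; rewrite /dcoef opprK kcN opprK; ring.
under eq_bigr do under eq_bigr do rewrite E.
under eq_bigr do rewrite -mulr_sumr.
rewrite -mulr_sumr => /eqP; rewrite mulf_eq0 gt_eqF ?kap_gt0//= => /eqP H.
transitivity (- \sum_(i < 2) \sum_(j < 2) \sum_(k <- box n) ksq k * v i k *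
   (kc j k * int2 (fun x => trigv n v i x * trigv n v j x * cas (- k) x))); last first.
  by rewrite H oppr0.
under [in RHS]eq_bigr do rewrite exchange_big.
rewrite [in RHS]exchange_big -sumrN; apply: eq_bigr => k _.
rewrite mulr_sumr -sumrN; apply: eq_bigr => i _.
by rewrite /convect !mulrN mulrA mulr_sumr.
Qed.

Lemma sum_ksq_rhs n v : divfree v ->
  \sum_(k <- box n) ksq k * \sum_(i < 2) v i k * rhs (trigv n v) v i k =
  - (nu * \sum_(k <- box n) lam k * ksq k * nsq v k).
Proof.
move=> dv; transitivity (- \sum_(k <- box n) ksq k * \sum_(j < 2) v j k * convect (trigv n v) j k
   - nu * \sum_(k <- box n) lam k * ksq k * nsq v k); last first.
  by rewrite sum_convect// oppr0 sub0r.
rewrite mulr_sumr -!sumrN -big_split; apply: eq_bigr => k _.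
by rewrite sum_rhs//=; ring.
Qed.

Definition convect_bound (A : R) k : R := (`|kc ord0 k| + `|kc ord_max k|) * (2 * A).

Lemma int2_mul_cas_le (f g : R * R -> R) A k : sqsummable f -> sqsummable g ->
  ip f f <= A -> ip g g <= A -> `|int2 (fun x => f x * g x * cas k x)| <= 2 * A.
Proof.
move=> Lf Lg fA gA.
have mc : mfun2 (@cas R k) by exact: (continuous_mfun2 (@continuous_cas _ k)).
have cb x : cell x -> `|cas k x| <= 2 :> R by move=> _; exact: cas_bound.
have -> : int2 (fun x => f x * g x * cas k x) = ip f (fun x => g x * cas k x).
  by rewrite ipE; congr int2; apply/funext => x; rewrite mulrA.
apply: le_trans (cauchy_schwarz Lf (sqsummable_mulb Lg mc cb)) _.
have h := nrm_mulb Lg mc (ler0n R 2) cb.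
apply: le_trans (ler_wpM2l (nrm_ge0 f) h) _; rewrite mulrCA ler_wpM2l//.
have A0 : 0 <= A by apply: le_trans fA; exact: ip_ge0.
have s (w : R * R -> R) : ip w w <= A -> nrm w <= Num.sqrt A by move=> wA; exact: ler_wsqrtr.
by rewrite -[leRHS]sqr_sqrtr// expr2; apply: ler_pM; rewrite ?nrm_ge0 ?s.
Qed.

Lemma convect_le u A i k : (forall i, sqsummable (u i)) -> (forall i, ip (u i) (u i) <= A) ->
  `|convect u i k| <= convect_bound A k.
Proof.
move=> Lu uA; rewrite /convect normrN !big_ord_recl big_ord0 addr0.
apply: le_trans (ler_normD _ _) _; rewrite /convect_bound mulrDl !normrM.
rewrite (_ : lift ord0 ord0 = ord_max :> 'I_2); last exact: val_inj.
by apply: lerD; apply: ler_wpM2l => //; exact: int2_mul_cas_le.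
Qed.

Lemma leray_le i j k : `|leray i j k| <= 2.
Proof.
have [->|k0] := eqVneq k 0.
  rewrite /leray /kc; case: ifP => _; case: ifP => _; rewrite !mul0r subr0;
  by case: (i == j); rewrite ?normr1 ?normr0 ?ler1n.
have K1 := ksq0 k0; have K0 : 0 < ksq k :> R by exact: lt_le_trans K1.
apply: le_trans (ler_normB _ _) _; rewrite (_ : 2 = 1 + 1)//; apply: lerD.
  by case: (i == j); rewrite ?normr1 ?normr0.
rewrite normrM normfV [X in _ / X]gtr0_norm// ler_pdivrMr// mul1r.
have a2 l : kc l k ^+ 2 <= ksq k :> R.
  rewrite ksq_kc (bigD1 l)//= lerDl; apply: sumr_ge0 => m _; exact: sqr_ge0.
have := a2 i; have := a2 j; rewrite -[kc j k ^+ 2]real_normK ?num_real//.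
rewrite -[kc i k ^+ 2]real_normK ?num_real// normrM.
have := sqr_ge0 (`|kc i k| - `|kc j k|); move: (`|kc i k|) (`|kc j k|) => p q; nra.
Qed.

(** The 4 comes from two components, each with a projection coefficient at most 2; 1 + [M] bounds a
    number whose square is at most [M]. *)
Definition rhs_bound (A M : R) k : R := 4 * convect_bound A k + nu * ksq k * (1 + M).

(** The bound grows with k but involves only square norms of u, not the truncation. It becomes the
    Lipschitz constant in time of the mode k, uniformly in N. *)
Lemma rhs_le u v A M i k : (forall i, sqsummable (u i)) -> (forall i, ip (u i) (u i) <= A) ->
  v i k ^+ 2 <= M -> `|rhs u v i k| <= rhs_bound A M k.
Proof.
move=> Lu uA vM; apply: le_trans (ler_normB _ _) _; rewrite normrN; apply: lerD.
  rewrite !big_ord_recl big_ord0 addr0; apply: le_trans (ler_normD _ _) _; rewrite !normrM.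
  have -> : 4 * convect_bound A k = 2 * convect_bound A k + 2 * convect_bound A k by ring.
  by apply: lerD; apply: ler_pM => //; rewrite ?leray_le ?convect_le.
rewrite !normrM [`|nu|]gtr0_norm// [`|lam k|]ger0_norm ?lam_ge0//.
have v1 : `|v i k| <= 1 + M.
  have := sqr_ge0 (`|v i k| - 1); move: vM; rewrite -[_ ^+ 2]real_normK ?num_real//.
  by have := normr_ge0 (v i k); nra.
apply: ler_pM => //; first by rewrite mulr_ge0 ?lam_ge0 ?ltW.
by rewrite ler_pM2l// lam_le.
Qed.

(** The scheme is frozen after N m steps of length 1/m, that is at time N, so that the accumulated
    error is bounded for all n. *)
Definition euler (N m : nat) (v0 : 'I_2 -> Z2 -> R) : nat -> 'I_2 -> Z2 -> R :=
  fix F n := match n with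
  | 0%N => fun i k => if k \in box N then v0 i k else 0
  | n'.+1 => fun i k => F n' i k + m%:R^-1 *
      (if (n' < N * m)%N && (k \in box N) then rhs (trigv N (F n')) (F n') i k else 0)
  end.

Section Bounds.
Variables (v0 : 'I_2 -> Z2 -> R) (E0 : R).
Hypothesis div0 : divfree v0.
Hypothesis ens0 : forall n, ens n v0 <= E0.

(** Bound for the sum of squares of all coefficients: the conserved mean, the initial enstrophy, and
    1 for the error of the scheme. *)
Definition mass : R := nsq v0 0 + E0 + 1.

(** Bound for the enstrophy of the right-hand side: one Euler step of length h adds at most h^2
    times this to the exact balance. *)
Definition rate N : R := \sum_(k <- box N) ksq k * (2 * rhs_bound (kap * mass) mass k ^+ 2).

(* So many Euler steps per unit of time that the quadratic errors of the scheme add at most 1 to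
   the enstrophy up to time [N]. *)
Definition substeps N : nat := ((Num.truncn (N%:R * rate N)).+1 + N)%N.

Definition galerkin N n := euler N (substeps N) v0 n.

Definition tstep N : R := (substeps N)%:R^-1.

Lemma euler_out N m n i k : k \notin box N -> euler N m v0 n i k = 0.
Proof.
move=> kN; elim: n => [|n IH] /=; first by rewrite (negbTE kN).
by rewrite IH (negbTE kN) andbF mulr0 addr0.
Qed.

Lemma euler_div N m n : divfree (euler N m v0 n).
Proof.
elim: n => [|n IH] k /=.
  case kN: (k \in box N); first exact: div0.
  by rewrite big1// => j _; rewrite mulr0.
under eq_bigr do rewrite mulrDr mulrCA.
rewrite big_split /= IH add0r -mulr_sumr; case: ((n < N * m)%N && (k \in box N)).
  by rewrite divfree_rhs ?mulr0//; exact: IH.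
by rewrite big1 ?mulr0// => i _; rewrite mulr0.
Qed.

Lemma convect0 u i : convect u i 0 = 0.
Proof. by rewrite /convect big1 ?oppr0// => j _; rewrite /kc; case: ifP; rewrite mul0r. Qed.

Lemma lam0 : lam 0 = 0.
Proof. by rewrite /lam /ksq /= expr0n addr0; case: ifP. Qed.

(** The mean is conserved because both the convective term, a divergence, and the dissipation vanish
    at k = 0. *)
Lemma euler_mean N m n i : euler N m v0 n i 0 = v0 i 0.
Proof.
elim: n => [|n IH] /=; first by rewrite mem_box.
rewrite IH; case: ifP => _; rewrite ?mulr0 ?addr0// /rhs lam0 mulr0 mul0r subr0.
by rewrite big1 ?oppr0 ?mulr0 ?addr0// => j _; rewrite convect0 mulr0.
Qed.

Lemma sum_box_supp N n (F : Z2 -> R) : (forall k, 0 <= F k) ->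
  (forall k, k \notin box N -> F k = 0) -> \sum_(k <- box n) F k <= \sum_(k <- box N) F k.
Proof.
move=> F0 FN; have [nN|/ltnW Nn] := leqP n N; first exact: sum_box_mono.
rewrite -(sum_box_indic _ Nn) le_eqVlt; apply/orP; left; apply/eqP.
by apply: eq_bigr => k _; case: ifPn => // /FN.
Qed.

(** Poincare's inequality: |k|^2 >= 1 away from 0, and the mean is added separately. *)
Lemma bsum_le_ens v N n i : (forall i k, k \notin box N -> v i k = 0) ->
  bsum n (v i) <= nsq v 0 + ens N v.
Proof.
move=> vN; apply: (@le_trans _ _ (bsum N (v i))).
  apply: sum_box_supp => [k|k /vN ->]; [exact: sqr_ge0|by rewrite expr0n].
have le1 k : v i k ^+ 2 <= nsq v k.
  by rewrite /nsq (bigD1 i)//= lerDl; apply: sumr_ge0 => j _; exact: sqr_ge0.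
rewrite /bsum /ens (bigD1_seq 0) ?uniq_box ?mem_box//= lerD ?le1//.
rewrite [leRHS](bigD1_seq 0) ?uniq_box ?mem_box//= ler_wpDl//.
  by rewrite mulr_ge0 ?nsq_ge0 ?ksq_ge0.
apply: ler_sum => k k0; apply: le_trans (le1 k) _.
by rewrite ler_peMl ?nsq_ge0// ksq0.
Qed.

Lemma rate_ge0 N : 0 <= rate N.
Proof.
by apply: sumr_ge0 => k _; rewrite mulr_ge0 ?ksq_ge0// mulr_ge0 ?sqr_ge0.
Qed.

Lemma tstep_gt0 N : 0 < tstep N.
Proof. by rewrite invr_gt0 ltr0n. Qed.

Lemma hrate N n : (n <= N * substeps N)%N -> n%:R * (tstep N ^+ 2 * rate N) <= 1.
Proof.
move=> nN; have m0 : 0 < (substeps N)%:R :> R by rewrite ltr0n.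
have r : N%:R * rate N <= (substeps N)%:R.
  apply/ltW; rewrite /substeps natrD ltr_wpDr//; exact: truncnS_gt.
apply: (@le_trans _ _ ((N * substeps N)%:R * (tstep N ^+ 2 * rate N))).
  by rewrite ler_wpM2r ?ler_nat// mulr_ge0 ?sqr_ge0 ?rate_ge0.
rewrite natrM /tstep; have -> : N%:R * (substeps N)%:R * ((substeps N)%:R^-1 ^+ 2 * rate N) =
  (N%:R * rate N) / (substeps N)%:R :> R by field; rewrite gt_eqF.
by rewrite ler_pdivrMr// mul1r.
Qed.

Definition spent N n : R :=
  \sum_(0 <= l < n) tstep N * (if (l < N * substeps N)%N then dis N (galerkin N l) else 0).

Lemma dis_ge0 n v : 0 <= dis n v.
Proof.
apply: mulr_ge0; first by rewrite mulr_ge0// ltW.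
apply: sumr_ge0 => k _.
by rewrite !mulr_ge0 ?nsq_ge0 ?lam_ge0 ?ksq_ge0.
Qed.

Lemma spent_ge0 N n : 0 <= spent N n.
Proof.
apply: sumr_ge0 => l _; apply: mulr_ge0; first exact: ltW (tstep_gt0 N).
by case: ifP => // _; exact: dis_ge0.
Qed.

Lemma euler_bsum_ens N n n' i : ens N (galerkin N n) <= E0 + 1 -> bsum n' (galerkin N n i) <= mass.
Proof.
move=> h1; apply: (le_trans (bsum_le_ens _ _ (fun i k => @euler_out N _ n i k))).
have -> : nsq (galerkin N n) 0 = nsq v0 0 by apply: eq_bigr => j _; rewrite /galerkin euler_mean.
by rewrite /mass -addrA lerD2l.
Qed.

Lemma trigv_mass N v i : bsum N (v i) <= mass -> ip (trigv N v i) (trigv N v i) <= kap * mass.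
Proof.
move=> vm; rewrite /trigv ip_trig; apply: ler_wpM2l; first exact: kap_ge0.
by apply: le_trans vm; rewrite le_eqVlt; apply/orP; left; apply/eqP.
Qed.

Lemma euler_rhs_le N n i k : (forall i n', bsum n' (galerkin N n i) <= mass) ->
  `|rhs (trigv N (galerkin N n)) (galerkin N n) i k| <= rhs_bound (kap * mass) mass k.
Proof.
move=> am; apply: rhs_le.
- by move=> j; exact: sqsummable_trig.
- by move=> j; apply: trigv_mass; exact: am.
- have [m km] := mem_box_ex [:: k]; apply: le_trans (am i m).
  rewrite /bsum (bigD1_seq k) ?uniq_box ?km ?inE//= lerDl.
  by apply: sumr_ge0 => l _; exact: sqr_ge0.
Qed.

(** A bootstrap: the estimate after n steps bounds the coefficients, hence the right-hand side,
    hence the error committed in the next step. *)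
Lemma euler_ens N n : ens N (galerkin N n) + spent N n <=
  E0 + (minn n (N * substeps N))%:R * (tstep N ^+ 2 * rate N).
Proof.
elim: n => [|n IH].
  rewrite /spent big_geq// addr0 min0n mul0r addr0; apply: le_trans (ens0 N).
  rewrite /ens le_eqVlt; apply/orP; left; apply/eqP; apply: eq_big_seq => k kN.
  by congr (_ * _); apply: eq_bigr => i _; rewrite /galerkin /= kN.
have [nN|nN] := ltnP n (N * substeps N); last first.
  have -> : galerkin N n.+1 = galerkin N n.
    by apply/funext => i; apply/funext => k; rewrite /galerkin /= ltnNge nN /= mulr0 addr0.
  rewrite /spent big_nat_recr//= ltnNge nN /= mulr0 addr0.
  by rewrite (minn_idPr (leqW nN)); move: IH; rewrite (minn_idPr nN).
(* The errors so far amount to at most 1, by the choice of the step. *)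
have E1 : ens N (galerkin N n) <= E0 + 1.
  apply: le_trans (le_trans IH _); first by rewrite lerDl spent_ge0.
  by rewrite lerD2l (minn_idPl (ltnW nN)) hrate// ltnW.
rewrite /spent big_nat_recr// -/(spent N n) nN (minn_idPl nN) -natr1 mulrDl mul1r.
rewrite (minn_idPl (ltnW nN)) in IH.
have am i n' : bsum n' (galerkin N n i) <= mass by exact: euler_bsum_ens.
pose r i k := rhs (trigv N (galerkin N n)) (galerkin N n) i k.
(* Expanding the square: the cross term is exactly the dissipation by [sum_ksq_rhs], and the
   quadratic term is the error of the scheme. *)
have stepE : ens N (galerkin N n.+1) = ens N (galerkin N n) - tstep N * dis N (galerkin N n) +
    tstep N ^+ 2 * \sum_(k <- box N) ksq k * \sum_(i < 2) r i k ^+ 2.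
  have S := sum_ksq_rhs N (@euler_div N (substeps N) n).
  have -> : tstep N * dis N (galerkin N n) = - (2 * tstep N *
     \sum_(k <- box N) ksq k * \sum_(i < 2) galerkin N n i k * r i k).
    by rewrite /r /galerkin S /dis; ring.
  rewrite opprK /ens !mulr_sumr -!big_split; apply: eq_big_seq => k kN.
  rewrite /nsq !mulr_sumr -!big_split; apply: eq_bigr => i _ /=.
  by rewrite /galerkin /= nN kN /r /tstep /galerkin /=; ring.
rewrite -/(galerkin N n.+1) stepE.
have : tstep N ^+ 2 * \sum_(k <- box N) ksq k * \sum_(i < 2) r i k ^+ 2 <= tstep N ^+ 2 * rate N.
  rewrite ler_wpM2l ?sqr_ge0//; apply: ler_sum => k _; rewrite ler_wpM2l ?ksq_ge0//.
  rewrite !big_ord_recl big_ord0 addr0 (_ : 2 = 1 + 1)// mulrDl mul1r.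
  have q i : r i k ^+ 2 <= rhs_bound (kap * mass) mass k ^+ 2.
    have q : `|r i k| <= rhs_bound (kap * mass) mass k by exact: euler_rhs_le.
    rewrite -[r i k ^+ 2]real_normK ?num_real// lerXn2r ?nnegrE//.
    exact: le_trans q.
  by apply: lerD; exact: q.
by move: IH; rewrite /=; lra.
Qed.

Lemma euler_energy N n : ens N (galerkin N n) + spent N n <= E0 + 1.
Proof. by apply: le_trans (euler_ens N n) _; rewrite lerD2l hrate// geq_minr. Qed.

Lemma euler_bsum N n n' i : bsum n' (galerkin N n i) <= mass.
Proof.
apply: euler_bsum_ens; apply: le_trans (euler_energy N n).
by rewrite lerDl spent_ge0.
Qed.

Lemma euler_ens_le N n n' : ens n' (galerkin N n) <= E0 + 1.
Proof.
apply: (@le_trans _ _ (ens N (galerkin N n))); last first.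
  by apply: le_trans (euler_energy N n); rewrite lerDl spent_ge0.
apply: sum_box_supp => [k|k kN]; first by rewrite mulr_ge0 ?nsq_ge0 ?ksq_ge0.
by rewrite /nsq big1 ?mulr0// => i _; rewrite /galerkin euler_out// expr0n.
Qed.

Lemma euler_rhs N n i k :
  `|rhs (trigv N (galerkin N n)) (galerkin N n) i k| <= rhs_bound (kap * mass) mass k.
Proof. by apply: euler_rhs_le => j n'; exact: euler_bsum. Qed.

End Bounds.

End Scheme.

(** * Passage to the limit along an ultrafilter *)

Section DiscreteODE.
Context {R : realType}.
Variables (U : set_system nat).
Hypothesis UU : UltraFilter U.

Let UP : ProperFilter U := ultra_proper.

(** By compactness of [-B, B] the image of the ultrafilter has a cluster point, and for an
    ultrafilter a cluster point is a limit. *)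
Lemma ultra_bounded_cvg (x : nat -> R) (B : R) : (forall N, `|x N| <= B) ->
  exists l : R, x N @[N --> U] --> l.
Proof.
move=> xB.
have xs : (x @ U) `[- B, B]%classic.
  by apply: nearW => N /=; rewrite in_itv /= -ler_norml.
have [l [_ cl]] := @segment_compact R (- B) B _ (fmap_proper_filter x UP) xs.
exists l => A lA; have [//|UA] := in_ultra_setVsetC (x @^-1` A) UU.
by have [y [/= nAy Ay]] := cl (~` A) A UA lA.
Qed.

(** Pairs (N, s) with N along the ultrafilter and s -> t in the half-line. Joint convergence is
    needed because an Euler increment near t involves the slopes at all intermediate grid times. *)
Definition near_time (t : R) : set_system (nat * R) :=
  filter_prod U (within [set s | 0 <= s] (nbhs t)).

#[global] Instance near_time_filter t : Filter (near_time t).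
Proof. exact: filter_prod_filter. Qed.

Lemma near_timeP (t : R) (P : nat * R -> Prop) : near_time t P -> exists2 d : R, 0 < d &
  U [set N | forall s, 0 <= s -> `|s - t| < d -> P (N, s)].
Proof.
move=> [[A B] /= [UA /nbhs_ballP[d /= d0 dB]] AB]; exists d => //.
apply: filterS UA => N AN s s0 sd; apply: AB; split=> //=; apply: dB => //.
by rewrite /ball /= distrC.
Qed.

Lemma near_time_intro (t d : R) (P : nat * R -> Prop) : 0 < d ->
  U [set N | forall s, 0 <= s -> `|s - t| < d -> P (N, s)] -> near_time t P.
Proof.
move=> d0 UP0; exists ([set N | forall s, 0 <= s -> `|s - t| < d -> P (N, s)],
   [set s | 0 <= s /\ `|s - t| < d]) => /=.
  split=> //; apply/nbhs_ballP; exists d => // s /= sd s0; split=> //.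
  by rewrite distrC.
by move=> [N s] /= [H [s0 sd]]; exact: H.
Qed.

Variables (h : nat -> R).
Hypothesis h0 : forall N, 0 < h N.
Hypothesis hU : h N @[N --> U] --> 0.

Definition slot N (t : R) : nat := Num.truncn (t / h N).

Lemma slot_itv N t : 0 <= t -> h N * (slot N t)%:R <= t < h N * (slot N t)%:R + h N.
Proof.
move=> t0; have q0 : 0 <= t / h N by rewrite divr_ge0// ltW.
have /andP[a b] := truncn_itv q0.
rewrite mulrC -ler_pdivlMr// a /=; move: b; rewrite -/(slot N t) ltr_pdivrMr// => b.
by apply: lt_le_trans b _; rewrite -natr1 mulrDl mul1r mulrC.
Qed.

Lemma slot_grid N (n : nat) : slot N (h N * n%:R) = n.
Proof. by rewrite /slot [h N * _]mulrC mulfK ?gt_eqF// natrK. Qed.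

Lemma slot_mono N s t : 0 <= s -> s <= t -> (slot N s <= slot N t)%N.
Proof. by move=> s0 st; rewrite /slot le_truncn// ler_pM2r ?invr_gt0. Qed.

Variables (a g : nat -> nat -> R).
Hypothesis aS : forall N n, a N n.+1 = a N n + h N * g N n.

Lemma euler_sum N (m n : nat) : (m <= n)%N -> a N n - a N m = h N * \sum_(m <= l < n) g N l.
Proof.
move=> mn; rewrite mulr_sumr; apply/esym.
by apply: (@telescope_sumr_eq _ _ _ (a N)) => // l _; rewrite aS; ring.
Qed.

Lemma slot_diff N s t : 0 <= s -> s <= t ->
  `|h N * ((slot N t)%:R - (slot N s)%:R) - (t - s)| <= h N.
Proof.
move=> s0 st; have /andP[a1 b1] := slot_itv N s0; have /andP[a2 b2] := slot_itv N (le_trans s0 st).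
by rewrite ler_norml; apply/andP; split; lra.
Qed.

(** With [w = 0] this gives the Lipschitz bound; with [w] the limit slope it gives the derivative of
    the limit. *)
Lemma euler_increment N s t (w e : R) : 0 <= s -> s <= t ->
  (forall l, (slot N s <= l < slot N t)%N -> `|g N l - w| <= e) ->
  `|a N (slot N t) - a N (slot N s) - h N * ((slot N t)%:R - (slot N s)%:R) * w| <=
   e * (h N * ((slot N t)%:R - (slot N s)%:R)).
Proof.
move=> s0 st ge; have sl := slot_mono N s0 st.
rewrite euler_sum// -mulrA -mulrBr normrM gtr0_norm// mulrCA ler_pM2l//.
have cst (z : R) : ((slot N t)%:R - (slot N s)%:R) * z = \sum_(slot N s <= l < slot N t) z.
  by rewrite big_const_nat -natrB// iter_addr_0 mulr_natl.
rewrite [e * _]mulrC !cst -sumrB; apply: le_trans (ler_norm_sum _ _ _) _.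
by rewrite !big_nat; apply: ler_sum => l /ge.
Qed.

Variable C : R.
Hypothesis gC : forall N n, `|g N n| <= C.

Lemma euler_lip N s t : 0 <= s -> 0 <= t ->
  `|a N (slot N t) - a N (slot N s)| <= C * (`|t - s| + h N).
Proof.
wlog st : s t / s <= t.
  move=> H s0 t0; have [/H|/ltW/H] := leP s t; first exact.
  by rewrite distrC [`|t - s|]distrC; exact.
move=> s0 t0; have C0 : 0 <= C by apply: le_trans (gC 0 0).
have := @euler_increment N s t 0 C s0 st.
rewrite mulr0 subr0 => H.
apply: le_trans (H _) _; first by move=> l _; rewrite subr0.
rewrite ler_wpM2l//; have := slot_diff N s0 st; rewrite ler_norml => /andP[_].
by rewrite [`|t - s|]ger0_norm ?subr_ge0//; lra.
Qed.

Variables (alpha gamma : R -> R).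
Hypothesis a_alpha : forall t, 0 <= t -> a N (slot N t) @[N --> U] --> alpha t.

Lemma limit_lip s t : 0 <= s -> 0 <= t -> `|alpha t - alpha s| <= C * `|t - s|.
Proof.
move=> s0 t0.
have L : `|a N (slot N t) - a N (slot N s)| @[N --> U] --> `|alpha t - alpha s|.
  by apply: cvg_norm; apply: cvgB; exact: a_alpha.
have M : C * (`|t - s| + h N) @[N --> U] --> C * (`|t - s| + 0).
  by apply: cvgM; [exact: cvg_cst|apply: cvgD => //; exact: cvg_cst].
rewrite -[`|t - s|]addr0; apply: (ler_cvg_to L M).
by apply: nearW => N; exact: euler_lip.
Qed.

(** The uniform Lipschitz bound upgrades convergence at the fixed time t to joint convergence. *)
Lemma near_time_cvg t : 0 <= t -> a z.1 (slot z.1 z.2) @[z --> near_time t] --> alpha t.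
Proof.
move=> t0; apply/cvgrPdist_le => e e0.
have C0 : 0 <= C by apply: le_trans (gC 0 0).
have C1 : 0 < C + 1 by rewrite ltr_wpDl.
have d0 : 0 < e / 4 / (C + 1) by rewrite !divr_gt0.
apply: (near_time_intro d0); have e2 : 0 < e / 2 by rewrite divr_gt0.
have H1 : \forall N \near U, `|alpha t - a N (slot N t)| <= e / 2.
  exact: (cvgr_dist_le _ _ (a_alpha t0)).
have H2 : \forall N \near U, `|0 - h N| <= e / 4 / (C + 1) by exact: (cvgr_dist_le _ _ hU).
near=> N => s s0 sd /=.
have h1 : `|alpha t - a N (slot N t)| <= e / 2 by near: N.
have h2 : `|0 - h N| <= e / 4 / (C + 1) by near: N.
have h3 := euler_lip N s0 t0.
have h4 : C * (`|t - s| + h N) <= e / 2.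
  apply: (@le_trans _ _ ((C + 1) * (e / 4 / (C + 1) + e / 4 / (C + 1)))).
    apply: ler_pM => //; [by rewrite addr_ge0// ltW|by rewrite lerDl|].
    apply: lerD; first by rewrite distrC ltW.
    by move: h2; rewrite sub0r normrN gtr0_norm.
  by rewrite le_eqVlt; apply/orP; left; apply/eqP; field; rewrite gt_eqF.
have := ler_normD (alpha t - a N (slot N t)) (a N (slot N t) - a N (slot N s)).
by rewrite addrA subrK; lra.
Unshelve. all: by end_near.
Qed.

Hypothesis g_gamma : forall t, 0 <= t -> g z.1 (slot z.1 z.2) @[z --> near_time t] --> gamma t.

Lemma near_time_const t : 0 <= t -> g N (slot N t) @[N --> U] --> gamma t.
Proof.
move=> t0; apply/cvgrPdist_le => e e0.
have /cvgr_dist_le/(_ _ e0)/near_timeP[d d0] := g_gamma t0.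
by apply: filterS => N; apply => //; rewrite subrr normr0.
Qed.

Lemma gamma_continuous t (e : R) : 0 <= t -> 0 < e -> exists2 d : R, 0 < d &
  forall s, 0 <= s -> `|s - t| < d -> `|gamma s - gamma t| <= e.
Proof.
move=> t0 e0; have /cvgr_dist_le/(_ _ e0)/near_timeP[d d0 H] := g_gamma t0.
exists d => // s s0 sd.
have L : `|g N (slot N s) - gamma t| @[N --> U] --> `|gamma s - gamma t|.
  by apply: cvg_norm; apply: cvgB; [exact: near_time_const|exact: cvg_cst].
apply: (ler_cvg_to L (cvg_cst e)).
by apply: filterS H => N /(_ s s0 sd) /=; rewrite distrC.
Qed.

(** Near t all discrete slopes are within e of [gamma t], so the increments are too, and this
    survives the limit. Both end points may differ from t, which covers left and right difference
    quotients. *)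
Lemma limit_increment t (e : R) : 0 <= t -> 0 < e -> exists2 d : R, 0 < d &
  forall r s, 0 <= r -> r <= s -> `|r - t| < d -> `|s - t| < d ->
    `|alpha s - alpha r - (s - r) * gamma t| <= e * (s - r).
Proof.
move=> t0 e0; have /cvgr_dist_le/(_ _ e0)/near_timeP[d d0 H] := g_gamma t0.
(* Half of d is kept for the step h: the grid time of the first slot may lie before r by almost
   h. *)
exists (d / 2); first by rewrite divr_gt0.
move=> r s r0 rs rd sd.
have s0 := le_trans r0 rs.
have hs : h N * ((slot N s)%:R - (slot N r)%:R) @[N --> U] --> s - r.
  apply/cvgrPdist_le => e' e'0.
  have /cvgr_dist_le/(_ _ e'0) := hU; apply: filterS => N.
  rewrite sub0r normrN gtr0_norm// => hN; apply: le_trans hN.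
  by rewrite distrC; exact: slot_diff.
have L : `|a N (slot N s) - a N (slot N r) - h N * ((slot N s)%:R - (slot N r)%:R) * gamma t|
    @[N --> U] --> `|alpha s - alpha r - (s - r) * gamma t|.
  apply: cvg_norm; apply: cvgB; first by apply: cvgB; exact: a_alpha.
  by apply: cvgM => //; exact: cvg_cst.
have M : e * (h N * ((slot N s)%:R - (slot N r)%:R)) @[N --> U] --> e * (s - r).
  by apply: cvgM => //; exact: cvg_cst.
apply: (ler_cvg_to L M).
have d2 : 0 < d / 2 by rewrite divr_gt0.
have /cvgr_dist_lt/(_ _ d2) := hU.
apply: filterS2 H => N HN; rewrite sub0r normrN gtr0_norm// => hN.
apply: euler_increment => // l /andP[l1 l2].
have l0 : 0 <= h N * l%:R by rewrite mulr_ge0// ltW.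
suff hl : `|h N * l%:R - t| < d by have := HN _ l0 hl; rewrite /= slot_grid distrC.
have /andP[a1 b1] := slot_itv N r0; have /andP[a2 b2] := slot_itv N s0.
have c1 : h N * (slot N r)%:R <= h N * l%:R by rewrite ler_pM2l// ler_nat.
have c2 : h N * l%:R <= h N * (slot N s)%:R by rewrite ler_pM2l// ler_nat ltnW.
by move: rd sd; rewrite !ltr_norml => /andP[? ?] /andP[? ?]; apply/andP; split; lra.
Qed.

Lemma limit_derive (t : R) : 0 < t -> is_derive t (1 : R) alpha (gamma t).
Proof.
move=> t0.
have D : h^-1 *: ((alpha \o shift t) (h *: (1 : R)) - alpha t) @[h --> 0^'] --> gamma t.
  apply/cvgrPdist_le => e e0.
  have [d d0 H] := limit_increment (ltW t0) e0.
  have m0 : 0 < Num.min d t by rewrite lt_min d0.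
  near=> z; have zn : z != 0 by near: z; exact: nbhs_dnbhs_neq.
  have zd : `|z| < Num.min d t by near: z; apply: dnbhs0_lt.
  rewrite /= [z *: (1 : R)]mulr1; move: zd; rewrite lt_min => /andP[zd zt].
  have tz : 0 <= z + t by move: zt; rewrite ltr_norml => /andP[? _]; lra.
  have -> : gamma t - z^-1 *: (alpha (z + t) - alpha t) =
      - (z^-1 * (alpha (z + t) - alpha t - z * gamma t)).
    by rewrite /GRing.scale /=; field.
  rewrite normrN normrM normfV -ler_pdivlMl ?invr_gt0 ?normr_gt0// invrK [leRHS]mulrC.
  (* The increment estimate has ordered end points, so the two signs of z are treated apart. *)
  have [zp|zneg] := leP 0 z.
    have := H t (z + t) (ltW t0); rewrite subrr normr0 addrK (ger0_norm zp).
    by apply=> //; [rewrite lerDr|move: zd; rewrite ger0_norm].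
  have := H (z + t) t tz; rewrite subrr normr0 addrK (ltr0_norm zneg).
  have -> : t - (z + t) = - z by ring.
  move=> HH; rewrite -normrN opprB opprD opprK.
  have zt' : z + t <= t by rewrite gerDr ltW.
  rewrite ltr0_norm// in zd; have := HH zt' zd d0.
  by congr (_ <= _); congr (`|_|); ring.
have Dt : derivable alpha t 1 by apply/cvg_ex; exists (gamma t).
by split=> //; apply/cvg_lim.
Unshelve. all: by end_near.
Qed.

End DiscreteODE.

(** * Strong convergence under an enstrophy bound *)

Section StrongConvergence.
Context {R : realType}.
Implicit Types (f g : R * R -> R) (c : Z2 -> R) (k : Z2).

Definition h1sum n c : R := \sum_(k <- box n) ksq k * c k ^+ 2.

Lemma ksq_out n k : k \notin box n -> n.+1%:R ^+ 2 <= ksq k :> R.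
Proof.
rewrite mem_box negb_and -!ltnNge /ksq.
have s (a : int) : (n < `|a|)%N -> n.+1%:R ^+ 2 <= (a%:~R : R) ^+ 2.
  move=> na; rewrite -[leRHS]real_normK ?num_real// -intr_norm -abszE.
  by rewrite lerXn2r ?nnegrE// ler_nat.
have p (a : int) : 0 <= (a%:~R : R) ^+ 2 by exact: sqr_ge0.
by case/orP => /s; have := p k.1; have := p k.2; lra.
Qed.

Lemma bsum_tail n0 n c E : (forall n, h1sum n c <= E) ->
  bsum n c <= bsum n0 c + E / n0.+1%:R ^+ 2.
Proof.
move=> cE; have E0 : 0 <= E.
  apply: le_trans (cE 0%N); apply: sumr_ge0 => k _.
  by rewrite mulr_ge0 ?ksq_ge0 ?sqr_ge0.
have N0 : 0 < n0.+1%:R ^+ 2 :> R by rewrite exprn_gt0.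
have [nn|/ltnW nn] := leqP n n0.
  by apply: le_trans (bsum_mono c nn) _; rewrite lerDl divr_ge0// ltW.
rewrite /bsum -(sum_box_indic _ nn).
apply: (@le_trans _ _ (\sum_(k <- box n) (if k \in box n0 then c k ^+ 2 else 0) + 
    \sum_(k <- box n) (ksq k * c k ^+ 2) / n0.+1%:R ^+ 2)); last first.
  rewrite lerD2l -mulr_suml; apply: ler_wpM2r; first by rewrite invr_ge0 ltW.
  exact: cE.
rewrite -big_split; apply: ler_sum => k _ /=.
have q : 0 <= ksq k * c k ^+ 2 by rewrite mulr_ge0 ?ksq_ge0 ?sqr_ge0.
case: ifPn => kn; first by rewrite lerDl divr_ge0// ltW.
rewrite add0r ler_pdivlMr// mulrC; apply: ler_wpM2r; first exact: sqr_ge0.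
exact: ksq_out.
Qed.

Lemma ip_tail f E n0 : sqsummable f -> (forall n, h1sum n (fcoef f) <= E) ->
  ip f f <= kap * (bsum n0 (fcoef f) + E / n0.+1%:R ^+ 2).
Proof. by move=> Lf fE; apply: parseval_le => // n; exact: bsum_tail. Qed.

Lemma fcoefB f g k : sqsummable f -> sqsummable g ->
  fcoef (fun x => f x - g x) k = fcoef f k - fcoef g k.
Proof. by move=> Lf Lg; rewrite /fcoef ipBl//; exact: sqsummable_cas. Qed.

Lemma h1sumB f g E n : sqsummable f -> sqsummable g -> h1sum n (fcoef f) <= E ->
  h1sum n (fcoef g) <= E -> h1sum n (fcoef (fun x => f x - g x)) <= 4 * E.
Proof.
move=> Lf Lg fE gE.
apply: (@le_trans _ _ (2 * (h1sum n (fcoef f) + h1sum n (fcoef g)))); last by lra.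
rewrite /h1sum -big_split mulr_sumr; apply: ler_sum => k _ /=; rewrite fcoefB//.
have : 0 <= ksq k * (fcoef f k + fcoef g k) ^+ 2 by rewrite mulr_ge0 ?ksq_ge0 ?sqr_ge0.
by move: (ksq k) => s; nra.
Qed.

Lemma cvg_sum_seq (T : Type) (F : set_system T) {FF : Filter F} (I : Type) (s : seq I)
    (u : T -> I -> R) (l : I -> R) : (forall i, u a i @[a --> F] --> l i) ->
  \sum_(i <- s) u a i @[a --> F] --> \sum_(i <- s) l i.
Proof.
move=> ul; elim: s => [|i s IH].
  rewrite big_nil; apply: cvg_near_cst; apply: nearW => a; by rewrite big_nil.
rewrite big_cons; under [X in X @ _ --> _]eq_fun do rewrite big_cons.
by apply: cvgD.
Qed.

(* Rellich's theorem in terms of coefficients. *)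
Lemma strong_cvg (T : Type) (F : set_system T) {FF : Filter F} (u : T -> R * R -> R) f E :
  (forall a, sqsummable (u a)) -> sqsummable f ->
  (forall a n, h1sum n (fcoef (u a)) <= E) -> (forall n, h1sum n (fcoef f) <= E) ->
  (forall k, fcoef (u a) k @[a --> F] --> fcoef f k) ->
  nrm (fun x => f x - u a x) @[a --> F] --> 0.
Proof.
move=> Lu Lf uE fE uf.
have E0 : 0 <= E.
  apply: le_trans (fE 0%N); apply: sumr_ge0 => k _.
  by rewrite mulr_ge0 ?ksq_ge0 ?sqr_ge0.
apply/cvgrPdist_le => e e0.
have e2 : 0 < e ^+ 2 / 2 by rewrite divr_gt0 ?exprn_gt0.
(* The high modes then contribute at most e^2/2, since (n0 + 1)^2 >= n0 + 1. The factor 4 is that of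
   [h1sumB] for a difference. *)
pose n0 := Num.truncn (kap * (4 * E) / (e ^+ 2 / 2)).
have n0P : kap * (4 * E / n0.+1%:R ^+ 2) <= e ^+ 2 / 2.
  have h : kap * (4 * E) / (e ^+ 2 / 2) <= n0.+1%:R by apply/ltW/truncnS_gt.
  rewrite mulrA ler_pdivrMr ?exprn_gt0// -ler_pdivrMl// mulrC; apply: le_trans h _.
  by rewrite expr2 ler_peMl// ler1n.
have B : kap * bsum n0 (fun k => fcoef f k - fcoef (u a) k) @[a --> F] --> 0.
  rewrite -[X in _ --> X](mulr0 kap); apply: cvgM; first exact: cvg_cst.
  have -> : 0 = \sum_(k <- box n0) (fcoef f k - fcoef f k) ^+ 2.
    by rewrite big1// => k _; rewrite subrr expr0n.
  apply: cvg_sum_seq => k; rewrite expr2; under eq_fun do rewrite expr2.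
  by apply: cvgM; apply: cvgB => //; exact: cvg_cst.
move/cvgr_dist_le : B => /(_ _ e2); apply: filterS => a.
rewrite !sub0r !normrN => h; rewrite ger0_norm ?nrm_ge0//.
rewrite -(@ler_pXn2r _ 2)// ?nnegrE ?nrm_ge0 ?(ltW e0)// sqr_nrm.
have LB := sqsummableB Lf (Lu a).
have hB n : h1sum n (fcoef (fun x => f x - u a x)) <= 4 * E by exact: h1sumB.
apply: le_trans (ip_tail n0 LB hB) _; rewrite mulrDr.
have -> : bsum n0 (fcoef (fun x => f x - u a x)) = bsum n0 (fun k => fcoef f k - fcoef (u a) k).
  by apply: eq_bigr => k _; rewrite fcoefB.
by rewrite [leRHS]splitr; apply: lerD => //; exact: le_trans (ler_norm _) h.
Qed.

Lemma convect_cvg (T : Type) (F : set_system T) {FF : Filter F} (u : T -> 'I_2 -> R * R -> R)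
    (w : 'I_2 -> R * R -> R) i k :
  (forall a i, sqsummable (u a i)) -> (forall i, sqsummable (w i)) ->
  (forall i, nrm (fun x => w i x - u a i x) @[a --> F] --> 0) ->
  convect (u a) i k @[a --> F] --> convect w i k.
Proof.
move=> Lu Lw uw; apply: cvgN; apply: cvg_sum_seq => j.
apply: cvgM; first exact: cvg_cst.
apply: (@cvg_int2_mulb _ _ _ _ _ _ _ _ _ 2) => //.
- exact: (continuous_mfun2 (@continuous_cas _ _)).
- by move=> x _; exact: cas_bound.
Qed.

Lemma rhs_cvg nu K (T : Type) (F : set_system T) {FF : Filter F} (u : T -> 'I_2 -> R * R -> R)
    (w : 'I_2 -> R * R -> R) (v : T -> 'I_2 -> Z2 -> R) (v' : 'I_2 -> Z2 -> R) i k :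
  (forall a i, sqsummable (u a i)) -> (forall i, sqsummable (w i)) ->
  (forall i, nrm (fun x => w i x - u a i x) @[a --> F] --> 0) ->
  (v a i k @[a --> F] --> v' i k) ->
  rhs nu K (u a) (v a) i k @[a --> F] --> rhs nu K w v' i k.
Proof.
move=> Lu Lw uw vv; apply: cvgB; last by apply: cvgM => //; exact: cvg_cst.
apply: cvgN; apply: cvg_sum_seq => j; apply: cvgM; first exact: cvg_cst.
exact: convect_cvg.
Qed.

End StrongConvergence.

Section LimitSolution.
Context {R : realType}.
Variables (nu : R) (K : set (int * int)) (v0 : 'I_2 -> Z2 -> R) (E0 : R).
Hypothesis nu0 : 0 < nu.
Hypothesis div0 : divfree v0.
Hypothesis ens0 : forall n, ens n v0 <= E0.
Implicit Types (v : 'I_2 -> Z2 -> R) (k : Z2).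

Lemma dis_supp M N v : (forall i k, k \notin box N -> v i k = 0) ->
  dis nu K M v <= dis nu K N v.
Proof.
move=> vN; rewrite /dis ler_pM2l ?mulr_gt0//; apply: sum_box_supp => [k|k kN].
  by rewrite !mulr_ge0 ?nsq_ge0 ?lam_ge0 ?ksq_ge0.
by rewrite /nsq big1 ?mulr0// => i _; rewrite vN// expr0n.
Qed.

Lemma nsq_le_mass v k B : (forall n i, bsum n (v i) <= B) -> nsq v k <= 2 * B.
Proof.
move=> vB; have [n kn] := mem_box_ex [:: k].
have le1 i : v i k ^+ 2 <= B.
  apply: le_trans (vB n i); rewrite /bsum (bigD1_seq k) ?uniq_box ?kn ?inE//= lerDl.
  by apply: sumr_ge0 => l _; exact: sqr_ge0.
by rewrite /nsq !big_ord_recl big_ord0; have := le1 ord0; have := le1 (lift ord0 ord0); lra.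
Qed.

Lemma h1sum_ens n v i : h1sum n (v i) <= ens n v.
Proof.
apply: ler_sum => k _; apply: ler_wpM2l; first exact: ksq_ge0.
by rewrite /nsq (bigD1 i)//= lerDl; apply: sumr_ge0 => j _; exact: sqr_ge0.
Qed.

Lemma coef_le v i k B : (forall n, bsum n (v i) <= B) -> `|v i k| <= 1 + B.
Proof.
move=> vB; have [n kn] := mem_box_ex [:: k].
have : v i k ^+ 2 <= B.
  apply: le_trans (vB n); rewrite /bsum (bigD1_seq k) ?uniq_box ?kn ?inE//= lerDl.
  by apply: sumr_ge0 => l _; exact: sqr_ge0.
have := sqr_ge0 (`|v i k| - 1); rewrite -[_ ^+ 2 <= _]/(_ <= _) -[v i k ^+ 2]real_normK ?num_real//.
by have := normr_ge0 (v i k); nra.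
Qed.

(** The summand N in [substeps] makes the step at most 1/(N + 1). *)
Lemma tstep_cvg : tstep nu v0 E0 N @[N --> \oo] --> 0.
Proof.
apply: (@squeeze_cvgr _ _ _ _ (cst 0) (@harmonic R)); last exact: cvg_harmonic.
  apply: nearW => N; apply/andP; split; first by rewrite ltW// tstep_gt0.
  by rewrite /harmonic /tstep lef_pV2 ?posrE ?ltr0n// ler_nat /substeps addSn ltnS leq_addl.
exact: cvg_cst.
Qed.

(** The function [delta] is the limit of the dissipation accumulated in the modes of [box M]. Stated
    as a bounded antiderivative, the dissipation bound passes to the limit by the same lemmas as the
    coefficients do. *)
Lemma limit_solution : exists (v : R -> 'I_2 -> Z2 -> R) (u : R -> 'I_2 -> R * R -> R),
 [/\ (forall (t : R) i, 0 <= t -> [/\ periodic2 (u t i), sqsummable (u t i) & fcoef (u t i) = v t i]),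
     v 0 = v0 /\ (forall t : R, 0 <= t -> divfree (v t)),
     (forall (t : R) n, 0 <= t -> ens n (v t) <= E0 + 1) /\
     (forall (t : R) n i, 0 <= t -> bsum n (v t i) <= mass v0 E0),
     (forall i k, [/\ (forall s t : R, 0 <= s -> 0 <= t -> `|v t i k - v s i k| <=
          rhs_bound nu (kap * mass v0 E0) (mass v0 E0) k * `|t - s|),
        (forall t : R, 0 < t -> is_derive t (1 : R) (fun t => v t i k) (rhs nu K (u t) (v t) i k)) &
        (forall t : R, 0 < t -> {for t, continuous (fun t : R => rhs nu K (u t) (v t) i k)})]) &
     forall M, exists (delta : R -> R) (C : R), [/\ (forall t : R, 0 <= t -> 0 <= delta t <= E0 + 1),
        (forall s t : R, 0 <= s -> 0 <= t -> `|delta t - delta s| <= C * `|t - s|) &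
        (forall t : R, 0 < t -> is_derive t (1 : R) delta (dis nu K M (v t)))]].
Proof.
pose gal N n := galerkin nu K v0 E0 N n.
pose h N := tstep nu v0 E0 N.
pose m N := substeps nu v0 E0 N.
pose rb k := rhs_bound nu (kap * mass v0 E0) (mass v0 E0) k.
(* The ultrafilter refines the filter at infinity, so whatever holds for all large N holds along
   it. *)
have [U [UU oU]] := ultraFilterLemma (eventually_filter : ProperFilter \oo).
have UP : ProperFilter U := ultra_proper.
have h0 N : 0 < h N by exact: tstep_gt0.
have hU : h N @[N --> U] --> 0.
  by move=> A /tstep_cvg ; exact: oU.
have bnd N n n' i : bsum n' (gal N n i) <= mass v0 E0 by exact: euler_bsum.
have out N n i k : k \notin box N -> gal N n i k = 0 by exact: euler_out.
have lim_coef i k t : {l : R | gal N (slot h N t) i k @[N --> U] --> l}.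
  apply: cid; apply: (ultra_bounded_cvg UU (B := 1 + mass v0 E0)) => N.
  by apply: coef_le => n; exact: bnd.
pose v t i k : R := sval (lim_coef i k t).
have vP i k t : gal N (slot h N t) i k @[N --> U] --> v t i k by exact: (svalP (lim_coef i k t)).
have vens t n : ens n (v t) <= E0 + 1.
  have L : ens n (gal N (slot h N t)) @[N --> U] --> ens n (v t).
    apply: cvg_sum_seq => k; apply: cvgM; first exact: cvg_cst.
    by apply: cvg_sum_seq => i; rewrite expr2; under eq_fun do rewrite expr2; apply: cvgM.
  by apply: (cvg_le L) => N; exact: euler_ens_le.
have vmass t n i : bsum n (v t i) <= mass v0 E0.
  have L : bsum n (gal N (slot h N t) i) @[N --> U] --> bsum n (v t i).
    by apply: cvg_sum_seq => k; rewrite expr2; under eq_fun do rewrite expr2; apply: cvgM.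
  by apply: (cvg_le L) => N; exact: bnd.
have rf i t : {f : R * R -> R | [/\ periodic2 f, sqsummable f & forall k, fcoef f k = v t i k]}.
  by apply: cid; apply: riesz_fischer_fcoef; exists (mass v0 E0) => n; exact: vmass.
pose u t i := sval (rf i t).
have uP t i : [/\ periodic2 (u t i), sqsummable (u t i) & fcoef (u t i) = v t i].
  by have [p1 p2 p3] := svalP (rf i t); split=> //; apply/funext.
have Lu t i : sqsummable (u t i) by have [] := uP t i.
pose g i k N n : R := if (n < N * m N)%N && (k \in box N)
   then rhs nu K (trigv N (gal N n)) (gal N n) i k else 0.
have aS i k N n : gal N n.+1 i k = gal N n i k + h N * g i k N n by [].
pose ac i k N n := gal N n i k.
have gC i k N n : `|g i k N n| <= rb k.
  have rb0 := le_trans (normr_ge0 _) (euler_rhs K nu0 div0 ens0 0 0 i k).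
  by rewrite /g; case: ifP => _; [exact: euler_rhs|rewrite normr0].
have vlip i k s t : 0 <= s -> 0 <= t -> `|v t i k - v s i k| <= rb k * `|t - s|.
  by apply: (@limit_lip _ _ UU _ h0 hU (ac i k) _ (aS i k) _ (gC i k) (fun t => v t i k)) => t' _; exact: vP.
have nt i k t : 0 <= t -> gal z.1 (slot h z.1 z.2) i k @[z --> near_time U t] --> v t i k.
  by apply: (@near_time_cvg _ _ UU _ h0 hU (ac i k) _ (aS i k) _ (gC i k) (fun t => v t i k)) => t' _; exact: vP.
pose w (z : nat * R) i := trigv z.1 (gal z.1 (slot h z.1 z.2)) i.
have Lw z i : sqsummable (w z i) by exact: sqsummable_trig.
have fw z i : fcoef (w z i) = gal z.1 (slot h z.1 z.2) i.
  by apply/funext => k; rewrite /w /trigv fcoef_trig; case: ifPn => // kN; rewrite out.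
have wu t i : 0 <= t -> nrm (fun x => u t i x - w z i x) @[z --> near_time U t] --> 0.
  move=> t0; apply: (@strong_cvg _ _ _ _ _ _ (E0 + 1)) => //.
  - by move=> z n; rewrite fw; apply: le_trans (h1sum_ens _ _ _) _; exact: euler_ens_le.
  - move=> n; have [_ _ ->] := uP t i.
    by apply: le_trans (h1sum_ens _ _ _) _; exact: vens.
  - by move=> k; have [_ _ ->] := uP t i; under eq_fun do rewrite fw; exact: nt.
(* Near a fixed time the scheme is eventually not yet frozen: times below t + 1 precede the horizon
   N. The bound [n0] serves to bring a given mode into the box. *)
have late t n0 : 0 <= t -> near_time U t (fun z => (n0 <= z.1)%N /\ (slot h z.1 z.2 < z.1 * m z.1)%N).
  move=> t0; apply: (near_time_intro ltr01).
  have : U [set N | (maxn n0 (Num.truncn (t + 1)).+1 <= N)%N] by apply: oU; exact: nbhs_infty_ge.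
  apply: filterS => N; rewrite /= geq_max => /andP[nN tN] s s0 st /=; split=> //.
  rewrite -(ltr_nat R) natrM -ltr_pdivrMr ?ltr0n//.
  have /andP[a _] := slot_itv h0 N s0.
  rewrite mulrC; apply: le_lt_trans a _.
  have st1 : s < t + 1 by move: st; rewrite ltr_norml => /andP[_]; lra.
  apply: lt_le_trans st1 _; apply: le_trans (ltW (truncnS_gt _)) _.
  by rewrite ler_nat.
have gcvg i k t : 0 <= t ->
   g i k z.1 (slot h z.1 z.2) @[z --> near_time U t] --> rhs nu K (u t) (v t) i k.
  move=> t0.
  have L : rhs nu K (w z) (gal z.1 (slot h z.1 z.2)) i k @[z --> near_time U t] -->
      rhs nu K (u t) (v t) i k.
    apply: rhs_cvg => //; [by move=> j; exact: wu|exact: nt].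
  have [n0 kn] := mem_box_ex [:: k].
  apply: cvg_trans L; apply: near_eq_cvg; apply: filterS (late t n0 t0) => z [z1 z2].
  by rewrite /g z2 (_ : k \in box z.1)//; apply: (box_leq z1); rewrite kn ?inE.
exists v, u; split.
- by move=> t i _; exact: uP.
- split.
    apply/funext => i; apply/funext => k; apply: (cvg_unique _ (vP i k 0)) => //.
    apply: cvg_near_cst; have [n0 kn] := mem_box_ex [:: k].
    have : U [set N | (n0 <= N)%N] by apply: oU; exact: nbhs_infty_ge.
    apply: filterS => N /= nN; rewrite /slot mul0r truncn0 /gal /galerkin /=.
    by rewrite (_ : k \in box N)//; apply: (box_leq nN); rewrite kn ?inE.
  move=> t _ k; have L : \sum_(j < 2) kc j k * gal N (slot h N t) j k @[N --> U] -->
      \sum_(j < 2) kc j k * v t j k.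
    by apply: cvg_sum_seq => j; apply: cvgM => //; exact: cvg_cst.
  apply: (cvg_unique _ L) => //; apply: cvg_near_cst; apply: nearW => N.
  exact: (euler_div nu K div0).
- by split=> [t n _|t n i _]; [exact: vens|exact: vmass].
- move=> i k; split; first exact: vlip.
    apply: (@limit_derive _ _ UU _ h0 hU (ac i k) _ (aS i k) (fun t => v t i k)
      (fun t => rhs nu K (u t) (v t) i k)) => t t0; [exact: vP|exact: gcvg].
  move=> t t0; apply/cvgrPdist_le => e e0.
  have [d d0 H] := gamma_continuous UU (gcvg i k) (ltW t0) e0.
  have dt0 : 0 < Num.min d t by rewrite lt_min d0.
  have B : nbhs t (ball t (Num.min d t)) by exact: nbhsx_ballx.
  apply: filterS B => s; rewrite /ball /= lt_min distrC => /andP[sd st].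
  rewrite distrC; apply: H => //.
  by move: st; rewrite ltr_norml => /andP[? _]; lra.
move=> M.
pose gM N n : R := if (n < N * m N)%N then dis nu K M (gal N n) else 0.
(* The dissipated amounts form an Euler sequence themselves, with slope [gM], so the limit lemmas
   apply to them. *)
pose aM N n : R := \sum_(0 <= l < n) h N * gM N l.
have aMS N n : aM N n.+1 = aM N n + h N * gM N n by rewrite /aM big_nat_recr.
pose C : R := 2 * nu * \sum_(k <- box M) lam K k * ksq k * (2 * mass v0 E0).
have disC N n : 0 <= dis nu K M (gal N n) <= C.
  rewrite dis_ge0//= /dis ler_pM2l ?mulr_gt0//; apply: ler_sum => k _.
  apply: ler_wpM2l; first by rewrite mulr_ge0 ?lam_ge0 ?ksq_ge0.
  by apply: nsq_le_mass => n' i; exact: bnd.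
have C0 : 0 <= C by have /andP[a b] := disC 0%N 0%N; exact: le_trans b.
have gMC N n : `|gM N n| <= C.
  rewrite /gM; case: ifP => _; last by rewrite normr0.
  by have /andP[a b] := disC N n; rewrite ger0_norm.
have aM0 N n : 0 <= aM N n <= E0 + 1.
  apply/andP; split.
    apply: sumr_ge0 => l _; apply: mulr_ge0; first exact: ltW.
    by rewrite /gM; case: ifP => // _; have /andP[] := disC N l.
  apply: le_trans (euler_energy K nu0 div0 ens0 N n).
  apply: (@le_trans _ _ (spent nu K v0 E0 N n)); last first.
    rewrite lerDr; apply: sumr_ge0 => k _; by rewrite mulr_ge0 ?nsq_ge0 ?ksq_ge0.
  apply: ler_sum => l _; apply: ler_wpM2l; first exact: ltW.
  by rewrite /gM; case: ifP => // _; apply: dis_supp => i k; exact: out.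
have dlim t : {l : R | aM N (slot h N t) @[N --> U] --> l}.
  apply: cid; apply: (ultra_bounded_cvg UU (B := E0 + 1)) => N.
  by have /andP[a b] := aM0 N (slot h N t); rewrite ger0_norm.
pose delta t := sval (dlim t).
have dP t : aM N (slot h N t) @[N --> U] --> delta t by exact: (svalP (dlim t)).
exists delta, C; split.
- move=> t t0; apply/andP; split.
    by apply: (ler_cvg_to (cvg_cst 0) (dP t)); apply: nearW => N; have /andP[] := aM0 N (slot h N t).
  by apply: (cvg_le (dP t)) => N; have /andP[] := aM0 N (slot h N t).
- by apply: (@limit_lip _ _ UU _ h0 hU _ _ aMS _ gMC delta) => t _; exact: dP.
- apply: (@limit_derive _ _ UU _ h0 hU _ _ aMS delta (fun t => dis nu K M (v t))) => [t _|t t0]; first exact: dP.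
  have L : dis nu K M (gal z.1 (slot h z.1 z.2)) @[z --> near_time U t] --> dis nu K M (v t).
    apply: cvgM; first exact: cvg_cst.
    apply: cvg_sum_seq => k; apply: cvgM; first exact: cvg_cst.
    apply: cvg_sum_seq => i; rewrite expr2; under eq_fun do rewrite expr2.
    by apply: cvgM; exact: nt.
  apply: cvg_trans L; apply: near_eq_cvg; apply: filterS (late t 0%N t0) => z [_ z2].
  by rewrite /gM z2.
Qed.

End LimitSolution.

(** * Sobolev norms and dissipation *)

Section FourierHartley.
Context {R : realType}.
Implicit Types (f g : R * R -> R) (k : Z2).

Lemma ksqN k : ksq (- k) = ksq k :> R.
Proof. by rewrite /ksq /= !mulrNz !sqrrN. Qed.

Lemma inL2_sqsummable f : inL2 f -> sqsummable f.
Proof.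
move=> [_ mf nf]; split; first exact: mf.
apply/integrableP; split.
  by apply/measurable_EFinP; apply: measurable_funX; exact: mf.
apply: le_lt_trans nf; rewrite /normL2sq le_eqVlt; apply/orP; left; apply/eqP.
by apply: eq_integral => x _; rewrite gee0_abs// lee_fin sqr_ge0.
Qed.

Lemma normL2sqE f : sqsummable f -> normL2sq f = (ip f f)%:E.
Proof.
move=> [mf If]; rewrite ipE /int2 /Rintegral fineK.
  by apply: eq_integral => x _; rewrite expr2.
under eq_fun do rewrite -expr2.
exact: (integrable_fin_num measurable_cell If).
Qed.

Lemma sqsummable_inL2 f : periodic2 f -> sqsummable f -> inL2 f.
Proof.
move=> pf Lf; split=> //; first by case: Lf.
by rewrite normL2sqE// ltry.
Qed.

(** The cosine and sine integrals are the half sum and half difference of the coefficients at k and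
    -k. *)
Lemma fourierE f k : sqsummable f ->
  fourier f k = (((fcoef f k + fcoef f (- k)) / 2) -i* ((fcoef f k - fcoef f (- k)) / 2))%C.
Proof.
move=> Lf; have If := summable2_sqsummable Lf.
have mc (w : R -> R) : continuous w -> (forall x, `|w x| <= 1) ->
    summable2 (fun x => f x * w (kdot k x)).
  move=> cw wb; apply: (@summable2_mulb _ _ _ 1) => //; apply: continuous_mfun2 => x.
  by apply: continuous_comp; [exact: continuous_kdot|exact: cw].
have Sc := mc _ (@continuous_cos R) (@cos_max R).
have Ss := mc _ (@continuous_sin R) (@sin_max R).
have p : fcoef f k = int2 (fun x => f x * cos (kdot k x)) + int2 (fun x => f x * sin (kdot k x)).
  by rewrite -int2D//; congr int2; apply/funext => x; rewrite mulrDr.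
have q : fcoef f (- k) = int2 (fun x => f x * cos (kdot k x)) - int2 (fun x => f x * sin (kdot k x)).
  rewrite -int2B//; congr int2; apply/funext => x.
  by rewrite casN mulrBr.
by rewrite p q /fourier; congr (_ -i* _)%C; rewrite /int2; field.
Qed.

Lemma sqmod_fourier f k : sqsummable f ->
  sqmod (fourier f k) = (fcoef f k ^+ 2 + fcoef f (- k) ^+ 2) / 2.
Proof. by move=> Lf; rewrite fourierE// /sqmod /=; field. Qed.

Lemma sum_sqmod_fourier f n : sqsummable f ->
  \sum_(k <- box n) ksq k * sqmod (fourier f k) = h1sum n (fcoef f).
Proof.
move=> Lf; transitivity ((h1sum n (fcoef f) +
   \sum_(k <- box n) ksq (- k) * fcoef f (- k) ^+ 2) / 2).
  rewrite /h1sum -big_split mulr_suml; apply: eq_bigr => k _.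
  by rewrite sqmod_fourier//= ksqN; field.
by rewrite (sum_box_opp n (fun k => ksq k * fcoef f k ^+ 2)) -/(h1sum _ _); field.
Qed.

Lemma term_ge0 f k : (0%E <= (ksq k * sqmod (fourier f k))%:E)%E.
Proof. by rewrite lee_fin mulr_ge0 ?ksq_ge0// addr_ge0 ?sqr_ge0. Qed.

Lemma normHdot1sq_le f E : sqsummable f -> (forall n, h1sum n (fcoef f) <= E) ->
  (normHdot1sq f <= (kap * E)%:E)%E.
Proof.
move=> Lf fE; rewrite /normHdot1sq EFinM; apply: lee_pmul.
- by rewrite lee_fin; exact: kap_ge0.
- by apply: esum_ge0 => k _; exact: term_ge0.
- by rewrite lee_fin /kap.
(* The sum over Z^2 is a supremum over finite sets, each of which is contained in a box. *)
apply: ge_ereal_sup => _ [A [/finite_seqP[s ->] _] <-].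
have -> : [set` s] = [set` undup s] by apply/seteqP; split=> x /=; rewrite mem_undup.
rewrite -fsbig_seq ?undup_uniq//.
have [n sn] := mem_box_ex (undup s).
rewrite sumEFin lee_fin; apply: le_trans (fE n); rewrite -sum_sqmod_fourier//.
have p k : 0 <= ksq k * sqmod (fourier f k) by have := term_ge0 f k; rewrite lee_fin.
rewrite [leRHS](bigID [in undup s]) /= (_ : \sum_(k <- box n | k \in undup s) _ =
  \sum_(k <- undup s) ksq k * sqmod (fourier f k)); last first.
  rewrite -big_filter; apply: perm_big; apply: uniq_perm; rewrite ?filter_uniq ?uniq_box ?undup_uniq//.
  by move=> k; rewrite mem_filter andb_idr// => /sn.
by rewrite lerDl; apply: sumr_ge0.
Qed.

Lemma inH1_h1sum f : inH1 f -> exists E, forall n, h1sum n (fcoef f) <= E.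
Proof.
move=> [/inL2_sqsummable Lf fH].
pose S := \esum_(k in [set: Z2]) (ksq k * sqmod (fourier f k))%:E.
have S0 : (0 <= S)%E by apply: esum_ge0 => k _; exact: term_ge0.
have Sf : S \is a fin_num.
  rewrite ge0_fin_numE//; move: fH; rewrite /normHdot1sq -/S.
  have k0 : 0 < (2 * pi) ^- 2 :> R := kap_gt0.
  by move: S0; case: (S) => [r| |] //= _; rewrite ?ltry// mulry gtr0_sg// mul1e.
exists (fine S) => n; rewrite -lee_fin fineK// -sum_sqmod_fourier//.
apply: ereal_sup_ubound; exists [set` box n].
  by split=> //; exact: finite_seq.
by rewrite -fsbig_seq ?uniq_box// sumEFin.
Qed.

(** The complex mode k mixes the real modes k and -k; the symmetry of [K] makes the symbol take the
    same value on both. *)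
Lemma is_YP K f g : symmetricZ2 K -> sqsummable f -> sqsummable g ->
  (forall k, fcoef g k = - lam K k * fcoef f k) -> is_Y K f g.
Proof.
move=> sK Lf Lg gf k; rewrite !fourierE// !gf.
have lN : lam K (- k) = lam K k :> R.
  rewrite /lam ksqN; have -> // : (- k \in K) = (k \in K).
  by apply/idP/idP; rewrite !inE; [move/sK|move/sK]; rewrite ?opprK.
rewrite lN /lam; case: ifP => _; first by rewrite oppr0 !mul0r subrr addr0 mul0r oppr0.
by rewrite /real_complex_def; simpc; congr (_ +i* _)%C; field.
Qed.

End FourierHartley.

(** * Functions of time on the half-line *)

Section HalfLine.
Context {R : realType}.

(** Freezing at negative times turns a Lipschitz function on the half-line into a continuous
    function on the whole line. *)
Lemma continuous_max0 (f : R -> R) (C : R) :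
  (forall s t : R, 0 <= s -> 0 <= t -> `|f t - f s| <= C * `|t - s|) ->
  continuous (fun t : R => f (Num.max 0 t)).
Proof.
move=> fC t; apply/cvgrPdist_le => e e0.
have C0 : 0 <= C by have := le_trans (normr_ge0 _) (fC 0 1 (lexx _) ler01); rewrite subr0 normr1 mulr1.
have d0 : 0 < e / (C + 1) by rewrite divr_gt0// ltr_wpDl.
apply: filterS (nbhsx_ballx t _ d0) => s; rewrite /ball /= => st.
have M0 (x : R) : 0 <= Num.max 0 x by rewrite le_max lexx.
apply: le_trans (fC _ _ (M0 s) (M0 t)) _.
have lm : `|Num.max 0 t - Num.max 0 s| <= `|t - s|.
  have a := ler_norm (t - s); have b := ler_norm (s - t); rewrite distrC in b.
  by rewrite /Num.max; case: (ltP 0 t); case: (ltP 0 s) => h1 h2;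
     rewrite ler_norml; apply/andP; split; lra.
apply: (@le_trans _ _ ((C + 1) * (e / (C + 1)))).
  by apply: ler_pM => //; [rewrite lerDl|exact: le_trans lm (ltW st)].
by rewrite mulrCA divff ?mulr1// gt_eqF// ltr_wpDl.
Qed.

(** On [0, n] the integral is an increment of [delta], hence at most [B]; then n -> oo. The
    antiderivative is frozen at negative times to be continuous at 0. *)
Lemma integral_rate (f delta : R -> R) (B C : R) : (forall t, 0 <= f t) -> continuous f ->
  (forall t : R, 0 < t -> is_derive t (1 : R) delta (f t)) ->
  (forall s t : R, 0 <= s -> 0 <= t -> `|delta t - delta s| <= C * `|t - s|) ->
  (forall t : R, 0 <= t -> 0 <= delta t <= B) ->
  (\int[lebesgue_measure]_(t in `[0%R, +oo[) (f t)%:E <= B%:E)%E.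
Proof.
move=> f0 cf df dC dB.
have L := @ge0_cvgn_integral R lebesgue_measure f f0 (continuous_measurable_fun cf).
rewrite -(cvg_lim _ L)//; apply: lime_le; first by apply/cvg_ex; eexists; exact: L.
near=> n; have n0 : (0 < n)%N by near: n; exact: nbhs_infty_gt.
have n0' : 0 < n%:R :> R by rewrite ltr0n.
pose D t := delta (Num.max 0 t).
have cD : continuous D by exact: continuous_max0 dC.
have DD (t : R) : 0 < t -> is_derive t (1 : R) D (f t).
  move=> t0; have H : \forall s \near t, delta s = D s.
    near=> s; have s0 : 0 < s by near: s; exact: lt_nbhsr.
    by rewrite /D max_r// ltW.
  by have [d1 d2] := df t t0; split; [exact: near_eq_derivable H d1|
     rewrite -d2; apply: near_eq_derive; apply: filterS H => s ->].
rewrite (@continuous_FTC2 R f D 0 n%:R n0').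
- rewrite -EFinB lee_fin /D maxxx (max_r (ltW n0')).
  have /andP[_ h1] := dB n%:R (ltW n0'); have /andP[h2 _] := dB 0 (lexx _).
  lra.
- exact: continuous_subspaceT.
- split.
  + by move=> t; rewrite in_itv /= => /andP[t0 _]; case: (DD t t0).
  + exact/cvg_at_right_filter/cD.
  + exact/cvg_at_left_filter/cD.
- by move=> t; rewrite in_itv /= => /andP[t0 _]; rewrite derive1E; case: (DD t t0).
Unshelve. all: by end_near.
Qed.

End HalfLine.

Section Dissipation.
Context {R : realType}.
Variables (nu : R) (K : set (int * int)) (v : R -> 'I_2 -> Z2 -> R) (L : Z2 -> R) (B : R).
Hypothesis nu0 : 0 < nu.
Hypothesis v_lip : forall i k (s t : R), 0 <= s -> 0 <= t -> `|v t i k - v s i k| <= L k * `|t - s|.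
Hypothesis v_dis : forall M, exists (delta : R -> R) (C : R),
  [/\ (forall t : R, 0 <= t -> 0 <= delta t <= B),
      (forall s t : R, 0 <= s -> 0 <= t -> `|delta t - delta s| <= C * `|t - s|) &
      (forall t : R, 0 < t -> is_derive t (1 : R) delta (dis nu K M (v t)))].

Lemma continuous_coef i k : continuous (fun t : R => v (Num.max 0 t) i k).
Proof. exact: (@continuous_max0 _ (fun t => v t i k) _ (v_lip i k)). Qed.

Lemma continuous_dis M : continuous (fun t : R => dis nu K M (v (Num.max 0 t))).
Proof.
move=> t; apply: cvgM; first exact: cvg_cst.
apply: cvg_sum_seq => k; apply: cvgM; first exact: cvg_cst.
apply: cvg_sum_seq => i; rewrite expr2; under eq_fun do rewrite expr2.
by apply: cvgM; exact: continuous_coef.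
Qed.

Lemma integral_dis M :
  (\int[lebesgue_measure]_(t in `[0%R, +oo[) (dis nu K M (v (Num.max 0 t)))%:E <= B%:E)%E.
Proof.
have [delta [C [dB dC dd]]] := v_dis M.
apply: (@integral_rate _ _ delta B C) => //; [by move=> t; exact: dis_ge0|exact: continuous_dis|].
by move=> t t0; rewrite max_r ?ltW//; exact: dd.
Qed.

Let c i (t : R) k : R := - lam K k * v (Num.max 0 t) i k.

(** Up to the factor [kap], the squared norm of Yu at time t, with the value +oo where the series
    diverges. *)
Let y i (t : R) : \bar R := limn (fun n => (bsum n (c i t))%:E).

Let bsum_nd i t : {homo (fun n => (bsum n (c i t))%:E) : m n / (m <= n)%N >-> (m <= n)%E}.
Proof. by move=> m n mn; rewrite lee_fin bsum_mono. Qed.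

Let measurable_bsum i n : measurable_fun [set: R] (fun t : R => (bsum n (c i t))%:E).
Proof.
apply/measurable_EFinP; apply: continuous_measurable_fun => t.
apply: cvg_sum_seq => k; rewrite expr2; under eq_fun do rewrite expr2.
by apply: cvgM; apply: cvgM; [exact: cvg_cst|exact: continuous_coef|exact: cvg_cst|exact: continuous_coef].
Qed.

Let y_ge0 i t : (0 <= y i t)%E.
Proof.
apply: lime_ge; first exact: ereal_nondecreasing_is_cvgn (bsum_nd i t).
by apply: nearW => n; rewrite lee_fin bsum_ge0.
Qed.

Let measurable_y i : measurable_fun [set: R] (y i).
Proof.
apply: (@emeasurable_fun_cvg _ _ R setT (fun n (t : R) => (bsum n (c i t))%:E)).
  by move=> n; exact: measurable_bsum.
by move=> t _; exact: ereal_nondecreasing_is_cvgn (bsum_nd i t).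
Qed.

(** Monotone convergence in the truncation, together with lam^2 <= lam |k|^2: the dissipation of
    enstrophy controls the square norm of Yu. *)
Let integral_y i : (\int[lebesgue_measure]_(t in `[0%R, +oo[) y i t <= (B / (2 * nu))%:E)%E.
Proof.
have mI : measurable (`[0%R, +oo[ : set R) by exact: measurable_itv.
have mb n : measurable_fun (`[0%R, +oo[ : set R) (fun t : R => (bsum n (c i t))%:E).
  exact: measurable_funS (measurable_bsum i n).
rewrite monotone_convergence//; last first.
  by move=> n t _; rewrite lee_fin bsum_ge0.
apply: lime_le.
  apply: ereal_nondecreasing_is_cvgn => m n mn; apply: ge0_le_integral => //.
  - by move=> t _; rewrite lee_fin bsum_ge0.
  - exact: mb.
  - exact: mb.
  - by move=> t _; rewrite lee_fin bsum_mono.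
apply: nearW => n.
have md : measurable_fun (`[0%R, +oo[ : set R) (fun t : R => (dis nu K n (v (Num.max 0 t)))%:E).
  apply: (@measurable_funS _ _ _ _ setT) => //; apply/measurable_EFinP.
  by apply: continuous_measurable_fun; exact: continuous_dis.
have n2 : 0 <= (2 * nu)^-1 by rewrite invr_ge0 mulr_ge0// ltW.
apply: (@le_trans _ _ (\int[lebesgue_measure]_(t in `[0%R, +oo[)
   (((2 * nu)^-1)%:E * (dis nu K n (v (Num.max 0 t)))%:E))%E).
  apply: ge0_le_integral => //.
  - by move=> t _; rewrite lee_fin bsum_ge0.
  - exact: mb.
  - exact: measurable_funeM.
  - move=> t _; rewrite -EFinM lee_fin /dis mulKf ?gt_eqF ?mulr_gt0//.
    apply: ler_sum => k _; rewrite /c exprMn sqrrN.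
    apply: ler_pM; rewrite ?sqr_ge0//.
      by rewrite expr2; apply: ler_wpM2l; [exact: lam_ge0|exact: lam_le].
    by rewrite /nsq (bigD1 i)//= lerDl; apply: sumr_ge0 => j _; exact: sqr_ge0.
rewrite ge0_integralZl//; last by move=> t _; rewrite lee_fin dis_ge0.
rewrite (mulrC B) EFinM; apply: lee_wpmul2l; first by rewrite lee_fin.
exact: integral_dis.
Qed.

(** [A i] is the set of times at which the coefficients of Yu are square summable; elsewhere the
    field is set to 0. Its measurability keeps the coefficients of [Yu i] measurable in time. *)
Lemma dissipation_field : exists (Yu : 'I_2 -> R -> R * R -> R) (A : 'I_2 -> set R),
  forall i, [/\ in_L2_L2 (Yu i), (forall t, sqsummable (Yu i t)), measurable (A i),
    {ae lebesgue_measure, forall t : R, 0 <= t -> A i t} &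
    forall (t : R) k, 0 <= t ->
      fcoef (Yu i t) k = if t \in A i then - lam K k * v t i k else 0].
Proof.
pose A i : set R := [set t | (y i t < +oo)%E].
have yA i t : A i t -> square_summable (c i t).
  move=> yt; exists (fine (y i t)) => n; rewrite -lee_fin fineK ?ge0_fin_numE//.
  rewrite /y (cvg_lim _ (ereal_nondecreasing_cvgn (bsum_nd i t)))//.
  by apply: ereal_sup_ubound; exists n.
have ex i t : {f : R * R -> R | [/\ periodic2 f, sqsummable f &
    forall k, fcoef f k = if t \in A i then c i t k else 0]}.
  apply: cid; apply: riesz_fischer_fcoef.
  case: (boolP (t \in A i)) => [|_]; first by rewrite inE => /yA.
  by exists 0 => n; rewrite /bsum big1// => k _; rewrite expr0n.
pose Yu i t := sval (ex i t).
have YuP i t : [/\ periodic2 (Yu i t), sqsummable (Yu i t) &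
    forall k, fcoef (Yu i t) k = if t \in A i then c i t k else 0] by exact: (svalP (ex i t)).
have mI : measurable (`[0%R, +oo[ : set R) by exact: measurable_itv.
have mA i : measurable (A i).
  rewrite /A -[X in measurable X]setTI; apply: emeasurable_fun_infty_o => //.
have myI i : measurable_fun (`[0%R, +oo[ : set R) (y i).
  exact: measurable_funS (measurable_y i).
have iy i : lebesgue_measure.-integrable (`[0%R, +oo[ : set R) (y i).
  apply/integrableP; split; first exact: myI.
  apply: (@le_lt_trans _ _ (B / (2 * nu))%:E); last exact: ltry.
  apply: le_trans (integral_y i); rewrite le_eqVlt; apply/orP; left; apply/eqP.
  by apply: eq_integral => t _; rewrite gee0_abs.
have aeA i : {ae lebesgue_measure, forall t : R, 0 <= t -> A i t}.
  have := integrable_ae _ (iy i); rewrite /= => /(_ mI); apply: filterS => t H t0.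
  by have := H _; rewrite ge0_fin_numE//; apply; rewrite /= in_itv /= t0.
exists Yu, A => i; split=> //; last 2 first.
- by move=> t; have [] := YuP i t.
- by move=> t k t0; have [_ _ ->] := YuP i t; rewrite /c max_r.
split.
  by apply: aeW => t _; have [p1 p2 _] := YuP i t; exact: sqsummable_inL2.
have -> : [set t : R | 0 <= t] = `[0%R, +oo[%classic.
  by apply/seteqP; split=> t /=; rewrite in_itv /= andbT.
apply: le_lt_trans (ltry (kap * (B / (2 * nu)))).
rewrite EFinM; apply: le_trans (lee_wpmul2l _ (integral_y i)); last by rewrite lee_fin; exact: kap_ge0.
have k0 : (0 <= kap%:E :> \bar R)%E by rewrite lee_fin; exact: kap_ge0.
rewrite -ge0_integralZl//; last exact: myI.
(* [fine] sends +oo to 0, which agrees with the zero field chosen off [A i]. *)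
have nY t : (normL2sq (Yu i t) = kap%:E * (fine (y i t))%:E)%E.
  have [p1 p2 p3] := YuP i t; rewrite normL2sqE//; congr EFin.
  have H := parseval p2; rewrite -(cvg_lim _ H)//; apply/cvg_lim => //.
  case: (boolP (t \in A i)) => tA.
    have tA' := tA; rewrite inE in tA'; have [E [cE _]] := bsum_cvg (yA _ _ tA').
    have -> : fcoef (Yu i t) = c i t by apply/funext => k; rewrite p3 tA.
    apply: cvgM; first exact: cvg_cst.
    have yE : y i t = E%:E by apply/cvg_lim => //; apply: cvg_EFin => //; exact: nearW.
    by rewrite yE.
  have -> : fcoef (Yu i t) = fun=> 0 by apply/funext => k; rewrite p3 (negbTE tA).
  have yE : y i t = +oo%E.
    by apply/eqP; rewrite -leye_eq leNgt; apply: contraNN tA => h; rewrite inE.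
  rewrite yE mulr0; apply: cvg_near_cst; apply: nearW => n.
  by rewrite /bsum big1 ?mulr0// => k _; rewrite expr0n.
apply: ge0_le_integral => //.
- by move=> t _; rewrite nY -EFinM lee_fin mulr_ge0 ?kap_ge0// fine_ge0.
- rewrite (_ : (fun t => _) = fun t : R => (kap%:E * (fine (y i t))%:E)%E); last first.
    by apply/funext => t; rewrite -nY.
  apply: measurable_funeM.
  apply/measurable_EFinP; apply: (measurableT_comp (f := @fine R) (g := y i)).
    exact: fine_measurable.
  exact: myI.
- by apply: measurable_funeM; exact: myI.
- move=> t _; rewrite nY; apply: lee_wpmul2l => //.
  by case: (y i t) (y_ge0 i t) => [r| |] //=; rewrite leey.
Qed.

End Dissipation.

(** * Weak derivatives *)

Section WeakDerivatives.
Context {R : realType}.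
Implicit Types (f g psi : R * R -> R) (k : Z2) (j : 'I_2).

Lemma test_C1 j psi : test_space psi -> C1_dir j psi (partial j psi).
Proof.
move=> [sp pp]; split=> //.
- by case: (sp [::]).
- by case: (sp [:: e_ j]).
- by move=> x; apply: DeriveDef => //; case: (sp [::]) => _; exact.
Qed.

Lemma nrm_subrr f : nrm (fun x => f x - f x) = 0.
Proof. by rewrite -[RHS](@nrm0 R); congr nrm; apply/funext => x; rewrite subrr. Qed.

(** Integration by parts holds for the truncated series, and both sides converge by Parseval. *)
Lemma weak_partial_fcoef j f g : sqsummable f -> sqsummable g ->
  fcoef g = dcoef j (fcoef f) -> weak_partial j f g.
Proof.
move=> Lf Lg gf psi tpsi; have [pp cp cdp dp] := test_C1 j tpsi.
have Lp := continuous_sqsummable cp; have Ldp := continuous_sqsummable cdp.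
have E n : ip (trig n (fcoef g)) psi = - ip (trig n (fcoef f)) (partial j psi).
  have := int2_partial (C1_dirM (C1_trig j n (fcoef f)) (test_C1 j tpsi)).
  rewrite int2D; last 2 first.
  - exact: sqsummableM (sqsummable_trig _ _) Lp.
  - exact: sqsummableM (sqsummable_trig _ _) Ldp.
  by rewrite gf => /eqP; rewrite addr_eq0 => /eqP.
have c0 h : nrm (fun x => h x - h x) @[n --> \oo] --> (0 : R) by rewrite nrm_subrr; exact: cvg_cst.
have A : ip (trig n (fcoef g)) psi @[n --> \oo] --> ip g psi.
  by apply: cvg_ip => //; [move=> n; exact: sqsummable_trig|exact: parseval_cvg].
have B : ip (trig n (fcoef f)) (partial j psi) @[n --> \oo] --> ip f (partial j psi).
  by apply: cvg_ip => //; [move=> n; exact: sqsummable_trig|exact: parseval_cvg].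
have B' : ip (trig n (fcoef g)) psi @[n --> \oo] --> - ip f (partial j psi).
  by under eq_fun do rewrite E; exact: cvgN.
by apply: (cvg_unique _ A) => //; exact: B'.
Qed.

Lemma square_summable_dcoef j c E : (forall n, h1sum n c <= E) ->
  square_summable (dcoef j c : Z2 -> R).
Proof.
move=> cE; exists E => n; apply: le_trans (cE n).
rewrite /bsum /h1sum -(sum_box_opp n (fun k => ksq k * c k ^+ 2)); apply: ler_sum => k _.
rewrite /dcoef exprMn sqrrN; apply: ler_wpM2r; first exact: sqr_ge0.
rewrite ksqN ksq_kc (bigD1 j)//= lerDl; apply: sumr_ge0 => i _; exact: sqr_ge0.
Qed.

(** Truncation acts mode by mode and preserves zero divergence, so u . grad u_i = div (u_i u) holds
    for the truncated fields. Integration by parts against [cas k] and strong convergence give the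
    claim. *)
Lemma convect_field (u : 'I_2 -> R * R -> R) (Du : 'I_2 -> 'I_2 -> R * R -> R) i k :
  (forall i, sqsummable (u i)) -> (forall i j, sqsummable (Du i j)) ->
  (forall i j, fcoef (Du i j) = dcoef j (fcoef (u i))) -> divfree (fun i => fcoef (u i)) ->
  int2 (fun x => (\sum_(j < 2) u j x * Du i j x) * cas k x) = convect u i k.
Proof.
move=> Lu LD Df dv.
pose w n j := trig n (fcoef (u j)); pose dw n l j := trig n (dcoef j (fcoef (u l))).
have Lw n j : sqsummable (w n j) by exact: sqsummable_trig.
have Ldw n l j : sqsummable (dw n l j) by exact: sqsummable_trig.
have cw j : nrm (fun x => u j x - w n j x) @[n --> \oo] --> 0 by exact: parseval_cvg.
have cdw l j : nrm (fun x => Du l j x - dw n l j x) @[n --> \oo] --> 0.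
  by rewrite /dw -Df; exact: parseval_cvg.
have mc l : mfun2 (@cas R l) by apply: continuous_mfun2; exact: continuous_cas.
have cb l x : cell x -> `|@cas R l x| <= 2 by move=> _; exact: cas_bound.
have I3 f g l : sqsummable f -> sqsummable g -> summable2 (fun x => f x * g x * cas l x).
  by move=> Lf Lg; exact: (summable2_mulb (sqsummableM Lf Lg) (mc l) (cb l)).
have E n : \sum_(j < 2) int2 (fun x => w n j x * dw n i j x * cas k x) =
    - \sum_(j < 2) kc j k * int2 (fun x => w n i x * w n j x * cas (- k) x).
  have Z j : int2 (fun x => w n j x * dw n i j x * cas k x) +
      int2 (fun x => w n i x * dw n j j x * cas k x) +
      kc j k * int2 (fun x => w n i x * w n j x * cas (- k) x) = 0.
    have cc : C1_dir j (@cas R k) (fun x => kc j k * cas (- k) x).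
      split; [exact: periodic2_cas|exact: continuous_cas|
        apply: continuousM2; [exact: continuous_cst2|exact: continuous_cas]|
        move=> x; exact: is_derive_cas].
    rewrite -(int2_partial (C1_dirM (C1_dirM (C1_trig j n (fcoef (u i)))
      (C1_trig j n (fcoef (u j)))) cc)) -int2Z; last exact: I3.
    rewrite -!int2D; try exact: I3; try exact: summable2Z (I3 _ _ _ _ _).
      by congr int2; apply/funext => x; rewrite /w /dw; ring.
    by apply: summable2D; exact: I3.
  have D0 : \sum_(j < 2) int2 (fun x => w n i x * dw n j j x * cas k x) = 0.
    rewrite -int2_sum; last by move=> j; exact: I3.
    rewrite (_ : (fun x => _) = cst 0) ?int2_cst ?mul0r//; apply/funext => x.
    rewrite -mulr_suml -mulr_sumr /dw.
    rewrite (_ : \sum_(j < 2) _ = 0) ?mulr0 ?mul0r//.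
    rewrite /trig -mulr_sumr exchange_big big1 ?mulr0//= => l _.
    have := dv (- l); rewrite -mulr_suml (_ : \sum_(i < 2) _ = \sum_(i < 2) dcoef i (fcoef (u i)) l).
      by move=> ->; rewrite mul0r.
    by apply: eq_bigr => j _; rewrite /dcoef kcN.
  have S (a b c : 'I_2 -> R) : (forall j, a j + b j + c j = 0) -> \sum_(j < 2) b j = 0 ->
      \sum_(j < 2) a j = - \sum_(j < 2) c j.
    move=> abc b0; have : \sum_(j < 2) (a j + b j + c j) = 0 by rewrite big1.
    by rewrite 2!big_split /= b0 addr0 => /eqP; rewrite addr_eq0 => /eqP.
  exact: S Z D0.
have A : \sum_(j < 2) int2 (fun x => w n j x * dw n i j x * cas k x) @[n --> \oo] -->
    \sum_(j < 2) int2 (fun x => u j x * Du i j x * cas k x).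
  by apply: cvg_sum_seq => j; apply: (cvg_int2_mulb _ _ _ _ (mc k) (cb k)) => //.
have B : - \sum_(j < 2) kc j k * int2 (fun x => w n i x * w n j x * cas (- k) x) @[n --> \oo] -->
    convect u i k.
  apply: cvgN; apply: cvg_sum_seq => j; apply: cvgM; first exact: cvg_cst.
  by apply: (cvg_int2_mulb _ _ _ _ (mc (- k)) (cb (- k))) => //; exact: cw.
transitivity (\sum_(j < 2) int2 (fun x => u j x * Du i j x * cas k x)); last first.
  have A' : \sum_(j < 2) int2 (fun x => w n j x * dw n i j x * cas k x) @[n --> \oo] -->
      convect u i k by under eq_fun do rewrite E; exact: B.
  by apply: (cvg_unique _ A) => //; exact: A'.
rewrite -int2_sum; last by move=> j; exact: I3.
by congr int2; apply/funext => x; rewrite mulr_suml.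
Qed.

Lemma is_derive_cas_dir k (x v : R * R) : is_derive x v (cas k) (kdot k v * cas (- k) x).
Proof.
apply: is_derive_line.
have E (h : R) : kdot k (h *: v + x) = h * kdot k v + kdot k x.
  have [E1 E2] : (h *: v + x).1 = h * v.1 + x.1 /\ (h *: v + x).2 = h * v.2 + x.2 by [].
  by rewrite /kdot E1 E2; ring.
rewrite /cas; under [X in is_derive _ _ X]eq_fun do rewrite E.
apply: is_derive_eq; rewrite kdotN cosN sinN mul0r !add0r.
by rewrite /GRing.scale /=; ring.
Qed.

(** Iterated directional derivatives of a basis function remain multiples of a basis function. *)
Lemma test_space_cas k : test_space (@cas R k).
Proof.
split; last exact: periodic2_cas.
have P (s : seq (R * R)) : exists (a : R) (l : Z2), Defs.iterD s (@cas R k) = fun x => a * cas l x.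
  elim: s => [|v s [a [l IH]]]; first by exists 1, k; apply/funext => x; rewrite mul1r.
  exists (a * kdot l v), (- l); apply/funext => x; rewrite /= -/(Defs.iterD s _) IH.
  have H := is_derive_cas_dir l x v; rewrite -mulrA.
  by rewrite (_ : (fun z => _) = a *: cas l)// deriveZ ?derive_val//; case: H.
move=> s; have [a [l ->]] := P s; split.
  by apply: continuousM2; [exact: continuous_cst2|exact: continuous_cas].
move=> v x; have [dc _] := is_derive_cas_dir l x v.
by rewrite (_ : (fun z => _) = a *: cas l)//; apply: derivableZ.
Qed.

Lemma divfree_fcoef (u : 'I_2 -> R * R -> R) : (forall i, sqsummable (u i)) ->
  div_free u -> divfree (fun i => fcoef (u i)).
Proof.
move=> Lu du k; have := du _ (test_space_cas (- k)).
under eq_bigr => j _.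
  rewrite -/(int2 _) (_ : int2 _ = kc j (- k) * fcoef (u j) k).
  over.
  rewrite -int2Z; last exact: sqsummableM (Lu j) (sqsummable_cas k).
  congr int2; apply/funext => x; rewrite /partial; have [_ ->] := is_derive_cas j (- k) x.
  by rewrite opprK mulrCA.
by under eq_bigr => j _ do rewrite kcN mulNr; rewrite sumrN => /eqP; rewrite oppr_eq0 => /eqP.
Qed.

Section TimeContinuity.
Variables (u : R -> R * R -> R) (c : R -> Z2 -> R) (L : Z2 -> R) (E : R).
Hypothesis u_coef : forall t, 0 <= t -> [/\ periodic2 (u t), sqsummable (u t) & fcoef (u t) = c t].
Hypothesis c_h1sum : forall t n, 0 <= t -> h1sum n (c t) <= E.
Hypothesis c_lip : forall k (s t : R), 0 <= s -> 0 <= t -> `|c t k - c s k| <= L k * `|t - s|.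

Lemma sqsummable_max0 (s : R) : sqsummable (u (Num.max 0 s)).
Proof. by have [|] := @u_coef (Num.max 0 s) _; rewrite ?le_max ?lexx. Qed.

(** Coefficients are continuous in time and the enstrophy is bounded, so [strong_cvg] applies to the
    filter s -> t. *)
Lemma cvg_nrm_coef (t : R) :
  nrm (fun x => u (Num.max 0 t) x - u (Num.max 0 s) x) @[s --> t] --> 0.
Proof.
have M0 (s : R) : 0 <= Num.max 0 s by rewrite le_max lexx.
have cm (s : R) : fcoef (u (Num.max 0 s)) = c (Num.max 0 s) by have [] := u_coef (M0 s).
apply: (@strong_cvg _ _ _ _ _ _ E).
- by move=> s; exact: sqsummable_max0.
- exact: sqsummable_max0.
- by move=> s n; rewrite cm; exact: c_h1sum.
- by move=> n; rewrite cm; exact: c_h1sum.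
- move=> k; under eq_fun do rewrite cm.
  rewrite cm; exact: (@continuous_max0 _ (fun t => c t k) _ (c_lip k) t).
Qed.

Lemma in_C_L2_coef : in_C_L2 u.
Proof.
split=> t t0; first by have [pu Lu _] := u_coef t0; exact: sqsummable_inL2.
have [_ Lu cu] := u_coef t0.
have := cvg_nrm_coef t; rewrite (max_r t0) => H.
apply: (@cvg_trans _ ((nrm (fun x => u t x - u (Num.max 0 s) x) ^+ 2)%:E @[s --> within `[0, +oo[ (nbhs t)])).
  apply: near_eq_cvg; near=> s.
  have s0 : 0 <= s.
    have : `[0, +oo[%classic s by near: s; exact: withinT.
    by rewrite /= in_itv /= andbT.
  have [_ Ls _] := u_coef s0; rewrite max_r// nrmBC sqr_nrm normL2sqE//; exact: sqsummableB.
have -> : 0%E = ((0 : R) ^+ 2)%:E by rewrite expr0n.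
apply: cvg_EFin; first exact: nearW.
rewrite /comp /= expr2; under eq_fun do rewrite expr2.
by apply: cvgM; apply: cvg_within_filter; exact: H.
Unshelve. all: by end_near.
Qed.

End TimeContinuity.

End WeakDerivatives.

(** * Test functions and their coefficients *)

Section BoxSums.
Context {R : realType}.
Implicit Types (k : Z2).

(** The product form makes the sum of the inverses factor into two sums over Z; the weight also
    dominates |k|^2. *)
Definition wt k : R := (1 + kc ord0 k ^+ 2) * (1 + kc ord_max k ^+ 2).

Lemma wt_ge1 k : 1 <= wt k.
Proof. by apply: mulr_ege1; rewrite lerDl sqr_ge0. Qed.

Lemma wt_gt0 k : 0 < wt k. Proof. exact: lt_le_trans ltr01 (wt_ge1 k). Qed.

Lemma wtN k : wt (- k) = wt k.
Proof. by rewrite /wt !kcN !sqrrN. Qed.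

Lemma wtE k : wt k = 1 + kc ord0 k ^+ 2 + kc ord_max k ^+ 2 +
  kc ord0 k ^+ 2 * kc ord_max k ^+ 2.
Proof. by rewrite /wt; ring. Qed.

Lemma perm_zrangeS n : perm_eq (zrange n.+1) (n.+1%:Z :: - n.+1%:Z :: zrange n).
Proof.
apply: uniq_perm; first exact: uniq_zrange.
  by rewrite 2!cons_uniq in_cons !mem_zrange uniq_zrange; lia.
by move=> a; rewrite mem_zrange 2!in_cons mem_zrange; lia.
Qed.

(** A telescoping majorant: the two terms added at step n are at most 4/(n + 1) - 4/(n + 2), and for
    n = 0 both sides are 1. *)
Lemma sum_zrange n : \sum_(a <- zrange n) (1 + a%:~R ^+ 2)^-1 <= 5 - 4 / n.+1%:R :> R.
Proof.
elim: n => [|n IH]; first by rewrite /zrange /= big_seq1 subrr expr0n addr0 invr1; lra.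
rewrite (perm_big _ (perm_zrangeS n)) 2!big_cons mulrNz sqrrN.
have n0 : 0 <= n%:R :> R by rewrite ler0n.
have -> : (n.+1%:Z)%:~R = n%:R + 1 :> R by rewrite natr1.
have e1 : n.+1%:R = n%:R + 1 :> R by rewrite natr1.
have e2 : n.+2%:R = n%:R + 1 + 1 :> R by rewrite !natr1.
rewrite e2; rewrite e1 in IH; move=> {e1 e2}.
set x : R := n%:R in n0 IH *.
have H : 2 * (1 + (x + 1) ^+ 2)^-1 <= 4 / (x + 1) - 4 / (x + 1 + 1).
  have -> : 4 / (x + 1) - 4 / (x + 1 + 1) = 4 / ((x + 1) * (x + 1 + 1)).
    by field; apply/andP; split; rewrite gt_eqF//; lra.
  rewrite ler_pdivlMr ?mulr_gt0//; last 2 first; try lra.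
  rewrite mulrAC ler_pdivrMr; last by rewrite ltr_pwDl// sqr_ge0.
  by nra.
suff : (1 + (x + 1) ^+ 2)^-1 + ((1 + (x + 1) ^+ 2)^-1 +
    \sum_(a <- zrange n) (1 + a%:~R ^+ 2)^-1) <= 5 - 4 / (x + 1 + 1) by [].
lra.
Qed.

Lemma sum_wt n : \sum_(k <- box n) (wt k)^-1 <= 25.
Proof.
rewrite /box big_allpairs_dep /=.
have S0 : 0 <= \sum_(a <- zrange n) (1 + a%:~R ^+ 2)^-1 :> R.
  by apply: sumr_ge0 => a _; rewrite invr_ge0 addr_ge0// sqr_ge0.
have S5 : \sum_(a <- zrange n) (1 + a%:~R ^+ 2)^-1 <= 5 :> R.
  by apply: le_trans (sum_zrange n) _; rewrite gerBl divr_ge0.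
rewrite (_ : \sum_(a <- _) _ = (\sum_(a <- zrange n) (1 + a%:~R ^+ 2)^-1) ^+ 2).
  by rewrite (_ : 25 = 5 ^+ 2); [rewrite 2!expr2; exact: ler_pM|ring].
rewrite expr2 mulr_suml; apply: eq_bigr => a _; rewrite mulr_sumr; apply: eq_bigr => b _.
by rewrite -invfM.
Qed.

Lemma box_sum_le (F : Z2 -> R) C n : (forall k, `|F k| <= C / wt k) ->
  \sum_(k <- box n) `|F k| <= 25 * C.
Proof.
move=> FC; have C0 : 0 <= C.
  by have := le_trans (normr_ge0 _) (FC 0); rewrite pmulr_lge0// invr_gt0 wt_gt0.
apply: (@le_trans _ _ (\sum_(k <- box n) C * (wt k)^-1)); first exact: ler_sum.
by rewrite -mulr_sumr mulrC; apply: ler_wpM2r => //; exact: sum_wt.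
Qed.

Lemma box_sum_cvg (F : Z2 -> R) C : (forall k, `|F k| <= C / wt k) ->
  cvgn (fun n => \sum_(k <- box n) F k).
Proof.
move=> FC.
have mono (G : Z2 -> R) B : (forall k, 0 <= G k) -> (forall n, \sum_(k <- box n) G k <= B) ->
    cvgn (fun n => \sum_(k <- box n) G k).
  move=> G0 GB; apply: nondecreasing_is_cvgn.
    by move=> m n mn; exact: sum_box_mono.
  by exists B => _ [n _ <-].
rewrite (_ : (fun n => _) = (fun n => \sum_(k <- box n) (`|F k| + F k) - \sum_(k <- box n) `|F k|)).
  apply: is_cvgB.
    apply: (mono _ (25 * (2 * C))) => [k|n]; first by have := ler_norm (- F k); rewrite normrN; lra.
    apply: le_trans (box_sum_le (F := fun k => `|F k| + F k) n _).
      by apply: ler_sum => k _; exact: ler_norm.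
    move=> k; apply: le_trans (ler_normD _ _) _; rewrite normr_id.
    by have := FC k; rewrite -mulrA; lra.
  by apply: (mono _ (25 * C)) => // n; exact: box_sum_le.
by apply/funext => n; rewrite big_split/= addrC addrK.
Qed.

End BoxSums.

Section AbsoluteFourier.
Context {R : realType}.
Implicit Types (f g : R * R -> R) (k : Z2).

(* An absolutely convergent Fourier series is bounded and represents its function almost everywhere,
   so it can be integrated term by term against merely integrable functions. *)
Lemma int2_trig_cvg f g C : summable2 g -> sqsummable f ->
  (forall k, `|fcoef f k| <= C / wt k) ->
  kap * (\sum_(k <- box n) fcoef f k * int2 (fun x => g x * cas k x)) @[n --> \oo] -->
    int2 (fun x => g x * f x).
Proof.
move=> Ig Lf fC; pose T n := trig n (fcoef f).
pose B : R := kap * (25 * (2 * C)).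
have TB n x : `|T n x| <= B.
  rewrite /T /trig normrM (ger0_norm kap_ge0); apply: ler_wpM2l; first exact: kap_ge0.
  apply: le_trans (ler_norm_sum _ _ _) (box_sum_le n _) => k.
  rewrite normrM mulrC -mulrA; apply: ler_pM => //; exact: cas_bound.
have cT x : T n x @[n --> \oo] --> limn (fun n => T n x).
  apply: is_cvgM; first exact: is_cvg_cst.
  apply: (@box_sum_cvg _ _ (2 * C)) => k.
  rewrite normrM mulrC -mulrA; apply: ler_pM => //; exact: cas_bound.
pose L x := limn (fun n => T n x).
have mT n : mfun2 (T n) by exact: mfun2_trig.
have mL : mfun2 L by apply: (mfun2_cvg mT) => x _; exact: cT.
have LB x : `|L x| <= B.
  apply: (ler_cvg_to (cvg_norm (cT x)) (cvg_cst B)); exact: nearW.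
have SL : sqsummable L by apply: (sqsummable_bounded mL) => x _; exact: LB.
have LE : {ae leb2, forall x, cell x -> f x = L x}.
  apply: fcoef_inj => // k.
  have mk : mfun2 (@cas R k) by apply: continuous_mfun2; exact: continuous_cas.
  have [_ H] : summable2 (fun x => L x * cas k x) /\
      int2 (fun x => T n x * cas k x) @[n --> \oo] --> int2 (fun x => L x * cas k x).
    apply: (@int2_dominated _ _ _ (cst (B * 2))).
    - by move=> n; exact: measurable_funM (mT n) mk.
    - by apply: (@summable2_bounded _ _ `|B * 2|); [exact: mfun2_cst|].
    - by move=> n x _; rewrite normrM; apply: ler_pM => //; exact: cas_bound.
    - by move=> x _; apply: cvgM; [exact: cT|exact: cvg_cst].
  apply: (cvg_unique _ _ H) => //; apply: cvg_near_cst.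
  have [n0 kn] := mem_box_ex [:: k].
  near=> n; rewrite -ipE -/(fcoef _ k) fcoef_trig (_ : k \in box n)//.
  apply: (@box_leq n0); first by near: n; exact: nbhs_infty_ge.
  by apply: kn; rewrite inE.
have [_ H] : summable2 (fun x => g x * L x) /\
    int2 (fun x => g x * T n x) @[n --> \oo] --> int2 (fun x => g x * L x).
  have mg := measurable_summable2 Ig.
  apply: (@int2_dominated _ _ _ (fun x => B * `|g x|)).
  - by move=> n; exact: measurable_funM mg (mT n).
  - apply: summable2Z; exact: integrable_norm Ig.
  - by move=> n x _; rewrite normrM mulrC; apply: ler_pM.
  - by move=> x _; apply: cvgM; [exact: cvg_cst|exact: cT].
rewrite (@int2_ae _ _ (fun x => g x * L x)).
- by under eq_fun do rewrite -int2_trig//; exact: H.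
- by apply: measurable_funM; [exact: measurable_summable2|case: Lf].
- by apply: measurable_funM; [exact: measurable_summable2|].
- by apply: filterS LE => x h cx; rewrite h.
Unshelve. all: by end_near.
Qed.

End AbsoluteFourier.

Section TestFunctions.
Context {R : realType}.
Implicit Types (phi : R * (R * R) -> R) (k : Z2) (j : 'I_2) (t : R) (x : R * R).

Lemma iterD_rcons (V : normedModType R) (s : seq V) (v : V) (f : V -> R) :
  Defs.iterD (rcons s v) f = Defs.iterD s (fun z => 'D_v f z).
Proof. by rewrite /Defs.iterD foldr_rcons. Qed.

Lemma supported_D phi (v : R * (R * R)) (a b : R) : supported_in a b phi ->
  supported_in a b (fun z => 'D_v phi z).
Proof.
move=> sab t x tab.
rewrite (@near_eq_derive _ _ _ _ (cst 0)) ?derive_cst//.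
have : \forall s \near t, ~~ (a <= s <= b).
  move: tab; rewrite negb_and -!ltNge => /orP[h|h].
    by near=> s; rewrite negb_and -!ltNge; apply/orP; left; near: s; exact: lt_nbhsl.
  by near=> s; rewrite negb_and -!ltNge; apply/orP; right; near: s; exact: lt_nbhsr.
move=> H; exists ([set s | ~~ (a <= s <= b)], setT) => /=; first by split=> //; exact: filterT.
by move=> [s y] [/= sab' _]; exact: sab.
Unshelve. all: by end_near.
Qed.

Lemma test_D phi (v : R * (R * R)) : test_spacetime phi -> test_spacetime (fun z => 'D_v phi z).
Proof.
move=> [sp pp [a [b [a0 sab]]]]; split.
- by move=> s; rewrite -iterD_rcons; exact: sp.
(* Difference quotients are invariant under a translation that leaves [phi] invariant. *)
- move=> t [x y]; have P (w : R * R) : (forall z : R * (R * R), phi ((0, w) + z) = phi z) ->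
      'D_v phi ((0, w) + (t, (x, y))) = 'D_v phi (t, (x, y)).
    move=> H; rewrite /derive.
    suff -> : (fun h => h^-1 *: ((phi \o shift ((0, w) + (t, (x, y)))) (h *: v) - phi ((0, w) + (t, (x, y))))) =
        (fun h => h^-1 *: ((phi \o shift (t, (x, y))) (h *: v) - phi (t, (x, y)))) by [].
    by apply/funext => h /=; rewrite H addrCA H.
  split => /=.
    rewrite -(P (2 * pi, 0)) => [|[t' [x' y']]].
      by congr ('D_v phi (_, (_, _))); rewrite ?add0r// addrC.
    rewrite -[RHS](proj1 (pp t' (x', y'))) /=.
    by congr (phi (_, (_, _))); rewrite ?add0r// addrC.
  rewrite -(P (0, 2 * pi)) => [|[t' [x' y']]].
    by congr ('D_v phi (_, (_, _))); rewrite ?add0r// addrC.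
  rewrite -[RHS](proj2 (pp t' (x', y'))) /=.
  by congr (phi (_, (_, _))); rewrite ?add0r// addrC.
- by exists a, b; split=> //; exact: supported_D.
Qed.

Lemma test_dt phi : test_spacetime phi -> test_spacetime (dt phi).
Proof. exact: test_D. Qed.

Lemma test_dx j phi : test_spacetime phi -> test_spacetime (dx j phi).
Proof. exact: test_D. Qed.

Lemma continuous_slice phi t : continuous phi -> continuous (fun x => phi (t, x)).
Proof.
move=> cp x; apply: (@continuous_comp _ _ _ (fun x => (t, x)) phi); last exact: cp.
exact: cvg_pair (cvg_cst _) cvg_id.
Qed.

Lemma test_continuous phi : test_spacetime phi -> continuous phi.
Proof. by case=> sp _ _; case: (sp [::]). Qed.

Lemma test_is_derive phi (v z : R * (R * R)) : test_spacetime phi -> is_derive z v phi ('D_v phi z).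
Proof. by case=> sp _ _; apply: DeriveDef => //; case: (sp [::]) => _; exact. Qed.

Lemma C1_slice j phi t : test_spacetime phi ->
  C1_dir j (fun x => phi (t, x)) (fun x => dx j phi (t, x)).
Proof.
move=> tp; split.
- by case: tp.
- exact: continuous_slice (test_continuous tp).
- exact: continuous_slice (test_continuous (test_dx j tp)).
- move=> x; apply: is_derive_line.
  have := test_is_derive (0, e_ j) (0 *: (0, e_ j) + (t, x)) tp.
  move/is_derive_along => H; apply: (is_derive_eqfun H) => [h|].
    by congr (phi (_, _)); rewrite /= scaler0 add0r.
  by rewrite /dx scale0r add0r.
Qed.

Lemma is_derive_time phi t x : test_spacetime phi ->
  is_derive t (1 : R) (fun s => phi (s, x)) (dt phi (t, x)).
Proof.
have e (h : R) : h *: ((1, 0) : R * (R * R)) + (0, x) = (h, x).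
  by congr pair => /=; [rewrite addr0 [_ *: _]mulr1|rewrite scaler0 add0r].
move=> tp; have := test_is_derive (1, 0) (t *: ((1, 0) : R * (R * R)) + (0, x)) tp.
move/is_derive_along => H; apply: (is_derive_eqfun H) => [h|]; first by rewrite e.
by rewrite e.
Qed.

Definition tcoef phi k t : R := fcoef (fun x => phi (t, x)) k.

Lemma sqsummable_slice phi t : test_spacetime phi -> sqsummable (fun x => phi (t, x)).
Proof. by move=> tp; apply/continuous_sqsummable/continuous_slice/test_continuous. Qed.

Lemma tcoef_dx j phi k t : test_spacetime phi ->
  tcoef (dx j phi) k t = - (kc j k * tcoef phi (- k) t).
Proof.
move=> tp; have cc : C1_dir j (@cas R k) (fun x => kc j k * cas (- k) x).
  split; [exact: periodic2_cas|exact: continuous_cas|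
    apply: continuousM2; [exact: continuous_cst2|exact: continuous_cas]|
    move=> x; exact: is_derive_cas].
have := int2_partial (C1_dirM (C1_slice j t tp) cc).
have Lp := sqsummable_slice t tp.
have S : summable2 (fun x => phi (t, x) * cas (- k) x) by exact: sqsummableM Lp (sqsummable_cas _).
rewrite int2D; last 2 first.
- exact: sqsummableM (sqsummable_slice t (test_dx j tp)) (sqsummable_cas _).
- rewrite (_ : (fun x => _) = (fun x => kc j k * (phi (t, x) * cas (- k) x))); first exact: summable2Z.
  by apply/funext => x; rewrite mulrCA.
move/eqP; rewrite addr_eq0 => /eqP E; rewrite {1}/tcoef /fcoef ipE E; congr (- _).
rewrite /tcoef /fcoef ipE -int2Z//; congr int2; apply/funext => x; exact: mulrCA.
Qed.

(** Bounds on the cell suffice because coefficients integrate over it; in time the bound is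
    global. *)
Definition Cbnd N phi (M : R) := forall s : seq (R * (R * R)), (size s <= N)%N ->
  {subset s <= spacetime_dirs} -> forall t x, cell x -> `|Defs.iterD s phi (t, x)| <= M.

Lemma Cbnd_le m n phi M : (m <= n)%N -> Cbnd n phi M -> Cbnd m phi M.
Proof. by move=> mn H s sm; apply: H; exact: leq_trans sm mn. Qed.

Lemma Cbnd_D N phi M v : v \in spacetime_dirs -> Cbnd N.+1 phi M -> Cbnd N (fun z => 'D_v phi z) M.
Proof.
move=> vd H s sN ss t x cx; rewrite -iterD_rcons; apply: H => //; first by rewrite size_rcons.
by move=> w; rewrite mem_rcons inE => /orP[/eqP ->|/ss].
Qed.

Lemma Cbnd_dx N j phi M : Cbnd N.+1 phi M -> Cbnd N (dx j phi) M.
Proof.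
apply: Cbnd_D; rewrite !inE; case: (ord2P j) => -> /=; first by rewrite eqxx orbT.
by rewrite (_ : lift ord0 ord0 = ord_max) ?eqxx ?orbT//; apply: val_inj.
Qed.

Lemma test_bounded phi : test_spacetime phi -> exists2 B, 0 <= B & forall t x, cell x -> `|phi (t, x)| <= B.
Proof.
move=> tp; have cf := test_continuous tp; have [_ _ [a [b [_ sab]]]] := tp.
have cK : compact (`[a, b]%classic `*` (`[0, 2 * pi]%classic `*` `[0, 2 * pi]%classic) : set (R * (R * R))).
  apply: compact_setX; first exact: segment_compact.
  by apply: compact_setX; exact: segment_compact.
have cfK : {within (`[a, b]%classic `*` (`[0, 2 * pi]%classic `*` `[0, 2 * pi]%classic) : set (R * (R * R))),
    continuous phi} by exact: continuous_subspaceT.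
have /compact_bounded [M [Mr HM]] := continuous_compact cfK cK.
exists (Num.max 0 (M + 1)); first by rewrite le_max lexx.
move=> t [x y] [/= ]; rewrite !in_itv /= => /andP[x0 /ltW x1] /andP[y0 /ltW y1].
have [tab|tab] := boolP (a <= t <= b); last by rewrite sab// normr0 le_max lexx.
have : `|phi (t, (x, y))| <= M + 1.
  apply: (HM (M + 1)); first by rewrite ltrDl.
  by exists (t, (x, y)) => //; split => /=; [rewrite in_itv|split; rewrite /= in_itv /= ?x0 ?y0].
by move=> /le_trans; apply; rewrite le_max lexx orbT.
Qed.

Lemma Cbnd_exists N phi : test_spacetime phi -> exists2 M, 0 <= M & Cbnd N phi M.
Proof.
elim: N phi => [|N IH] phi tp; have [B B0 phiB] := test_bounded tp.
  by exists B => // -[|//] _ _ t x cx; exact: phiB.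
have [M1 M10 H1] := IH _ (test_dt tp); have [M2 M20 H2] := IH _ (test_dx ord0 tp).
have [M3 M30 H3] := IH _ (test_dx ord_max tp).
exists (B + M1 + M2 + M3); first by rewrite !addr_ge0.
move=> s; case/lastP: s => [|s v] sN ss t x cx.
  by apply: le_trans (phiB _ _ cx) _; rewrite -!addrA lerDl !addr_ge0.
rewrite iterD_rcons; rewrite size_rcons ltnS in sN.
have ss' : {subset s <= spacetime_dirs} by move=> w ws; apply: ss; rewrite mem_rcons inE ws orbT.
have : v \in spacetime_dirs by apply: ss; rewrite mem_rcons inE eqxx.
rewrite !inE => /or3P[] /eqP ->.
- by apply: le_trans (H1 s sN ss' t x cx) _; lra.
- by apply: le_trans (H2 s sN ss' t x cx) _; lra.
- by apply: le_trans (H3 s sN ss' t x cx) _; lra.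
Qed.

Definition cst2 : R := 2 * (2 * pi) ^+ 2.

Lemma cst2_ge0 : 0 <= cst2. Proof. by rewrite mulr_ge0// sqr_ge0. Qed.

Lemma tcoef_le phi M k t : test_spacetime phi -> Cbnd 0 phi M -> `|tcoef phi k t| <= cst2 * M.
Proof.
move=> tp H; rewrite /tcoef /fcoef ipE; have Lp := sqsummable_slice t tp.
apply: le_trans (@le_normr_int2_bounded _ _ (M * 2) _ _) _.
- exact: sqsummableM Lp (sqsummable_cas _).
- move=> x cx; rewrite normrM; apply: ler_pM => //; last exact: cas_bound.
  by apply: (H [::]).
- by rewrite /cst2 le_eqVlt; apply/orP; left; apply/eqP; ring.
Qed.

(** [wt] has four terms, the costliest being k_1^2 k_2^2. Each square costs two derivatives, hence
    four further derivatives and a factor 4. *)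
Lemma decay_step (w : Z2 -> R) N C : (forall k, 0 <= w k) ->
  (forall phi M k t, test_spacetime phi -> Cbnd N phi M -> w k * `|tcoef phi k t| <= C * M) ->
  forall phi M k t, test_spacetime phi -> Cbnd N.+4 phi M ->
    wt k * w k * `|tcoef phi k t| <= 4 * C * M.
Proof.
move=> w0 H phi M k t tp B.
have d2 j psi : test_spacetime psi ->
    kc j k ^+ 2 * `|tcoef psi k t| = `|tcoef (dx j (dx j psi)) k t|.
  move=> tpsi; rewrite tcoef_dx ?tcoef_dx//; last exact: test_dx.
  by rewrite opprK kcN mulNr opprK normrN mulrA -expr2 normrM ger0_norm// sqr_ge0.
have t1 := test_dx ord0 (test_dx ord0 tp); have t2 := test_dx ord_max (test_dx ord_max tp).
have t3 := test_dx ord_max (test_dx ord_max t1).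
have B1 : Cbnd N.+2 (dx ord0 (dx ord0 phi)) M by do 2!apply: Cbnd_dx.
have B2 : Cbnd N.+2 (dx ord_max (dx ord_max phi)) M by do 2!apply: Cbnd_dx.
have B3 : Cbnd N (dx ord_max (dx ord_max (dx ord0 (dx ord0 phi)))) M by do 2!apply: Cbnd_dx.
have h0 := H _ M k t tp (Cbnd_le (leq_addr 4 N) (eq_rect _ (fun n => Cbnd n phi M) B _ (esym (addn4 N)))).
have h1 := H _ M k t t1 (Cbnd_le (leqW (leqnSn N)) B1).
have h2 := H _ M k t t2 (Cbnd_le (leqW (leqnSn N)) B2).
have h3 := H _ M k t t3 B3.
rewrite -(d2 _ _ tp) in h1; rewrite -(d2 _ _ tp) in h2.
rewrite -(d2 _ _ t1) -(d2 _ _ tp) in h3; rewrite wtE.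
move: h0 h1 h2 h3; move: (`|tcoef _ _ _|) (kc _ _ ^+ 2) (kc _ _ ^+ 2) => T x y ????; lra.
Qed.

(** Two decay steps: one factor [wt] absorbs the growth of the coefficients paired with [phi], the
    other makes the series summable. *)
Lemma tcoef_decay phi M k t : test_spacetime phi -> Cbnd 8 phi M ->
  wt k ^+ 2 * `|tcoef phi k t| <= 16 * cst2 * M.
Proof.
move=> tp B; have H0 : forall phi M k t, test_spacetime phi -> Cbnd 0 phi M ->
    1 * `|tcoef phi k t| <= cst2 * M by move=> ????? ?; rewrite mul1r; exact: tcoef_le.
have H1 := decay_step (w := fun=> 1) (fun=> ler01) H0.
have w0 k' : 0 <= wt k' * 1 :> R by rewrite mulr1 ltW// wt_gt0.
have := decay_step w0 H1 k t tp B.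
by rewrite mulr1 expr2; congr (_ <= _); ring.
Qed.

Lemma tcoef_le_wt phi : test_spacetime phi ->
  exists2 C, 0 <= C & forall k t, `|tcoef phi k t| <= C / wt k ^+ 2.
Proof.
move=> tp; have [M M0 B] := Cbnd_exists 8 tp; exists (16 * cst2 * M).
  by apply: mulr_ge0 => //; apply: mulr_ge0 cst2_ge0.
move=> k t; rewrite ler_pdivlMr ?exprn_gt0 ?wt_gt0// mulrC; exact: tcoef_decay.
Qed.

Lemma mvt_line (g G : R -> R) (s t : R) : (forall r : R, is_derive r (1 : R) g (G r)) ->
  exists2 r, `|r - s| <= `|t - s| & g t - g s = G r * (t - s).
Proof.
move=> dg; have cg : continuous g.
  by move=> r; apply: differentiable_continuous; apply/derivable1_diffP; case: (dg r).
have [st|/ltW ts] := leP s t.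
  have [r] := MVT_segment st (fun r _ => dg r) (continuous_subspaceT cg).
  rewrite in_itv /= => /andP[sr rt] E; exists r => //.
  by rewrite !ger0_norm ?subr_ge0// lerB.
have [r] := MVT_segment ts (fun r _ => dg r) (continuous_subspaceT cg).
rewrite in_itv /= => /andP[sr rt] E; exists r; last by rewrite -[LHS]opprB E; ring.
by rewrite !ler0_norm ?subr_le0// lerN2 lerB.
Qed.

Lemma is_derive_quadratic (a : R -> R) (d M t : R) :
  (forall h, `|a (h + t) - a t - h * d| <= M * h ^+ 2) -> is_derive t (1 : R) a d.
Proof.
move=> H; have M0 : 0 <= M by have := le_trans (normr_ge0 _) (H 1); rewrite expr1n mulr1.
have D : h^-1 *: ((a \o shift t) (h *: (1 : R)) - a t) @[h --> 0^'] --> d.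
  apply/cvgrPdist_le => e e0.
  have d0 : 0 < e / (M + 1) by rewrite divr_gt0// ltr_wpDl.
  near=> z; have zn : z != 0 by near: z; exact: nbhs_dnbhs_neq.
  have zd : `|z| < e / (M + 1) by near: z; apply: dnbhs0_lt.
  rewrite /= [z *: (1 : R)]mulr1.
  have -> : d - z^-1 *: (a (z + t) - a t) = - (z^-1 * (a (z + t) - a t - z * d)).
    by rewrite /GRing.scale /=; field.
  rewrite normrN normrM normfV -ler_pdivlMl ?invr_gt0 ?normr_gt0// invrK.
  apply: le_trans (H z) _; rewrite -real_normK ?num_real// expr2 mulrCA.
  apply: ler_wpM2l => //; apply: (@le_trans _ _ ((M + 1) * (e / (M + 1)))).
    by apply: ler_pM => //; [rewrite lerDl|exact: ltW].
  by rewrite mulrCA divff ?mulr1// gt_eqF// ltr_wpDl.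
have Dt : derivable a t 1 by apply/cvg_ex; exists d.
by split=> //; apply/cvg_lim.
Unshelve. all: by end_near.
Qed.

(** Differentiation under the integral by a quadratic remainder uniform in x: the mean value theorem
    is applied to [phi] and then to its time derivative. *)
Lemma is_derive_tcoef phi k t : test_spacetime phi ->
  is_derive t (1 : R) (tcoef phi k) (tcoef (dt phi) k t).
Proof.
move=> tp; have [M M0 B] := Cbnd_exists 0 (test_dt (test_dt tp)).
have dtp := test_dt tp.
apply: (@is_derive_quadratic _ _ (M * 2 * (2 * pi) ^+ 2)) => h.
have Lc := @sqsummable_cas R k.
have L1 := sqsummable_slice (h + t) tp; have L2 := sqsummable_slice t tp.
have L3 := sqsummableZ h (sqsummable_slice t dtp).
rewrite /tcoef /fcoef -ipZl//; last exact: sqsummable_slice.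
rewrite -ipBl// -ipBl//; last exact: sqsummableB.
rewrite ipE mulrAC; apply: le_trans (@le_normr_int2_bounded _ _ (M * h ^+ 2 * 2) _ _) _.
- by apply: sqsummableM => //; apply: sqsummableB => //; exact: sqsummableB.
- move=> x cx; rewrite normrM; apply: ler_pM => //; last exact: cas_bound.
  have [r rh E] := @mvt_line (fun s => phi (s, x)) (fun s => dt phi (s, x)) t (h + t)
    (fun s => is_derive_time s x tp).
  have [q qr E'] := @mvt_line (fun s => dt phi (s, x)) (fun s => dt (dt phi) (s, x)) t r
    (fun s => is_derive_time s x dtp).
  rewrite E addrK in rh *; rewrite mulrC -mulrBr E' normrM normrM.
  have Bq := B [::] isT (fun _ => ltac:(by [])) q x cx.
  have -> : M * h ^+ 2 = `|h| * (M * `|h|) by rewrite [RHS]mulrCA -expr2 real_normK ?num_real.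
  apply: ler_wpM2l => //.
  by apply: ler_pM.
- by rewrite le_eqVlt; apply/orP; left; apply/eqP; ring.
Qed.

Lemma continuous_tcoef phi k : test_spacetime phi -> continuous (tcoef phi k).
Proof.
move=> tp t; apply: differentiable_continuous; apply/derivable1_diffP.
by case: (is_derive_tcoef k t tp).
Qed.

Lemma tcoef_supp phi (a b : R) k t : supported_in a b phi -> ~~ (a <= t <= b) -> tcoef phi k t = 0.
Proof.
move=> sab tab; rewrite /tcoef /fcoef ipE (_ : (fun x => _) = cst 0) ?int2_cst ?mul0r//.
by apply/funext => x; rewrite sab// mul0r.
Qed.

End TestFunctions.

(** * Pairings mode by mode *)

Section TimeIntegral.
Context {R : realType}.

#[global] Instance lebesgue_ae_filter : Filter (almost_everywhere (@lebesgue_measure R)).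
Proof. exact: ae_filter_ringOfSetsType. Qed.

Implicit Types (g h : R -> R) (a b B : R).

Definition posR : set R := `]0, +oo[%classic.

Definition tint h : R := \int[lebesgue_measure]_(t in posR) h t.

Definition tsummable h := lebesgue_measure.-integrable posR (EFin \o h).

Lemma posRE t : posR t = (0 < t) :> Prop.
Proof. by rewrite /posR /= in_itv /= andbT. Qed.

Lemma measurable_posR : measurable (posR : set (measurableTypeR R)).
Proof. exact: measurable_itv. Qed.

Lemma tsummable_indic a b : tsummable (\1_`[a, b]).
Proof.
have := @integrable_indic_itv R a b true false.
by apply: integrableS => //; exact: measurable_posR.
Qed.

Lemma tsummableZ B h : tsummable h -> tsummable (fun t => B * h t).
Proof. exact: (integrableZl measurable_posR). Qed.

Lemma tsummableD g h : tsummable g -> tsummable h -> tsummable (fun t => g t + h t).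
Proof. exact: (integrableD measurable_posR). Qed.

Definition dominated_on a b B h := forall t, 0 < t -> `|h t| <= B * \1_(`[a, b]%classic) t.

Lemma tsummable_dominated a b B h : measurable_fun posR h -> dominated_on a b B h -> tsummable h.
Proof.
move=> mh hB; apply: (le_integrable measurable_posR _ _ (tsummableZ B (tsummable_indic a b))).
  exact/measurable_EFinP.
move=> t; rewrite posRE => t0 /=; rewrite lee_fin; apply: le_trans (hB t t0) (ler_norm _).
Qed.

Lemma tintZ B h : tsummable h -> tint (fun t => B * h t) = B * tint h.
Proof. exact: RintegralZl measurable_posR. Qed.

Lemma tintD g h : tsummable g -> tsummable h -> tint (fun t => g t + h t) = tint g + tint h.
Proof. exact: (RintegralD measurable_posR). Qed.

Lemma tint0 : tint (fun=> 0) = 0.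
Proof. by rewrite /tint Rintegral_cst ?mul0r//; exact: measurable_posR. Qed.

Lemma eq_tint g h : (forall t, 0 < t -> g t = h t) -> tint g = tint h.
Proof. by move=> gh; apply: eq_Rintegral => t; rewrite inE posRE => /gh. Qed.

Lemma tint_sum (I : Type) (s : seq I) (F : I -> R -> R) : (forall i, tsummable (F i)) ->
  tsummable (fun t => \sum_(i <- s) F i t) /\
  tint (fun t => \sum_(i <- s) F i t) = \sum_(i <- s) tint (F i).
Proof.
move=> IF; elim: s => [|i s [IH1 IH2]].
  rewrite big_nil (_ : (fun t => _) = (fun=> 0)); last by apply/funext => t; rewrite big_nil.
  split; last exact: tint0.
  have := tsummableZ 0 (tsummable_indic 0 0); congr (tsummable _).
  by apply/funext => t; rewrite mul0r.
rewrite big_cons -IH2 -tintD// (_ : (fun t => _) = (fun t => F i t + \sum_(j <- s) F j t)).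
  by split=> //; exact: tsummableD.
by apply/funext => t; rewrite big_cons.
Qed.

Lemma tint_dominated_le a b B h : measurable_fun posR h -> dominated_on a b B h ->
  `|tint h| <= B * tint (\1_(`[a, b]%classic)).
Proof.
move=> mh hB; have Ih := tsummable_dominated mh hB.
apply: le_trans (le_normr_Rintegral measurable_posR Ih) _.
rewrite -tintZ; last exact: tsummable_indic.
apply: (le_Rintegral measurable_posR).
- exact: integrable_norm Ih.
- exact: tsummableZ (tsummable_indic a b).
- by move=> t; rewrite posRE; exact: hB.
Qed.

Lemma tint_cvg a b B (g : nat -> R -> R) h : (forall n, measurable_fun posR (g n)) ->
  (forall n, dominated_on a b B (g n)) ->
  (forall t, 0 < t -> g n t @[n --> \oo] --> h t) ->
  tsummable h /\ tint (g n) @[n --> \oo] --> tint h.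
Proof.
move=> mg gB gh.
have mh : measurable_fun posR h.
  by apply: (measurable_fun_cvg mg) => t; rewrite posRE; exact: gh.
have hB : dominated_on a b B h.
  move=> t t0; apply: (ler_cvg_to (cvg_norm (gh t t0)) (cvg_cst _)).
  by apply: nearW => n; exact: gB.
have Ih := tsummable_dominated mh hB; split=> //; apply: fine_cvg.
rewrite (_ : (fine _)%:E = (\int[lebesgue_measure]_(t in posR) (h t)%:E)%E); last first.
  by rewrite fineK//; exact: (integrable_fin_num measurable_posR Ih).
apply: (@dominated_cvg _ _ _ lebesgue_measure _ measurable_posR _ _
  (fun t => (B * \1_(`[a, b]%classic) t)%:E)) => //.
- by move=> n; apply/measurable_EFinP; exact: mg.
- by move=> t; rewrite posRE => t0; apply: cvg_EFin; [exact: nearW|exact: gh].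
- exact: tsummableZ (tsummable_indic a b).
- by move=> n t; rewrite posRE => t0; rewrite /= lee_fin; exact: gB.
Qed.

Lemma tint_ae g h : measurable_fun posR g -> measurable_fun posR h ->
  {ae lebesgue_measure, forall t : R, 0 < t -> g t = h t} -> tint g = tint h.
Proof.
move=> mg mh gh; rewrite /tint /Rintegral; congr fine.
apply: (@ae_eq_integral _ _ _ lebesgue_measure posR) => //.
- exact: measurable_posR.
- exact/measurable_EFinP.
- exact/measurable_EFinP.
- by apply: filterS gh => t H; rewrite posRE => t0; rewrite H.
Qed.

Lemma tint_derive g h a b : 0 < a -> (forall t : R, 0 < t -> is_derive t (1 : R) g (h t)) ->
  (forall t : R, 0 < t -> {for t, continuous h}) ->
  (forall t, ~~ (a <= t <= b) -> g t = 0 /\ h t = 0) -> tint h = 0.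
Proof.
move=> a0 dg ch s0.
have c0 : 0 < a / 2 by rewrite divr_gt0.
(* Both a/2 and [d] lie outside [a, b] and are positive, so the antiderivative vanishes at both
   ends. *)
pose d := `|b| + a; have cd : a / 2 < d by rewrite /d; have := normr_ge0 b; lra.
have cI (t : R) : t \in `[a / 2, d] -> 0 < t by rewrite in_itv /= => /andP[/(lt_le_trans c0)].
rewrite /tint; transitivity (\int[lebesgue_measure]_(t in `[a / 2, d]) h t).
  rewrite -[in RHS](_ : posR `&` `[a / 2, d] = `[a / 2, d]%classic); last first.
    by apply/seteqP; split=> [t []//|t /= td]; split=> //; rewrite posRE; exact: cI.
  rewrite Rintegral_mkcondr; apply: eq_Rintegral => t _; rewrite patchE; case: ifPn => // td.
  apply: (proj2 (s0 t _)); apply: contra td => /andP[at' tb]; rewrite inE /= in_itv /=.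
  by apply/andP; split; [lra|apply: le_trans tb _; rewrite /d; have := ler_norm b; lra].
have cg (t : R) : 0 < t -> {for t, continuous g}.
  by move=> t0; apply: differentiable_continuous; apply/derivable1_diffP; case: (dg t t0).
rewrite /Rintegral (@continuous_FTC2 R h g _ _ cd).
- rewrite -EFinB /= (proj1 (s0 d _)); last by rewrite negb_and -!ltNge /d; apply/orP; right; have := ler_norm b; lra.
  by rewrite (proj1 (s0 (a / 2) _)) ?subrr// negb_and -!ltNge; apply/orP; left; lra.
- apply: continuous_in_subspaceT => t; rewrite inE => td; apply: ch; exact: cI.
- split.
  + by move=> t td; case: (dg t _) => //; apply: cI; exact: subset_itv_oo_cc td.
  + exact/cvg_at_right_filter/cg.
  + by apply/cvg_at_left_filter/cg; exact: lt_trans cd.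
- move=> t td; rewrite derive1E; have t0 := cI t (subset_itv_oo_cc td).
  by case: (dg t t0).
Qed.

End TimeIntegral.

Section Moments.
Context {R : realType}.
Implicit Types (phi : R * (R * R) -> R) (k : Z2) (c d : Z2 -> R -> R) (B : R).

Definition moment c phi k : R := tint (fun t => c k t * tcoef phi k t).

(** Growth like [wt] is what the decay wt^-2 of the test coefficients can absorb, leaving the
    summable wt^-1. *)
Definition coef_bounded c B := [/\ 0 <= B, (forall k, measurable_fun posR (c k)) &
  forall k t, 0 < t -> `|c k t| <= B * wt k].

Lemma moment_measurable c B phi k : coef_bounded c B -> test_spacetime phi ->
  measurable_fun posR (fun t => c k t * tcoef phi k t).
Proof.
move=> [_ mc _] tp; apply: measurable_funM; first exact: mc.
apply: (@measurable_funS _ _ _ _ setT) => //.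
by apply: continuous_measurable_fun; exact: continuous_tcoef.
Qed.

Lemma moment_dominated c B phi C a b k : coef_bounded c B -> supported_in a b phi ->
  (forall k t, `|tcoef phi k t| <= C / wt k ^+ 2) ->
  dominated_on a b (B * C / wt k) (fun t => c k t * tcoef phi k t).
Proof.
move=> [B0 _ cB] sab pC t t0; rewrite indicE; case: (boolP (t \in _)) => tab.
  rewrite mulr1 normrM; apply: le_trans (ler_pM (normr_ge0 _) (normr_ge0 _) (cB k t t0) (pC k t)) _.
  by rewrite le_eqVlt; apply/orP; left; apply/eqP; field; rewrite gt_eqF// wt_gt0.
rewrite (@tcoef_supp _ _ a b) ?mulr0 ?normr0//.
by apply: contra tab; rewrite inE /= in_itv.
Qed.

Lemma tsummable_moment c B phi k : coef_bounded c B -> test_spacetime phi ->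
  tsummable (fun t => c k t * tcoef phi k t).
Proof.
move=> cB tp; have [C C0 pC] := tcoef_le_wt tp; have [_ _ [a [b [_ sab]]]] := tp.
exact: tsummable_dominated (moment_measurable k cB tp) (moment_dominated k cB sab pC).
Qed.

Lemma moment_le c B phi C a b k : coef_bounded c B -> test_spacetime phi -> supported_in a b phi ->
  (forall k t, `|tcoef phi k t| <= C / wt k ^+ 2) ->
  `|moment c phi k| <= B * C * tint (\1_(`[a, b]%classic)) / wt k.
Proof.
move=> cB tp sab pC.
have := tint_dominated_le (moment_measurable k cB tp) (moment_dominated k cB sab pC).
by rewrite mulrAC.
Qed.

Definition pairsum c phi n : R := kap * \sum_(k <- box n) moment c phi k.

Lemma pairsum_opp c phi n : pairsum c phi n = kap * \sum_(k <- box n) moment c phi (- k).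
Proof. by rewrite (sum_box_opp n (moment c phi)). Qed.

Lemma pairsum_cvg c B phi : coef_bounded c B -> test_spacetime phi ->
  pairsum c phi n @[n --> \oo] --> limn (pairsum c phi).
Proof.
move=> cB tp; have [C C0 pC] := tcoef_le_wt tp; have [_ _ [a [b [_ sab]]]] := tp.
apply: is_cvgM; first exact: is_cvg_cst.
by apply: box_sum_cvg => k; exact: moment_le cB tp sab pC.
Qed.

Lemma pairing_cvg (f : R -> R * R -> R) c B phi : coef_bounded c B ->
  (forall t, 0 < t -> summable2 (f t)) ->
  (forall t k, 0 < t -> int2 (fun x => f t x * cas k x) = c k t) -> test_spacetime phi ->
  pairsum c phi n @[n --> \oo] --> pairing f phi.
Proof.
move=> cB If fc tp; have [C C0 pC] := tcoef_le_wt tp; have [_ _ [a [b [_ sab]]]] := tp.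
have [B0 _ _] := cB.
have Im k := tsummable_moment k cB tp.
pose g n t := kap * \sum_(k <- box n) c k t * tcoef phi k t.
have [_ H] : tsummable (fun t => int2 (fun x => f t x * phi (t, x))) /\
    tint (g n) @[n --> \oo] --> tint (fun t => int2 (fun x => f t x * phi (t, x))).
  apply: (@tint_cvg _ a b (kap * (25 * (B * C)))).
  - move=> n; apply: measurable_funM; first exact: measurable_cst.
    by apply: measurable_sum => k; exact: moment_measurable cB tp.
  - move=> n t t0; rewrite /g normrM (ger0_norm kap_ge0) -mulrA.
    apply: ler_wpM2l; first exact: kap_ge0.
    apply: le_trans (ler_norm_sum _ _ _) _.
    have -> : 25 * (B * C) * \1_(`[a, b]%classic) t = 25 * (B * C * \1_(`[a, b]%classic) t).
      by rewrite !mulrA.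
    apply: (box_sum_le (F := fun k => c k t * tcoef phi k t)) => k.
    apply: le_trans (moment_dominated k cB sab pC t0) _.
    by rewrite mulrAC.
  - move=> t t0; rewrite /g; under eq_fun => n.
      under eq_bigr => k _ do rewrite -fc// mulrC.
      over.
    apply: (int2_trig_cvg (C := C)); [exact: If|exact: sqsummable_slice|].
    move=> k; apply: le_trans (pC k t) _; rewrite ler_wpM2l// lef_pV2 ?posrE ?exprn_gt0 ?wt_gt0//.
    by rewrite expr2 ler_peMl ?wt_ge1// ltW// wt_gt0.
rewrite (_ : pairsum c phi = fun n => tint (g n)); first exact: H.
apply/funext => n; have [I1 I2] := tint_sum (box n) Im.
by rewrite /g tintZ// I2.
Qed.

Lemma tcoef_lin (r : R) phi psi k t : test_spacetime phi -> test_spacetime psi ->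
  tcoef (fun z => r * phi z + psi z) k t = r * tcoef phi k t + tcoef psi k t.
Proof.
move=> tp tq; have Lp := sqsummable_slice t tp; have Lq := sqsummable_slice t tq.
by rewrite /tcoef /fcoef ipDl ?ipZl//; [exact: sqsummable_cas|exact: sqsummableZ|exact: sqsummable_cas].
Qed.

(** The order is at most 8, the number of derivatives behind the decay wt^-2. *)
Lemma distribution_pairsum c B : coef_bounded c B -> Defs.distribution (fun phi => limn (pairsum c phi)).
Proof.
move=> cB; split=> [r phi psi tp tq|a b a0].
  apply/cvg_lim => //.
  rewrite (_ : pairsum c _ = fun n => r * pairsum c phi n + pairsum c psi n).
    by apply: cvgD; [apply: cvgM; [exact: cvg_cst|]|]; exact: pairsum_cvg cB _.
  apply/funext => n; rewrite /pairsum [X in X + _]mulrCA -mulrDr; congr (_ * _).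
  rewrite mulr_sumr -big_split; apply: eq_bigr => k _; have Ip := tsummable_moment k cB tp; have Iq := tsummable_moment k cB tq.
  rewrite /= /moment -tintZ// -tintD//; last exact: tsummableZ.
  by apply: eq_tint => t _; rewrite tcoef_lin// mulrDr mulrCA.
have [B0 _ _] := cB.
pose D := B * (16 * cst2) * tint (\1_(`[a, b]%classic)).
exists (kap * (25 * D)), 8 => phi M tp sab pM.
have CM : Cbnd 8 phi M by move=> s s8 ss t x _; exact: pM.
have pC k t : `|tcoef phi k t| <= 16 * cst2 * M / wt k ^+ 2.
  by rewrite ler_pdivlMr ?exprn_gt0 ?wt_gt0// mulrC; exact: tcoef_decay.
apply: (ler_cvg_to (cvg_norm (pairsum_cvg cB tp)) (cvg_cst _)); apply: nearW => n.
rewrite normrM (ger0_norm kap_ge0) -mulrA; apply: ler_wpM2l; first exact: kap_ge0.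
rewrite -mulrA; apply: le_trans (ler_norm_sum _ _ _) (box_sum_le n _) => k.
have := moment_le k cB tp sab pC; congr (_ <= _); rewrite /D; ring.
Qed.

End Moments.

(** * The weak solution *)

Section Assembly.
Context {R : realType}.
Variables (nu : R) (K : set (int * int)) (E M : R) (L : Z2 -> R).
Variables (v : R -> 'I_2 -> Z2 -> R) (u : R -> 'I_2 -> R * R -> R).
Hypothesis uv : forall (t : R) i, 0 <= t ->
  [/\ periodic2 (u t i), sqsummable (u t i) & fcoef (u t i) = v t i].
Hypothesis div_v : forall t : R, 0 <= t -> divfree (v t).
Hypothesis h1_v : forall (t : R) i n, 0 <= t -> h1sum n (v t i) <= E.
Hypothesis bsum_v : forall (t : R) i n, 0 <= t -> bsum n (v t i) <= M.
Hypothesis v_lip : forall i k (s t : R), 0 <= s -> 0 <= t -> `|v t i k - v s i k| <= L k * `|t - s|.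
Hypothesis v_derive : forall i k (t : R), 0 < t ->
  is_derive t (1 : R) (fun t => v t i k) (rhs nu K (u t) (v t) i k).
Implicit Types (phi : R * (R * R) -> R) (k : Z2) (i j : 'I_2).

Let M0 (s : R) : 0 <= Num.max 0 s. Proof. by rewrite le_max lexx. Qed.

Let Lu (t : R) i : 0 <= t -> sqsummable (u t i). Proof. by move=> /(@uv t i)[]. Qed.

Definition velocity_coef i k (t : R) : R := v (Num.max 0 t) i k.

Definition convect_coef i k (t : R) : R := convect (u (Num.max 0 t)) i k.

(* [tcoef_dx] carries the wave number [- k], whence the reflected arguments. *)
Definition pressure_coef k (t : R) : R :=
  \sum_(j < 2) kc j (- k) / ksq (- k) * convect_coef j (- k) t.

(** The indicator matches the convention that the field vanishes off [A i]. *)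
Definition dissipation_coef (A : 'I_2 -> set R) i k (t : R) : R :=
  \1_(A i) t * (- lam K k * velocity_coef i k t).

Lemma continuous_velocity_coef i k : continuous (velocity_coef i k).
Proof. exact: (@continuous_max0 _ (fun t => v t i k) _ (v_lip i k)). Qed.

Lemma continuous_convect_coef i k : continuous (convect_coef i k).
Proof.
move=> t; apply: convect_cvg.
- by move=> s j; exact: Lu.
- by move=> j; exact: Lu.
- move=> j; apply: (@cvg_nrm_coef _ (fun t => u t j) (fun t => v t j) L E).
  + by move=> s; exact: uv.
  + by move=> s n; exact: h1_v.
  + by move=> l; exact: v_lip.
Qed.

Lemma continuous_pressure_coef k : continuous (pressure_coef k).
Proof.
move=> t; apply: cvg_sum_seq => j; apply: cvgM; first exact: cvg_cst.
exact: continuous_convect_coef.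
Qed.

Let measurable_posR_continuous (f : R -> R) : continuous f -> measurable_fun posR f.
Proof.
by move=> cf; apply: (@measurable_funS _ _ _ _ setT) => //; exact: continuous_measurable_fun.
Qed.

Let M_ge0 : 0 <= M. Proof. exact: le_trans (bsum_ge0 0 _) (bsum_v ord0 0 (lexx 0)). Qed.

Lemma velocity_coef_le i k t : `|velocity_coef i k t| <= 1 + M.
Proof. by apply: coef_le => n; exact: bsum_v. Qed.

Lemma velocity_coef_bounded i : coef_bounded (velocity_coef i) (1 + M).
Proof.
split; [exact: addr_ge0|by move=> k; apply: measurable_posR_continuous; exact: continuous_velocity_coef|].
move=> k t _; apply: le_trans (velocity_coef_le i k t) _; rewrite ler_peMr ?wt_ge1//.
exact: addr_ge0.
Qed.

Lemma norm_le_sqr (x : R) : `|x| <= (1 + x ^+ 2) / 2.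
Proof. by rewrite -[x ^+ 2]real_normK ?num_real//; have := sqr_ge0 (`|x| - 1); nra. Qed.

Lemma convect_coef_le i k t : `|convect_coef i k t| <= 2 * (kap * M) * wt k.
Proof.
apply: le_trans (convect_le (A := kap * M) _ _ _ _) _.
- by move=> j; exact: Lu.
- move=> j; apply: parseval_le; first exact: Lu.
  by move=> n; have [_ _ ->] := uv j (M0 t); exact: bsum_v.
rewrite /convect_bound mulrC; apply: ler_wpM2l.
  by rewrite !mulr_ge0 ?kap_ge0.
have := mulr_ge0 (sqr_ge0 (kc ord0 k : R)) (sqr_ge0 (kc ord_max k : R)).
have := norm_le_sqr (kc ord0 k); have := norm_le_sqr (kc ord_max k).
have := sqr_ge0 (kc ord0 k : R); have := sqr_ge0 (kc ord_max k : R).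
by rewrite wtE; lra.
Qed.

Let Mk_ge0 : 0 <= 2 * (kap * M). Proof. by rewrite !mulr_ge0 ?kap_ge0. Qed.

Lemma convect_coef_bounded i : coef_bounded (convect_coef i) (2 * (kap * M)).
Proof.
split=> //; first by move=> k; apply: measurable_posR_continuous; exact: continuous_convect_coef.
by move=> k t _; exact: convect_coef_le.
Qed.

Lemma kc_ksq_le j k : `|kc j k / ksq k| <= 1 :> R.
Proof.
have [->|k0] := eqVneq k 0.
  by rewrite /ksq /= expr0n addr0 invr0 mulr0 normr0.
have s1 := @ksq0 R k k0; have s0 : 0 < ksq k :> R := lt_le_trans ltr01 s1.
rewrite normrM normfV (gtr0_norm s0) ler_pdivrMr// mul1r.
have : kc j k ^+ 2 <= ksq k :> R.
  by rewrite ksq_kc (bigD1 j)//= lerDl; apply: sumr_ge0 => i _; exact: sqr_ge0.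
by have := norm_le_sqr (kc j k); lra.
Qed.

Lemma pressure_coef_bounded : coef_bounded pressure_coef (2 * (2 * (kap * M))).
Proof.
split; [by rewrite mulr_ge0|by move=> k; apply: measurable_posR_continuous; exact: continuous_pressure_coef|].
move=> k t _; apply: le_trans (ler_norm_sum _ _ _) _.
apply: (@le_trans _ _ (\sum_(j < 2) 2 * (kap * M) * wt k)).
  apply: ler_sum => j _; rewrite normrM -[leRHS]mul1r; apply: ler_pM => //.
    exact: kc_ksq_le.
  by rewrite -[wt k]wtN; exact: convect_coef_le.
by rewrite sumr_const card_ord mulr2n; lra.
Qed.

Lemma dissipation_coef_bounded A i : measurable (A i) ->
  coef_bounded (dissipation_coef A i) (1 + M).
Proof.
move=> mA; split; first exact: addr_ge0.
- move=> k; apply: measurable_funM; first exact: measurable_indic.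
  apply: measurable_funM; first exact: measurable_cst.
  apply: measurable_posR_continuous; exact: continuous_velocity_coef.
move=> k t _; rewrite /dissipation_coef normrM.
apply: (@le_trans _ _ (1 * (wt k * (1 + M)))); last by rewrite mul1r mulrC.
apply: ler_pM => //; first by rewrite indicE; case: (_ \in _); rewrite ?normr1 ?normr0.
rewrite normrM normrN; apply: ler_pM => //; last exact: velocity_coef_le.
rewrite ger0_norm ?lam_ge0//; apply: le_trans (lam_le K k) _.
have -> : ksq k = kc ord0 k ^+ 2 + kc ord_max k ^+ 2 :> R by [].
have := mulr_ge0 (sqr_ge0 (kc ord0 k : R)) (sqr_ge0 (kc ord_max k : R)).
by rewrite wtE; lra.
Qed.

(** The part removed by the projection is a gradient, and its potential is the pressure of
    [pressure_coef]. *)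
Lemma sum_leray i k (N : 'I_2 -> R) :
  \sum_(j < 2) leray i j k * N j = N i - kc i k * \sum_(j < 2) kc j k / ksq k * N j.
Proof.
have -> : \sum_(j < 2) leray i j k * N j =
    \sum_(j < 2) (i == j)%:R * N j - \sum_(j < 2) kc i k * (kc j k / ksq k * N j).
  by rewrite -sumrB; apply: eq_bigr => j _; rewrite /leray mulrBl !mulrA.
rewrite -mulr_sumr (bigD1 i)//= eqxx mul1r big1 ?addr0// => j.
by rewrite eq_sym => /negbTE ->; rewrite mul0r.
Qed.

Lemma pressure_coef_rhs i k (t : R) : 0 <= t ->
  convect_coef i k t - kc i k * pressure_coef (- k) t + nu * lam K k * velocity_coef i k t =
  - rhs nu K (u t) (v t) i k.
Proof.
move=> t0; rewrite /rhs sum_leray /pressure_coef /convect_coef /velocity_coef opprK max_r//.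
ring.
Qed.

Section Testing.
Variables (phi : R * (R * R) -> R) (A : 'I_2 -> set R).
Hypothesis tphi : test_spacetime phi.
Hypothesis mA : forall i, measurable (A i).
Hypothesis aeA : forall i, {ae lebesgue_measure, forall t : R, 0 <= t -> A i t}.

(** The mode -k of d_i phi is k_i times the mode k of phi, so the pressure enters at -k. The sum of
    the integrands is then a total time derivative with compact support. *)
Lemma momentum_mode i k :
  - moment (velocity_coef i) (dt phi) k + moment (convect_coef i) phi k
  - moment pressure_coef (dx i phi) (- k) - nu * moment (dissipation_coef A i) phi k = 0.
Proof.
have tdt := test_dt tphi; have tdx := test_dx i tphi.
pose a := tcoef phi k; pose a' := tcoef (dt phi) k.
pose V := velocity_coef i k; pose N := convect_coef i k.
pose P := pressure_coef (- k); pose b := tcoef (dx i phi) (- k).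
have Va := velocity_coef_bounded i.
have I1 : tsummable (fun t => V t * a' t) by exact: tsummable_moment k Va tdt.
have I2 : tsummable (fun t => N t * a t) by exact: tsummable_moment k (convect_coef_bounded i) tphi.
have I3 : tsummable (fun t => P t * b t) by exact: tsummable_moment (- k) pressure_coef_bounded tdx.
have I4 : tsummable (fun t => V t * a t) by exact: tsummable_moment k Va tphi.
(* [A i] has full measure in the half-line, so its indicator drops out of the integral. *)
have Edis : moment (dissipation_coef A i) phi k = - lam K k * tint (fun t => V t * a t).
  rewrite -tintZ//; apply: tint_ae.
  - exact: moment_measurable (dissipation_coef_bounded (mA i)) tphi.
  - by have /measurable_EFinP := measurable_int _ (tsummableZ (- lam K k) I4).
  - have := aeA i; apply: filterS => t At t0.
    by rewrite /dissipation_coef indicE (_ : t \in A i) ?mul1r ?mulrA// inE; apply: At; exact: ltW.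
pose F t := -1 * (V t * a' t) + N t * a t + (-1 * (P t * b t) + nu * lam K k * (V t * a t)).
transitivity (tint F).
  rewrite tintD; [|apply: tsummableD => //; exact: tsummableZ|
    by apply: tsummableD; exact: tsummableZ].
  rewrite tintD//; last exact: tsummableZ.
  rewrite tintD; [|exact: tsummableZ|exact: tsummableZ].
  rewrite Edis !tintZ// -[moment _ (dt phi) k]/(tint (fun t => V t * a' t)).
  rewrite -[moment _ phi k]/(tint (fun t => N t * a t)).
  rewrite -[moment _ (dx i phi) (- k)]/(tint (fun t => P t * b t)).
  move: (tint (fun t => V t * a' t)) (tint (fun t => N t * a t)) (tint (fun t => P t * b t))
    (tint (fun t => V t * a t)) => x y z w; ring.
have [_ _ [al [be [al0 sphi]]]] := tphi.
have ca := @continuous_tcoef R phi k tphi; have ca' := @continuous_tcoef R _ k tdt.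
have cV : continuous V by exact: continuous_velocity_coef.
have cN : continuous N by exact: continuous_convect_coef.
have cP : continuous P by exact: continuous_pressure_coef.
have cb : continuous b by exact: continuous_tcoef.
have cM (f g : R -> R) : continuous f -> continuous g -> continuous (fun t => f t * g t).
  by move=> cf cg t; exact: cvgM (cf t) (cg t).
have cD (f g : R -> R) : continuous f -> continuous g -> continuous (fun t => f t + g t).
  by move=> cf cg t; exact: cvgD (cf t) (cg t).
have cc (r : R) : continuous (fun _ : R => r) by move=> t; exact: cvg_cst.
have cF : continuous F := cD _ _ (cD _ _ (cM _ _ (cc (-1)) (cM _ _ cV ca')) (cM _ _ cN ca))
  (cD _ _ (cM _ _ (cc (-1)) (cM _ _ cP cb)) (cM _ _ (cc (nu * lam K k)) (cM _ _ cV ca))).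
have bE t : b t = kc i k * a t by rewrite /b tcoef_dx// kcN opprK mulNr opprK.
(* By [pressure_coef_rhs] the factor of [a] in [F] is minus the time derivative of v, so [F] is the
   derivative of -v a. *)
apply: (@tint_derive _ (fun t => - (v t i k * a t)) F al be al0).
- move=> t t0; have dv := v_derive i k t0; have da := is_derive_tcoef k t tphi.
  apply: is_derive_eq.
  rewrite /F bE -/a' /GRing.scale /=.
  have := pressure_coef_rhs i k (ltW t0); rewrite -/V -/N -/P => E1.
  have E2 : rhs nu K (u t) (v t) i k = - (N t - kc i k * P t + nu * lam K k * V t) by rewrite E1 opprK.
  rewrite E2 (_ : v t i k = V t) -/a; last by rewrite /V /velocity_coef max_r// ltW.
  ring.
- move=> t _; exact: cF.
- move=> t tout; have a0 : a t = 0 by exact: tcoef_supp sphi tout.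
  have sdt : supported_in al be (dt phi) by exact: supported_D.
  have a'0 : a' t = 0 by exact: tcoef_supp sdt tout.
  by split; rewrite /F ?bE a0 ?a'0 !mulr0 ?oppr0 ?addr0.
Qed.

(** Since the boxes are symmetric, the pressure modes can be summed over -k, and the identity then
    holds mode by mode. *)
Lemma momentum_sum i n :
  - pairsum (velocity_coef i) (dt phi) n + pairsum (convect_coef i) phi n
  - pairsum pressure_coef (dx i phi) n - nu * pairsum (dissipation_coef A i) phi n = 0.
Proof.
have S (a b c d : Z2 -> R) : (forall k, - a k + b k - c k - nu * d k = 0) ->
    - (kap * \sum_(k <- box n) a k) + kap * (\sum_(k <- box n) b k)
    - kap * (\sum_(k <- box n) c k) - nu * (kap * \sum_(k <- box n) d k) = 0.
  move=> abcd; transitivity (kap * \sum_(k <- box n) (- a k + b k - c k - nu * d k)).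
    rewrite !sumrB big_split sumrN -mulr_sumr /=.
    move: (\sum_(k <- _) a k) (\sum_(k <- _) b k) (\sum_(k <- _) c k) (\sum_(k <- _) d k) => *; ring.
  by rewrite big1 ?mulr0.
rewrite (pairsum_opp pressure_coef); apply: S => k; exact: momentum_mode.
Qed.

Lemma divergence_sum n : \sum_(j < 2) pairsum (velocity_coef j) (dx j phi) n = 0.
Proof.
under eq_bigr => j _ do rewrite pairsum_opp.
rewrite -mulr_sumr exchange_big big1 ?mulr0//= => k _.
under eq_bigr => j _ do rewrite /moment.
have I j := tsummable_moment (- k) (velocity_coef_bounded j) (test_dx j tphi).
have [_ <-] := tint_sum (index_enum 'I_2) I.
rewrite -[RHS]tint0; apply: eq_tint => t t0.
under eq_bigr => j _ do rewrite tcoef_dx// opprK mulrN mulrA -mulNr.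
rewrite -mulr_suml sumrN; have := div_v (M0 t) (- k).
under eq_bigr => j _ do rewrite mulrC.
by move=> ->; rewrite oppr0 mul0r.
Qed.

(** The four pairings are limits of sums over the same boxes, and the combination of these sums
    vanishes for every n. *)
Lemma momentum_equation i (w y : R -> R * R -> R) (p : (R * (R * R) -> R) -> R) :
  pairsum pressure_coef (dx i phi) n @[n --> \oo] --> p (dx i phi) ->
  (forall t, 0 < t -> summable2 (w t)) ->
  (forall t k, 0 < t -> int2 (fun x => w t x * cas k x) = convect_coef i k t) ->
  (forall t, 0 < t -> sqsummable (y t)) ->
  (forall t k, 0 < t -> fcoef (y t) k = dissipation_coef A i k t) ->
  - pairing (fun t => u t i) (dt phi) + pairing w phi - p (dx i phi) - nu * pairing y phi = 0.
Proof.
move=> hp Iw wc Ly yc.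
have hu : pairsum (velocity_coef i) (dt phi) n @[n --> \oo] --> pairing (fun t => u t i) (dt phi).
  apply: (pairing_cvg (velocity_coef_bounded i)); last exact: test_dt.
    by move=> t t0; apply/summable2_sqsummable/Lu/ltW.
  move=> t k t0; have [_ _ E1] := uv i (ltW t0).
  by rewrite /velocity_coef max_r ?ltW// -E1.
have hw := pairing_cvg (convect_coef_bounded i) Iw wc tphi.
have hy : pairsum (dissipation_coef A i) phi n @[n --> \oo] --> pairing y phi.
  apply: (pairing_cvg (dissipation_coef_bounded (mA i))) => //.
  by move=> t t0; apply/summable2_sqsummable/Ly.
have lim4 (a b c d : nat -> R) (la lb lc ld : R) : a n @[n --> \oo] --> la ->
    b n @[n --> \oo] --> lb -> c n @[n --> \oo] --> lc -> d n @[n --> \oo] --> ld ->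
    - a n + b n - c n - nu * d n @[n --> \oo] --> - la + lb - lc - nu * ld.
  move=> ha hb hc hd; apply: cvgB; last by apply: cvgM; [exact: cvg_cst|].
  by apply: cvgB => //; apply: cvgD => //; exact: cvgN.
have H := lim4 _ _ _ _ _ _ _ _ hu hw hp hy.
apply/esym; apply: (cvg_unique _ _ H) => //; apply: cvg_near_cst; apply: nearW => n.
exact: momentum_sum.
Qed.

Lemma divergence_equation : \sum_(j < 2) pairing (fun t => u t j) (dx j phi) = 0.
Proof.
have H : \sum_(j < 2) pairsum (velocity_coef j) (dx j phi) n @[n --> \oo] -->
    \sum_(j < 2) pairing (fun t => u t j) (dx j phi).
  apply: cvg_sum_seq => j; apply: (pairing_cvg (velocity_coef_bounded j)); last exact: test_dx.
    by move=> t t0; apply/summable2_sqsummable/Lu/ltW.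
  move=> t k t0; have [_ _ E1] := uv j (ltW t0).
  by rewrite /velocity_coef max_r ?ltW// -E1.
apply/esym; apply: (cvg_unique _ _ H) => //; apply: cvg_near_cst; apply: nearW => n.
exact: divergence_sum.
Qed.

End Testing.

Hypothesis nu0 : 0 < nu.
Hypothesis symK : symmetricZ2 K.
Hypothesis v_dis : forall n, exists (delta : R -> R) (C : R),
  [/\ (forall t : R, 0 <= t -> 0 <= delta t <= E),
      (forall s t : R, 0 <= s -> 0 <= t -> `|delta t - delta s| <= C * `|t - s|) &
      (forall t : R, 0 < t -> is_derive t (1 : R) delta (dis nu K n (v t)))].

Lemma gradient_exists : exists Du : 'I_2 -> 'I_2 -> R -> R * R -> R,
  forall i j (t : R), 0 <= t -> [/\ periodic2 (Du i j t), sqsummable (Du i j t) &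
    fcoef (Du i j t) = dcoef j (v t i)].
Proof.
have ex i j (t : R) : {f : R * R -> R | [/\ periodic2 f, sqsummable f &
    forall k, fcoef f k = dcoef j (v (Num.max 0 t) i) k]}.
  apply: cid; apply: riesz_fischer_fcoef.
  by apply: (@square_summable_dcoef _ j _ E) => n; exact: h1_v.
exists (fun i j t => sval (ex i j t)) => i j t t0.
have [p1 p2 p3] := svalP (ex i j t); split=> //.
by apply/funext => k; rewrite p3 max_r.
Qed.

Lemma weak_solution_coef (u0 : 'I_2 -> R * R -> R) : (forall i, sqsummable (u0 i)) ->
  (forall i, fcoef (u0 i) = v 0 i) -> weak_solution nu K u0 u.
Proof.
move=> Lu0 u0v.
have [Du DuP] := gradient_exists.
have [Yu [A YuP]] := dissipation_field nu0 v_lip v_dis.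
have mA i : measurable (A i) by have [] := YuP i.
have aeA i : {ae lebesgue_measure, forall t : R, 0 <= t -> A i t} by have [] := YuP i.
split.
- move=> i; apply: (@in_C_L2_coef _ (fun t => u t i) (fun t => v t i) L E).
  + by move=> t; exact: uv.
  + by move=> t n; exact: h1_v.
  + by move=> k; exact: v_lip.
- move=> i; exists (kap * E); apply: aeW => t t0; have [_ Lt Et] := uv i t0.
  by apply: normHdot1sq_le => // n; rewrite Et; exact: h1_v.
- exists Du, Yu, (fun phi => limn (pairsum pressure_coef phi)); split.
  + apply: aeW => t t0 i j; have [p1 p2 p3] := DuP i j t t0; have [_ Lt Et] := uv i t0.
    by split; [exact: sqsummable_inL2|apply: weak_partial_fcoef => //; rewrite Et].
  + move=> i; have [Y1 Y2 _ Y4 Y5] := YuP i; split=> //.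
    apply: filterS Y4 => t At t0; have [_ Lt Et] := uv i t0.
    apply: is_YP => // k; rewrite Y5// Et (_ : t \in A i)// inE; exact: At.
  + exact: distribution_pairsum pressure_coef_bounded.
  + split=> [i phi tphi|phi tphi]; last exact: divergence_equation.
    have [_ Y2 _ _ Y5] := YuP i.
    apply: (@momentum_equation phi A tphi mA aeA i _ (Yu i) (fun phi => limn (pairsum pressure_coef phi))).
    * exact: pairsum_cvg pressure_coef_bounded (test_dx i tphi).
    * move=> t t0; apply: summable2_sum => j; apply: sqsummableM; first exact/Lu/ltW.
      by have [] := DuP i j t (ltW t0).
    * move=> t k t0; rewrite /convect_coef max_r ?ltW//.
      apply: (@convect_field _ (u t) (fun i j => Du i j t)).
      - by move=> j; exact/Lu/ltW.
      - by move=> l j; have [] := DuP l j t (ltW t0).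
      - by move=> l j; have [_ _ ->] := DuP l j t (ltW t0); have [_ _ ->] := uv l (ltW t0).
      - have := div_v (ltW t0); congr divfree; apply/funext => l.
        by have [_ _ ->] := uv l (ltW t0).
    * by move=> t t0; exact: Y2.
    * move=> t k t0; rewrite Y5 ?ltW// /dissipation_coef indicE /velocity_coef max_r ?ltW//.
      by case: (t \in A i); rewrite ?mul1r ?mul0r.
- move=> i; have [_ L0 E1] := uv i (lexx 0).
  by apply: fcoef_inj => // k; rewrite E1 u0v.
Qed.

End Assembly.

Theorem corollary2p1 (R : realType) (nu : R) (K : set (int * int))
    (u0 : 'I_2 -> R * R -> R) :
  0 < nu ->
  symmetricZ2 K ->
  (forall i, inH1 (u0 i)) ->
  div_free u0 ->
  exists u : R -> 'I_2 -> R * R -> R, weak_solution nu K u0 u.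
Proof.
move=> nu0 symK h1 divu0.
have Lu0 i : sqsummable (u0 i) by have [/inL2_sqsummable] := h1 i.
pose v0 i := fcoef (u0 i).
have div0 : divfree v0 by exact: divfree_fcoef.
have [E1 hE1] := inH1_h1sum (h1 ord0); have [E2 hE2] := inH1_h1sum (h1 ord_max).
have ens0 n : ens n v0 <= E1 + E2.
  have -> : ens n v0 = h1sum n (v0 ord0) + h1sum n (v0 ord_max).
    rewrite /h1sum -big_split; apply: eq_bigr => k _.
    rewrite /nsq big_ord_recl big_ord1 mulrDr (_ : lift ord0 ord0 = ord_max)//; exact: val_inj.
  exact: lerD.
have [v [u [uv [v00 divv] [ensv bsumv] vP disv]]] := @limit_solution _ nu K _ _ nu0 div0 ens0.
exists u; apply: (@weak_solution_coef _ nu K (E1 + E2 + 1) (mass v0 (E1 + E2))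
  (rhs_bound nu (kap * mass v0 (E1 + E2)) (mass v0 (E1 + E2))) v u) => //.
- by move=> t i n t0; apply: le_trans (h1sum_ens _ _ _) (ensv t n t0).
- by move=> t i n t0; exact: bsumv.
- by move=> i k; have [] := vP i k.
- by move=> i k; have [] := vP i k.
- by move=> i; rewrite v00.
Qed.
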